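(* Let $s,m,d\in\mathbb N$, $\alpha_0>1$, and $\alpha_i=\frac{s}{s-i}\alpha_0$ for $1\le i\le\lfloor\frac{s-1}{2}\rfloor$. Let $\{(\Xi_l^{(1)},\dots,\Xi_l^{(s)})\}_{l\in\mathbb Z}$ be i.i.d. zero-mean random matrices in $\mathbb R^{m\times s}$ (with columns $\Xi_l^{(r)}\in\mathbb R^m$) such that $E\big[\|\Xi_1^{(r)}\|_F^{s\vee2}\big]<\infty$ for all $1\le r\le s$ and $$\max_{\pi\in\mathcal P_s}\ \max_{0\le i\le\lfloor\frac{s-1}{2}\rfloor}\ \sup_{t\ge0}\ t^{\alpha_i}\,P\Big(\prod_{r\in\{\pi(1),\dots,\pi(s-i)\}}\|\Xi_1^{(r)}\|_F>t\Big)<\infty.$$ Moreover, let $\{(C_l^{(1)},\dots,C_l^{(s)})\}_{l\in\mathbb Z}$ be $s$-tuples of matrices in $\mathbb R^{d\times m}$ such that, for each $1\le r\le s$, $\sup_{l\in\mathbb Z}|l|^{\sigma_r}\|C_l^{(r)}\|_F<\infty$ for some $\sigma_r\in(\frac12,1]$. For $1\le r\le s$ and $k\in\mathbb Z$ define $X_k^{(r)}=\sum_{l=-\infty}^{\infty}C_{k-l}^{(r)}\Xi_l^{(r)}\in\mathbb R^d$. Then $$\lim_{n\to\infty}n^{-\frac1p}\sum_{k=1}^n\Big(\bigotimes_{r=1}^sX_k^{(r)}-E\Big[\bigotimes_{r=1}^sX_k^{(r)}\Big]\Big)=0\quad\text{a.s.}$$ for every $p$ satisfying $$0<p<\begin{cases}\dfrac{2}{3-2\sigma_1},&s=1,\\[2mm]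 2\wedge\alpha_0\wedge\dfrac{1}{2-\sigma_1-\sigma_2},&s=2,\\[2mm] \alpha_0\wedge\dfrac{2}{3-2\min_{1\le i\le s}\sigma_i},&s>2.\end{cases}$$
   Context: $\|A\|_F=\sqrt{\mathrm{trace}(A^TA)}$ is the Frobenius norm (the Euclidean norm for a vector). $\mathcal P_s$ is the set of permutations of $\{1,\dots,s\}$; $a\vee b=\max\{a,b\}$, $a\wedge b=\min\{a,b\}$. For $v^{(1)},\dots,v^{(s)}\in\mathbb R^d$ the tensor product $\bigotimes_{r=1}^sv^{(r)}\in\mathbb R^{d^s}$ is defined entrywise by $\big(\bigotimes_{r=1}^sv^{(r)}\big)_{i_1\dots i_s}=\prod_{r=1}^sv^{(r)}_{i_r}$, $1\le i_j\le d$. Convention: in an expression $a\wedge\frac1x$ with $a>0$ and $x=0$, $\frac1x$ is read as $+\infty$. Under the hypotheses the two-sided series defining $X_k^{(r)}$ converge almost surely. *)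

(* Defs.v *)
From HB Require Import structures.
From mathcomp Require Import all_boot all_order all_algebra perm finmap.
From mathcomp Require Import all_classical all_reals all_analysis.

Set Implicit Arguments.
Unset Strict Implicit.
Unset Printing Implicit Defensive.

Import Order.TTheory GRing.Theory Num.Theory.
Import numFieldNormedType.Exports.

Local Open Scope classical_set_scope.
Local Open Scope ring_scope.

Definition frobenius (R : realType) (m n : nat) (A : 'M[R]_(m, n)) : R :=
  Num.sqrt (\tr (A^T *m A)).

(* The product (= Borel) sigma-algebra on matrices: it is generated by the
   coordinate maps. *)
Definition mx_measurable (R : realType) (m n : nat) : set (set 'M[R]_(m, n)) :=
  <<s [set A | exists i j (B : set R), measurable B /\
                 A = [set M : 'M[R]_(m, n) | B (M i j)]] >>.

Definition random_mx d (T : measurableType d) (R : realType) (m n : nat)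
    (Y : T -> 'M[R]_(m, n)) : Prop :=
  forall i j, measurable_fun [set: T] (fun w => Y w i j).

Definition independent_mx d (T : measurableType d) (R : realType)
    (P : probability T R) (I : choiceType) (m n : nat)
    (Y : I -> T -> 'M[R]_(m, n)) : Prop :=
  forall (J : {fset I}) (A : I -> set 'M[R]_(m, n)),
    (forall l, l \in J -> mx_measurable (A l)) ->
    P (\bigcap_(l in [set` J]) (Y l @^-1` A l)) =
    (\prod_(l <- J) P (Y l @^-1` A l))%E.

Definition identically_distributed_mx d (T : measurableType d) (R : realType)
    (P : probability T R) (I : choiceType) (m n : nat)
    (Y : I -> T -> 'M[R]_(m, n)) : Prop :=
  forall (l l' : I) (A : set 'M[R]_(m, n)),
    mx_measurable A -> P (Y l @^-1` A) = P (Y l' @^-1` A).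

Definition iid_mx d (T : measurableType d) (R : realType)
    (P : probability T R) (I : choiceType) (m n : nat)
    (Y : I -> T -> 'M[R]_(m, n)) : Prop :=
  [/\ forall l, random_mx (Y l), independent_mx P Y &
      identically_distributed_mx P Y].

(* The sum over all l in Z; a two-sided series converges when both of its
   halves (l >= 0 and l < 0) do. *)
Definition seriesZ (R : realType) (V : normedModType R) (f : int -> V) : V :=
  limn (fun n => \sum_(0 <= l < n) f l%:Z) +
  limn (fun n => \sum_(0 <= l < n) f (- (l.+1)%:Z)).

Definition linear_process (T : Type) (R : realType) (d m s : nat)
    (C : int -> 'I_s -> 'M[R]_(d, m)) (Xi : int -> T -> 'M[R]_(m, s))
    (k : int) (r : 'I_s) (w : T) : 'cV[R]_d :=
  seriesZ (fun l : int => C (k - l) r *m col r (Xi l w)).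

(* Elements of R^(d^s) are indexed by the multi-indices (i_1, ..., i_s). *)
Definition tensor (R : realType) (d s : nat) (v : 'I_s -> 'cV[R]_d)
    (i : {ffun 'I_s -> 'I_d}) : R :=
  \prod_(r < s) v r (i r) 0.

(* The strict upper bound for p.  The indices sigma_1, ..., sigma_s are
   0, ..., s - 1 here.  In [\bar R] the inverse of 0 is +oo, which is the
   convention wanted for sigma_1 = sigma_2 = 1.  The initial value 1 of the
   minimum is immaterial because every sigma_i is at most 1.  The case s = 0
   is junk. *)
Definition rate_bound (R : realType) (s : nat) (alpha0 : R) :
    ('I_s -> R) -> \bar R :=
  match s return ('I_s -> R) -> \bar R with
  | 0 => fun=> 0%E
  | 1 => fun sigma => (2 / (3 - 2 * sigma ord0))%:E
  | 2 => fun sigma =>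
      mine (mine 2%:E alpha0%:E) ((2 - sigma ord0 - sigma ord_max)%:E^-1)%E
  | s'.+3 => fun sigma =>
      mine alpha0%:E
        (2 / (3 - 2 * \big[Num.min/1]_(i < s'.+3) sigma i))%:E
  end.

(* Main.v *)
(** Only finitely many innovations [Xi_l] are used at first.  Expanding the product
    over [r] of the sums over [l], each [l] serves a set [D] of factors, and reading
    the [l]'s one by one gives a linear recursion with independent coefficients.
    Let [N^D] be the product of the norms of the columns in [D].  If
    [2 |D| <= max (s, 2)] then [N^D] is square integrable and the coefficient is left
    alone.  Any other [D] contains more than half of the factors, so a term has at
    most one of these; its coefficient is truncated at a level [M] and split into its
    mean, its centred part and its tail.  For [p < al < 2], and [al < alpha_0] if [s > 1]:
    - the terms without centred part have covariances [O (|k - k'|^-b)] uniformly in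
      [M], where [b] is determined by the [sigma_r] alone;
    - the terms with a centred part have variance [O (n M^(2 - al))] over [n] times;
    - the terms with a tail have first moment [O (M^(1 - al))].
    On the times up to [2^j] take [M = 2^(j / al)].  Chaining over dyadic blocks bounds
    the maximum of the normalised sums in a truncated L2 sense by a geometric sequence
    in [j].  Uniform integrability and Fatou's lemma then allow all innovations. *)

Require Import Defs.
From HB Require Import structures.
From mathcomp Require Import all_boot all_order all_algebra perm finmap.
From mathcomp Require Import all_classical all_reals all_analysis.
From mathcomp Require Import measurable_realfun.
From mathcomp Require Import zify ring lra.

Set Implicit Arguments.
Unset Strict Implicit.
Unset Printing Implicit Defensive.

Import Order.TTheory GRing.Theory Num.Theory.
Import numFieldNormedType.Exports.

Local Open Scope classical_set_scope.
Local Open Scope ring_scope.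

(** * Expectations and independence *)

(** The weights [|h|^-sigma] are not summable since [sigma <= 1]; only their squares are, by
    [sigma > 1/2]. Every estimate therefore needs two weights at each [l]. Singletons are the only
    coefficients of first order, and their means vanish; larger sets carry a squared weight, and
    nonempty sets at two times [k] and [k'] carry one weight each. Hence the second moments follow a
    deterministic linear system that differs from the identity by summable coefficients, and
    Gronwall bounds them uniformly in the window. Light and heavy mirror the hypotheses on the
    innovations: the moment of order [max (s, 2)] makes light products square integrable, and a
    heavy set has [s - i] elements with [i <= (s - 1) / 2], so the tail condition gives its moments
    of order below [alpha_0]. In general [b] lies just below [2 sigma - 1], with [sigma] the least
    exponent: the decay of the overlap of the weights at [k] and [k']. For [s = 2] only the full set
    is heavy, its coefficient without centred part is a constant, and only steps serving one factor
    at each time correlate. Two overlaps multiply, and [b] rises to just below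
    [2 (sigma_1 + sigma_2) - 2]. *)

Section expectation.
Context d (T : measurableType d) (R : realType) (P : probability T R).
Implicit Types (f g h : T -> R).

Definition L1 f := P.-integrable setT (EFin \o f).
Definition Ex f : R := \int[P]_x f x.

Lemma L1P f : L1 f <->
  measurable_fun setT f /\ (\int[P]_x `|f x|%:E < +oo)%E.
Proof.
split=> [/integrableP[mf fi]|[mf fi]]; first by split; [exact/measurable_EFinP|].
by apply/integrableP; split => //; exact/measurable_EFinP.
Qed.

Lemma L1_measurable f : L1 f -> measurable_fun setT f.
Proof. by case/L1P. Qed.

Lemma L1_integral f : L1 f -> (\int[P]_x (f x)%:E = (Ex f)%:E)%E.
Proof. by move=> Lf; rewrite /Ex /Rintegral fineK//; exact: integrable_fin_num. Qed.

Lemma Ex_integral f (r : R) : (\int[P]_x (f x)%:E = r%:E)%E -> Ex f = r.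
Proof. by rewrite /Ex /Rintegral => ->. Qed.

Lemma eq_Ex f g : f =1 g -> Ex f = Ex g.
Proof. by move/funext ->. Qed.

Lemma L1_le f g : measurable_fun setT f -> L1 g ->
  (forall x, `|f x| <= g x) -> L1 f.
Proof.
move=> mf Lg fg; apply: le_integrable Lg => //; first exact/measurable_EFinP.
by move=> x _ /=; rewrite lee_fin (le_trans (fg x))// ler_norm.
Qed.

Lemma L1_cst (c : R) : L1 (fun=> c).
Proof. exact: finite_measure_integrable_cst. Qed.

Lemma Ex_cst (c : R) : Ex (fun=> c) = c.
Proof. by rewrite /Ex Rintegral_cst// [X in fine X]probability_setT mulr1. Qed.

Lemma L1D f g : L1 f -> L1 g -> L1 (fun x => f x + g x).
Proof. by move=> Lf Lg; exact: (integrableD measurableT Lf Lg). Qed.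

Lemma ExD f g : L1 f -> L1 g -> Ex (fun x => f x + g x) = Ex f + Ex g.
Proof. by move=> Lf Lg; exact: RintegralD. Qed.

Lemma L1Z (c : R) f : L1 f -> L1 (fun x => c * f x).
Proof. by move=> Lf; exact: (integrableZl measurableT c Lf). Qed.

Lemma ExZ (c : R) f : L1 f -> Ex (fun x => c * f x) = c * Ex f.
Proof. by move=> Lf; exact: RintegralZl. Qed.

Lemma L1N f : L1 f -> L1 (fun x => - f x).
Proof. by move=> Lf; exact: (integrableN Lf). Qed.

Lemma L1B f g : L1 f -> L1 g -> L1 (fun x => f x - g x).
Proof. by move=> Lf Lg; apply: L1D => //; exact: L1N. Qed.

Lemma ExB f g : L1 f -> L1 g -> Ex (fun x => f x - g x) = Ex f - Ex g.
Proof. by move=> Lf Lg; exact: RintegralB. Qed.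

Lemma L1_sum (I : Type) (s : seq I) (Q : pred I) (F : I -> T -> R) :
  (forall i, L1 (F i)) -> L1 (fun x => \sum_(i <- s | Q i) F i x).
Proof.
move=> LF; elim: s => [|i s IH].
  by under eq_fun do rewrite big_nil; exact: L1_cst.
under eq_fun do rewrite big_cons; case: (Q i) => //.
exact: L1D.
Qed.

Lemma Ex_sum (I : Type) (s : seq I) (Q : pred I) (F : I -> T -> R) :
  (forall i, L1 (F i)) ->
  Ex (fun x => \sum_(i <- s | Q i) F i x) = \sum_(i <- s | Q i) Ex (F i).
Proof.
move=> LF; elim: s => [|i s IH].
  by under eq_Ex do rewrite big_nil; rewrite Ex_cst big_nil.
under eq_Ex do rewrite big_cons; rewrite big_cons; case: (Q i) => //.
by rewrite ExD ?IH//; exact: L1_sum.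
Qed.

Lemma Ex_ge0 f : (forall x, 0 <= f x) -> 0 <= Ex f.
Proof. by move=> f0; apply: Rintegral_ge0. Qed.

Lemma Ex_le f g : L1 f -> L1 g -> (forall x, f x <= g x) -> Ex f <= Ex g.
Proof. by move=> Lf Lg fg; apply: le_Rintegral. Qed.

Lemma L1_norm f : L1 f -> L1 (fun x => `|f x|).
Proof. exact: integrable_norm. Qed.

Lemma Ex_norm f : L1 f -> `|Ex f| <= Ex (fun x => `|f x|).
Proof. by move=> Lf; apply: le_normr_Rintegral. Qed.

Lemma L1_ge0 f : measurable_fun setT f -> (forall x, 0 <= f x) ->
  (\int[P]_x (f x)%:E < +oo)%E -> L1 f.
Proof.
move=> mf f0 fi; apply/L1P; split => //.
by under eq_integral do rewrite ger0_norm//.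
Qed.

Lemma L1_sqr_mul f g : measurable_fun setT f -> measurable_fun setT g ->
  L1 (fun x => f x ^+ 2) -> L1 (fun x => g x ^+ 2) -> L1 (fun x => f x * g x).
Proof.
move=> mf mg Lf Lg; apply: (@L1_le _ (fun x => f x ^+ 2 + g x ^+ 2)).
- exact: measurable_funM.
- exact: L1D.
move=> x; have := sqr_ge0 (`|f x| - `|g x|); rewrite normrM.
rewrite -(real_normK (num_real (f x))) -(real_normK (num_real (g x))).
by move: (normr_ge0 (f x)) (normr_ge0 (g x)); nra.
Qed.

Lemma L1_sqr f : measurable_fun setT f -> L1 (fun x => f x ^+ 2) -> L1 f.
Proof.
move=> mf Lf; apply: (@L1_le _ (fun x => 1 + f x ^+ 2)) => //.
  by apply: L1D => //; exact: L1_cst.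
move=> x; have := sqr_ge0 (`|f x| - 1); rewrite -(real_normK (num_real (f x))).
by move: (normr_ge0 (f x)); nra.
Qed.

End expectation.
Arguments Ex_cst {d T R} P c.
Arguments L1_cst {d T R} P c.

(** * Factoring one independent coordinate out of an expectation *)

Section independence_step.
Context d (T : measurableType d) (R : realType) (P : probability T R).
Context d' (E : measurableType d') (z : T -> E) (mz : measurable_fun setT z).
Implicit Types (f g h X : T -> R) (phi : E -> R) (A : set E).

Import HBNNSimple.

Lemma measurable_indic_comp A : measurable A ->
  measurable_fun setT (fun w => \1_A (z w) : R).
Proof.
by move=> mA; apply: (measurableT_comp (f := \1_A : E -> R)) => //.
Qed.

Lemma L1_indic_mul A X : measurable A -> L1 P X ->
  L1 P (fun w => \1_A (z w) * X w).
Proof.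
move=> mA LX; apply: (L1_le _ (L1_norm LX)).
  by apply: measurable_funM; [exact: measurable_indic_comp|exact: L1_measurable LX].
move=> x; rewrite normrM indicE; case: (_ \in _); rewrite ?normr1 ?normr0 ?mul1r ?mul0r//.
Qed.

Lemma L1_indic A : measurable A -> L1 P (fun w => \1_A (z w) : R).
Proof.
move=> mA; apply: (L1_le _ (L1_cst P 1)); first exact: measurable_indic_comp.
by move=> w; rewrite indicE; case: (_ \in _); rewrite ?normr1 ?normr0.
Qed.

(** A simple function is a finite combination of indicators of its level sets, so the hypothesis on
    indicators extends by linearity. *)
Lemma nnsfun_step (f : {nnsfun E >-> R}) X : L1 P X ->
  (forall A, measurable A ->
     Ex P (fun w => \1_A (z w) * X w) = Ex P (fun w => \1_A (z w)) * Ex P X) ->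
  [/\ L1 P (fun w => f (z w) * X w), L1 P (fun w => f (z w)) &
  Ex P (fun w => f (z w) * X w) = Ex P (fun w => f (z w)) * Ex P X].
Proof.
move=> LX HX.
have fE x : f x = \sum_(k <- fset_set (range f)) k * \1_(f @^-1` [set k]) x.
  by rewrite fimfunE fsbig_finite//=; exact: fimfunP.
have mA k : measurable (f @^-1` [set k]) by exact: measurable_sfunP.
have L1k k : L1 P (fun w => k * \1_(f @^-1` [set k]) (z w)).
  exact: (L1Z k (L1_indic (mA k))).
have -> : (fun w => f (z w)) = (fun w => \sum_(k <- fset_set (range f)) k * \1_(f @^-1` [set k]) (z w)).
  by apply/funext => w; rewrite fE.
have -> : (fun w => f (z w) * X w) = (fun w => \sum_(k <- fset_set (range f)) k * (\1_(f @^-1` [set k]) (z w) * X w)).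
  by apply/funext => w; rewrite fE mulr_suml; apply: eq_bigr => k _; rewrite mulrA.
split.
- by apply: L1_sum => k; apply: L1Z; exact: L1_indic_mul.
- by apply: L1_sum => k; exact: L1k.
rewrite !Ex_sum//; last by move=> k; apply: L1Z; exact: L1_indic_mul.
rewrite mulr_suml; apply: eq_bigr => k _.
rewrite ExZ; last exact: L1_indic_mul.
by rewrite HX// mulrA; congr (_ * _); rewrite ExZ//; exact: L1_indic.
Qed.

(** Approximation of [phi] from below by simple functions: monotone convergence carries the
    factorisation to the limit. Integrability of the product is a result of this, because the
    product of the two expectations is finite. *)
Lemma indep_step_ge0 phi X : measurable_fun setT phi -> (forall x, 0 <= phi x) ->
  L1 P (fun w => phi (z w)) -> L1 P X -> (forall w, 0 <= X w) ->
  (forall A, measurable A ->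
     Ex P (fun w => \1_A (z w) * X w) = Ex P (fun w => \1_A (z w)) * Ex P X) ->
  L1 P (fun w => phi (z w) * X w) /\
  Ex P (fun w => phi (z w) * X w) = Ex P (fun w => phi (z w)) * Ex P X.
Proof.
move=> mphi phi0 Lphi LX X0 HX.
have mphi' : measurable_fun setT (EFin \o phi) by exact/measurable_EFinP.
pose f_ := nnsfun_approx measurableT mphi'.
have fcvg x : (f_ n x)%:E @[n --> \oo] --> (phi x)%:E.
  by apply: cvg_nnsfun_approx => // y _; rewrite lee_fin.
have fnd x : {homo (fun n => (f_ n x)%:E) : m n / (m <= n)%N >-> (m <= n)%E}.
  by move=> m n mn; rewrite lee_fin; exact/lefP/nd_nnsfun_approx.
have mX := L1_measurable LX.
have mfz n : measurable_fun setT (fun w => f_ n (z w)) by exact: measurableT_comp.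
have E1 : (\int[P]_w (phi (z w) * X w)%:E = limn (fun n => \int[P]_w (f_ n (z w) * X w)%:E))%E.
  rewrite -monotone_convergence//.
  - apply: eq_integral => w _; apply/esym/cvg_lim => //.
    rewrite EFinM (_ : (fun n => _) = (fun n => (f_ n (z w))%:E * (X w)%:E)%E); last first.
      by apply/funext => n; rewrite EFinM.
    by apply: cvgeZr => //; exact: fcvg.
  - by move=> n; apply/measurable_EFinP/measurable_funM.
  - by move=> n w _; rewrite lee_fin mulr_ge0.
  - move=> w _ m n mn; rewrite lee_fin ler_wpM2r//.
    by have := fnd (z w) _ _ mn; rewrite lee_fin.
have E2 : (\int[P]_w (f_ n (z w))%:E @[n --> \oo] --> \int[P]_w (phi (z w))%:E)%E.
  have -> : (\int[P]_w (phi (z w))%:E = \int[P]_w limn (fun n => (f_ n (z w))%:E))%E.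
    by apply: eq_integral => w _; apply/esym/cvg_lim => //; exact: fcvg.
  apply: cvg_monotone_convergence => //.
  - by move=> n; exact/measurable_EFinP.
  - by move=> n w _; rewrite lee_fin.
have E3 : (\int[P]_w (phi (z w) * X w)%:E = (Ex P (fun w => phi (z w)) * Ex P X)%:E)%E.
  rewrite E1 EFinM -!L1_integral//; apply/cvg_lim => //.
  rewrite (_ : (fun n => _) = (fun n => (\int[P]_w (f_ n (z w))%:E * \int[P]_w (X w)%:E)%E)).
    by apply: cvgeZr => //; exact: integrable_fin_num.
  apply/funext => n.
  have [La Lb Eab] := nnsfun_step (f_ n) LX HX.
  by rewrite !L1_integral// Eab EFinM.
split; last exact: Ex_integral.
apply: L1_ge0 => //.
- by apply: measurable_funM => //; exact: measurableT_comp.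
- by move=> w; rewrite mulr_ge0.
- by rewrite E3 ltry.
Qed.

End independence_step.

Lemma normrD_ge0 (R : realDomainType) (x : R) : 0 <= `|x| + x.
Proof. by have := ler_norm (- x); rewrite normrN; lra. Qed.

(** * Expectations of products over an i.i.d. family *)

Section iid_family.
Context d (T : measurableType d) (R : realType) (P : probability T R).
Context d' (E : measurableType d') (Z : int -> T -> E).

Record iid_family : Prop := IIDFamily {
  iid_measurable : forall l, measurable_fun setT (Z l);
  iid_indep : forall (ls : seq int) (A : int -> set E), uniq ls ->
    (forall l, measurable (A l)) ->
    (P (\bigcap_(l in [set` ls]) (Z l @^-1` A l)) =
     \prod_(l <- ls) P (Z l @^-1` A l))%E;
  iid_distr : forall l l' (A : set E), measurable A ->
    P (Z l @^-1` A) = P (Z l' @^-1` A) }.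

Hypothesis iidZ : iid_family.

Let mZ l : measurable_fun setT (Z l). Proof. exact: iid_measurable. Qed.

Definition Lz (phi : E -> R) :=
  measurable_fun setT phi /\ L1 P (fun w => phi (Z 0 w)).

Definition Mu (phi : E -> R) : R := Ex P (fun w => phi (Z 0 w)).

(** Both sides are integrals against the laws of [Z l] and [Z 0], which agree on measurable sets. *)
Lemma iid_integral_ge0 l (phi : E -> \bar R) : measurable_fun setT phi ->
  (forall x, 0 <= phi x)%E ->
  (\int[P]_w phi (Z l w) = \int[P]_w phi (Z 0 w))%E.
Proof.
move=> mphi phi0.
pose mk l : {mfun T >-> E} := HB.pack (Z l) (isMeasurableFun.Build _ _ _ _ (Z l) (mZ l)).
have H k : (\int[P]_w phi (Z k w) = \int[pushforward P (mk k)]_y phi y)%E.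
  rewrite ge0_integral_pushforward//.
rewrite !H; apply: eq_measure_integral => A mA _ /=.
exact: iid_distr.
Qed.

Lemma Lz_L1 l phi : Lz phi -> L1 P (fun w => phi (Z l w)).
Proof.
case=> mphi /L1P[_ fi]; apply/L1P; split; first exact: measurableT_comp.
rewrite (iid_integral_ge0 l (phi := fun x => `|phi x|%:E))//.
by apply/measurable_EFinP; exact: measurableT_comp.
Qed.

Lemma Ex_Mu l phi : Lz phi -> Ex P (fun w => phi (Z l w)) = Mu phi.
Proof.
move=> Lphi; have [mphi _] := Lphi.
(* The transfer between indices holds for nonnegative functions, so [phi] is written as
   [|phi| + phi] minus [|phi|]. *)
have H k : Ex P (fun w => phi (Z k w)) =
    Ex P (fun w => `|phi (Z k w)| + phi (Z k w)) - Ex P (fun w => `|phi (Z k w)|).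
  rewrite -ExB; last 2 first.
  - by apply: L1D; [exact/L1_norm/Lz_L1|exact: Lz_L1].
  - exact/L1_norm/Lz_L1.
  by apply: eq_Ex => w; rewrite addrAC subrr add0r.
rewrite /Mu !H; congr (fine _ - fine _).
  apply: (iid_integral_ge0 l (phi := fun x => (`|phi x| + phi x)%:E)).
    by apply/measurable_EFinP/measurable_funD => //; exact: measurableT_comp.
  by move=> x; rewrite lee_fin normrD_ge0.
apply: (iid_integral_ge0 l (phi := fun x => `|phi x|%:E)) => //.
by apply/measurable_EFinP; exact: measurableT_comp.
Qed.

Definition prodZ (ls : seq int) (phi : int -> E -> R) (w : T) : R :=
  \prod_(l <- ls) phi l (Z l w).

Lemma prodZ_cons l ls phi w :
  prodZ (l :: ls) phi w = phi l (Z l w) * prodZ ls phi w.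
Proof. by rewrite /prodZ big_cons. Qed.

Lemma prodZ_nil phi w : prodZ [::] phi w = 1.
Proof. by rewrite /prodZ big_nil. Qed.

Definition upd (phi : int -> E -> R) l psi : int -> E -> R :=
  fun k => if k == l then psi else phi k.

Lemma prodZ_upd ls phi l psi w : l \notin ls ->
  prodZ (l :: ls) (upd phi l psi) w = psi (Z l w) * prodZ ls phi w.
Proof.
move=> lls; rewrite prodZ_cons /upd eqxx; congr (_ * _).
by apply: eq_big_seq => k kls; case: eqP => // kl; rewrite -kl kls in lls.
Qed.

Lemma prod_upd ls phi l psi (F : (E -> R) -> R) : l \notin ls ->
  \prod_(k <- l :: ls) F (upd phi l psi k) = F psi * \prod_(k <- ls) F (phi k).
Proof.
move=> lls; rewrite big_cons /upd eqxx; congr (_ * _).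
by apply: eq_big_seq => k kls; case: eqP => // kl; rewrite -kl kls in lls.
Qed.

Lemma Ex_prodZ_indic ls (A : int -> set E) : uniq ls ->
  (forall l, measurable (A l)) ->
  L1 P (prodZ ls (fun l => \1_(A l))) /\
  Ex P (prodZ ls (fun l => \1_(A l))) = \prod_(l <- ls) Mu (\1_(A l)).
Proof.
move=> uls mA.
have mI : measurable (\bigcap_(l in [set` ls]) (Z l @^-1` A l)).
  rewrite bigcap_seq; elim: ls {uls} => [|l ls IH].
    by rewrite big_nil; exact: measurableT.
  by rewrite big_cons; apply: measurableI => //; rewrite -[X in measurable X]setTI; exact: mZ.
have -> : prodZ ls (fun l => \1_(A l)) =
    (\1_(\bigcap_(l in [set` ls]) (Z l @^-1` A l)) : T -> R).
  apply/funext => w; rewrite bigcap_seq {uls mI}; elim: ls => [|l ls IH].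
    by rewrite prodZ_nil big_nil indicT.
  by rewrite prodZ_cons IH big_cons indicI.
split.
  by apply/integrableP; split; [exact/measurable_EFinP/measurable_indic|
     under eq_integral do rewrite gee0_abs ?lee_fin//;
     rewrite integral_indic// setIT (le_lt_trans (probability_le1 _ _))// ltry].
apply: Ex_integral; rewrite integral_indic// setIT.
have := iid_indep iidZ uls mA => /= ->.
rewrite -prodEFin; apply: eq_bigr => l _.
rewrite (iid_distr iidZ l 0)//.
rewrite -[LHS]fineK ?fin_num_measure//; last by rewrite -[X in measurable X]setTI; exact: mZ.
congr (EFin _).
rewrite /Mu /Ex /Rintegral; congr fine.
have -> : (fun w => (\1_(A l) (Z 0 w))%:E) = (fun w => (\1_(Z 0 @^-1` A l) w)%:E :> \bar R) by [].
by rewrite integral_indic ?setIT// -[X in measurable X]setTI; exact: mZ.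
Qed.

Lemma Lz_indic A : measurable A -> Lz (\1_A).
Proof.
move=> mA; split; first exact: measurable_indic.
exact: (L1_indic _ (mZ 0)).
Qed.

(** The indices in [pre] carry general functions already, those in [suf] still indicators. In the
    induction on [pre], its head [l] is first moved to [suf] with an arbitrary indicator, where the
    induction hypothesis factors; [indep_step_ge0] then replaces that indicator by [phi l]. *)
Lemma Ex_prodZ_ge0 pre suf phi (A : int -> set E) : uniq (pre ++ suf) ->
  (forall l, Lz (phi l)) -> (forall l x, 0 <= phi l x) ->
  (forall l, measurable (A l)) ->
  L1 P (fun w => prodZ pre phi w * prodZ suf (fun l => \1_(A l)) w) /\
  Ex P (fun w => prodZ pre phi w * prodZ suf (fun l => \1_(A l)) w) =
  (\prod_(l <- pre) Mu (phi l)) * \prod_(l <- suf) Mu (\1_(A l)).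
Proof.
move=> + Lphi phi0; elim: pre suf A => [|l pre IH] suf A us mA.
  under [X in L1 _ X]eq_fun do rewrite prodZ_nil mul1r.
  under [X in Ex _ X]eq_fun do rewrite prodZ_nil mul1r.
  by rewrite big_nil mul1r; exact: Ex_prodZ_indic.
have us' : uniq (pre ++ suf) by case/andP : us.
have us2 : uniq (pre ++ l :: suf) by rewrite -(cat1s l suf) uniq_catCA.
have lsuf : l \notin suf by move: us; rewrite /= mem_cat negb_or => /andP[/andP[]].
have [LX EX] := IH _ _ us' mA.
pose X w := prodZ pre phi w * prodZ suf (fun l => \1_(A l)) w.
have X0 w : 0 <= X w by apply: mulr_ge0; apply: prodr_ge0.
have HX B : measurable B ->
   Ex P (fun w => \1_B (Z l w) * X w) = Ex P (fun w => \1_B (Z l w)) * Ex P X.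
  move=> mB; pose A' k := if k == l then B else A k.
  have mA' k : measurable (A' k) by rewrite /A'; case: ifP.
  have [_ H] := IH _ _ us2 mA'.
  have AE : (fun k => \1_(A' k)) = upd (fun k => \1_(A k)) l \1_B :> (int -> E -> R).
    by apply/funext => k; rewrite /A' /upd; case: ifP.
  have -> : (fun w => \1_B (Z l w) * X w) =
            (fun w => prodZ pre phi w * prodZ (l :: suf) (fun k => \1_(A' k)) w).
    apply/funext => w; rewrite AE.
    by rewrite [X in _ = _ * X]prodZ_upd// mulrCA.
  rewrite H (Ex_Mu _ (Lz_indic mB)) EX mulrCA; congr (_ * _).
  rewrite -(prod_upd (fun k => \1_(A k)) \1_B Mu lsuf).
  by apply: eq_bigr => k _; rewrite -AE.
have [mphil _] := Lphi l.
have [] := indep_step_ge0 (mZ l) mphil (phi0 l) (Lz_L1 l (Lphi l)) LX X0 HX.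
under [X in L1 _ X]eq_fun do rewrite /X mulrA -prodZ_cons.
under [X in Ex _ X]eq_fun do rewrite /X mulrA -prodZ_cons.
move=> L1' ->; split => //.
by rewrite EX big_cons -mulrA (Ex_Mu _ (Lphi l)).
Qed.

(** The same exchange between two lists, now with nonnegative functions in [suf] and signed ones in
    [pre]: the positive part [p] and the negative part [n] of [phi l] can each be moved to [suf]. *)
Lemma prodZ_signed pre suf phi psi : uniq (pre ++ suf) ->
  (forall l, Lz (phi l)) -> (forall l, Lz (psi l)) ->
  (forall l x, 0 <= psi l x) ->
  L1 P (fun w => prodZ pre phi w * prodZ suf psi w) /\
  Ex P (fun w => prodZ pre phi w * prodZ suf psi w) =
  (\prod_(l <- pre) Mu (phi l)) * \prod_(l <- suf) Mu (psi l).
Proof.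
move=> + Lphi; elim: pre suf psi => [|l pre IH] suf psi us Lpsi psi0.
  have us0 : uniq (suf ++ [::]) by rewrite cats0.
  have [] := Ex_prodZ_ge0 us0 Lpsi psi0 (fun=> measurableT).
  under [X in L1 _ X]eq_fun do rewrite prodZ_nil mulr1.
  under [X in Ex _ X]eq_fun do rewrite prodZ_nil mulr1.
  under [X in _ -> _ -> L1 _ X /\ _]eq_fun do rewrite prodZ_nil mul1r.
  under [X in _ -> _ -> _ /\ Ex _ X = _]eq_fun do rewrite prodZ_nil mul1r.
  by move=> ? ->; rewrite !big_nil mul1r mulr1.
have us2 : uniq (pre ++ l :: suf) by rewrite -(cat1s l suf) uniq_catCA.
have lsuf : l \notin suf by move: us; rewrite /= mem_cat negb_or => /andP[/andP[]].
have [ml Ll] := Lphi l.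
pose p x : R := (`|phi l x| + phi l x) / 2.
pose n x : R := (`|phi l x| - phi l x) / 2.
have Lp : Lz p.
  split; first by apply: measurable_funM => //; apply: measurable_funD => //; exact: measurableT_comp.
  rewrite (_ : (fun _ => _) = fun w => 2^-1 * (`|phi l (Z 0 w)| + phi l (Z 0 w))).
    by apply: L1Z; apply: L1D => //; exact: L1_norm.
  by apply/funext => w; rewrite mulrC.
have Ln : Lz n.
  split; first by apply: measurable_funM => //; apply: measurable_funB => //; exact: measurableT_comp.
  rewrite (_ : (fun _ => _) = fun w => 2^-1 * (`|phi l (Z 0 w)| - phi l (Z 0 w))).
    by apply: L1Z; apply: L1B => //; exact: L1_norm.
  by apply/funext => w; rewrite mulrC.
have p0 x : 0 <= p x.
  by rewrite /p mulr_ge0// normrD_ge0.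
have n0 x : 0 <= n x.
  by rewrite /n mulr_ge0// subr_ge0 ler_norm.
have Lupd q : Lz q -> forall k, Lz (upd psi l q k).
  by move=> Lq k; rewrite /upd; case: ifP.
have upd0 q : (forall x, 0 <= q x) -> forall k x, 0 <= upd psi l q k x.
  by move=> Lq k; rewrite /upd; case: ifP.
have [L1' E1] := IH _ _ us2 (Lupd _ Lp) (upd0 _ p0).
have [L2 E2] := IH _ _ us2 (Lupd _ Ln) (upd0 _ n0).
have -> : (fun w => prodZ (l :: pre) phi w * prodZ suf psi w) =
  (fun w => prodZ pre phi w * prodZ (l :: suf) (upd psi l p) w -
            prodZ pre phi w * prodZ (l :: suf) (upd psi l n) w).
  apply/funext => w; rewrite !prodZ_upd// prodZ_cons /p /n; lra.
split; first exact: L1B.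
rewrite ExB// E1 E2 !prod_upd// big_cons.
have -> : Mu (phi l) = Mu p - Mu n.
  rewrite /Mu -ExB; [|by case: Lp|by case: Ln].
  by apply: eq_Ex => w; rewrite /p /n; lra.
by ring.
Qed.

Lemma prodZP ls phi : uniq ls -> (forall l, Lz (phi l)) ->
  L1 P (prodZ ls phi) /\ Ex P (prodZ ls phi) = \prod_(l <- ls) Mu (phi l).
Proof.
move=> uls Lphi; have us0 : uniq (ls ++ [::]) by rewrite cats0.
have [] := prodZ_signed us0 Lphi (fun=> Lz_indic measurableT) (fun _ _ => ler0n _ _).
under [X in L1 _ X]eq_fun do rewrite prodZ_nil mulr1.
under [X in Ex _ X]eq_fun do rewrite prodZ_nil mulr1.
by move=> ? ->; rewrite big_nil mulr1.
Qed.

End iid_family.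

Section independence_calculus.
Context d (T : measurableType d) (R : realType) (P : probability T R).
Context d' (E : measurableType d') (Z : int -> T -> E).
Hypothesis iidZ : iid_family P Z.
Implicit Types (f g : T -> R) (phi : E -> R) (ls : seq int).

Local Notation Lz := (@Lz _ T R P _ E Z).
Local Notation Mu := (@Mu _ T R P _ E Z).

(* [f] behaves as if it were a function of the [Z l], [l] in [ls], only. *)
Definition ind ls f := forall ls2 (phi : int -> E -> R), uniq ls2 ->
  (forall l, l \in ls2 -> l \notin ls) -> (forall l, Lz (phi l)) ->
  L1 P (fun w => f w * prodZ Z ls2 phi w) /\
  Ex P (fun w => f w * prodZ Z ls2 phi w) = Ex P f * \prod_(l <- ls2) Mu (phi l).

Lemma Lz_cst (c : R) : Lz (fun=> c).
Proof. by split; [exact: measurable_cst|exact: L1_cst]. Qed.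

Lemma ind_L1 ls f : ind ls f -> L1 P f.
Proof.
move=> /(_ [::] (fun _ _ => 0) erefl (fun l => ltac:(by [])) (fun=> Lz_cst 0))[+ _].
by under eq_fun do rewrite prodZ_nil mulr1.
Qed.

Lemma ind_cst ls c : ind ls (fun=> c).
Proof.
move=> ls2 phi uls _ Lphi; have [L1' E1] := prodZP iidZ uls Lphi.
by split; [exact: L1Z|rewrite ExZ// Ex_cst E1].
Qed.

Lemma ind_D ls f g : ind ls f -> ind ls g -> ind ls (fun w => f w + g w).
Proof.
move=> If Ig ls2 phi uls dls Lphi.
have [L1' E1] := If _ _ uls dls Lphi.
have [L2' E2] := Ig _ _ uls dls Lphi.
under [X in L1 _ X]eq_fun do rewrite mulrDl.
under [X in Ex _ X = _]eq_fun do rewrite mulrDl.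
split; first exact: L1D.
by rewrite (ExD L1' L2') E1 E2 (ExD (ind_L1 If) (ind_L1 Ig)) mulrDl.
Qed.

Lemma ind0 ls : ind ls (fun=> 0).
Proof.
move=> ls2 phi uls dls Lphi.
under [X in L1 _ X]eq_fun do rewrite mul0r.
under [X in Ex _ X = _]eq_fun do rewrite mul0r.
by rewrite Ex_cst mul0r; split => //; exact: L1_cst.
Qed.

Lemma ind_sum (I : Type) ls (s : seq I) (Q : pred I) (F : I -> T -> R) :
  (forall i, ind ls (F i)) -> ind ls (fun w => \sum_(i <- s | Q i) F i w).
Proof.
move=> IF; elim: s => [|i s IH].
  by under eq_fun do rewrite big_nil; exact: ind0.
under eq_fun do rewrite big_cons; case: (Q i) => //.
exact: ind_D.
Qed.

(** The factor at the fresh index [l] is absorbed into the test product by [upd], so the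
    independence of [f] already contains the claim; the empty test product gives the expectation. *)
Lemma ind_cons ls l phi f : l \notin ls -> ind ls f -> Lz phi ->
  ind (l :: ls) (fun w => phi (Z l w) * f w) /\
  Ex P (fun w => phi (Z l w) * f w) = Mu phi * Ex P f.
Proof.
move=> lls If Lphi.
have H ls2 (psi : int -> E -> R) : uniq ls2 ->
    (forall k, k \in ls2 -> k \notin l :: ls) -> (forall k, Lz (psi k)) ->
    L1 P (fun w => phi (Z l w) * f w * prodZ Z ls2 psi w) /\
    Ex P (fun w => phi (Z l w) * f w * prodZ Z ls2 psi w) =
    Ex P f * Mu phi * \prod_(k <- ls2) Mu (psi k).
  move=> uls dls Lpsi.
  have lls2 : l \notin ls2 by apply/negP => /dls; rewrite inE eqxx.
  have us : uniq (l :: ls2) by rewrite /= lls2.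
  have ds k : k \in l :: ls2 -> k \notin ls.
    by rewrite inE => /predU1P[->//|/dls]; rewrite inE negb_or => /andP[].
  have Lu k : Lz (upd psi l phi k) by rewrite /upd; case: ifP.
  have [] := If _ _ us ds Lu.
  rewrite prod_upd// mulrA.
  have -> : (fun w => f w * prodZ Z (l :: ls2) (upd psi l phi) w) =
    (fun w => phi (Z l w) * f w * prodZ Z ls2 psi w).
    by apply/funext => w; rewrite prodZ_upd// mulrA (mulrC (f w)).
  by [].
have E0 : Ex P (fun w => phi (Z l w) * f w) = Mu phi * Ex P f.
  have [_] := H [::] (fun _ _ => 0) erefl (fun l => ltac:(by [])) (fun=> Lz_cst 0).
  under eq_Ex do rewrite prodZ_nil mulr1.
  by rewrite big_nil mulr1 mulrC.
split => // ls2 psi uls dls Lpsi; rewrite E0 (mulrC (Mu phi)).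
exact: H.
Qed.

End independence_calculus.

(** * Second moments of a random linear recursion *)

Section linear_system.
Context d (T : measurableType d) (R : realType) (P : probability T R).
Context d' (E : measurableType d') (Z : int -> T -> E).
Hypothesis iidZ : iid_family P Z.
Local Notation Lz := (@Lz _ T R P _ E Z).
Local Notation Mu := (@Mu _ T R P _ E Z).
Variables (J : finType) (G : int -> J -> J -> E -> R) (x0 : J -> R).

(** [k] is the time of observation and [l] the index of an innovation; only the lag [k - l] selects
    the coefficient matrix. The order of the list is arbitrary. *)
Fixpoint lin (k : int) (ls : seq int) (j : J) (w : T) : R :=
  if ls is l :: ls' then \sum_j' G (k - l) j j' (Z l w) * lin k ls' j' w
  else x0 j.

Definition M2 k k' ls j i := Ex P (fun w => lin k ls j w * lin k' ls i w).

Hypothesis LG : forall h h' j j' i i', Lz (fun x => G h j j' x * G h' i i' x).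

Lemma lin_ind k k' ls j i : uniq ls ->
  ind P Z ls (fun w => lin k ls j w * lin k' ls i w).
Proof.
elim: ls j i => [|l ls IH] j i /=; first by move=> _; exact: ind_cst.
move=> /andP[lls uls].
rewrite (_ : (fun w => _) = fun w => \sum_j' \sum_i'
   (G (k - l) j j' (Z l w) * G (k' - l) i i' (Z l w)) * (lin k ls j' w * lin k' ls i' w)).
  apply: ind_sum => j'; apply: ind_sum => i'.
  by have [] := ind_cons lls (IH j' i' uls) (LG (k - l) (k' - l) j j' i i').
apply/funext => w; rewrite mulr_suml; apply: eq_bigr => j' _.
by rewrite mulr_sumr; apply: eq_bigr => i' _; ring.
Qed.

(** The coefficients at [l] are independent of the solutions over [ls], even jointly for two times,
    so the mixed moments satisfy a deterministic linear system. *)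
Lemma M2_cons k k' l ls j i : uniq (l :: ls) ->
  M2 k k' (l :: ls) j i = \sum_j' \sum_i'
     Mu (fun x => G (k - l) j j' x * G (k' - l) i i' x) * M2 k k' ls j' i'.
Proof.
move=> /= /andP[lls uls].
rewrite /M2 (_ : (fun w => _) = fun w => \sum_j' \sum_i'
   (G (k - l) j j' (Z l w) * G (k' - l) i i' (Z l w)) * (lin k ls j' w * lin k' ls i' w)); last first.
  apply/funext => w /=; rewrite mulr_suml; apply: eq_bigr => j' _.
  by rewrite mulr_sumr; apply: eq_bigr => i' _; ring.
have H j' i' := ind_cons lls (lin_ind k k' j' i' uls) (LG (k - l) (k' - l) j j' i i').
rewrite Ex_sum; last first.
  by move=> j'; apply: L1_sum => i'; have [/ind_L1] := H j' i'.
apply: eq_bigr => j' _; rewrite Ex_sum; last first.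
  by move=> i'; have [/ind_L1] := H j' i'.
by apply: eq_bigr => i' _; have [_] := H j' i'.
Qed.

End linear_system.

(** * A discrete Gronwall inequality *)

Lemma gronwall_step (R : realFieldType) (e f S S0 N X D : R) :
  1 <= e -> 1 <= f -> 0 <= N * D -> S <= f * (S0 + N * X) ->
  e * S + N * D <= e * f * (S0 + N * (X + D)).
Proof.
move=> e1 f1 ND SX.
have -> : e * f * (S0 + N * (X + D)) = e * (f * (S0 + N * X)) + e * f * (N * D) by ring.
rewrite lerD//; first by rewrite ler_wpM2l// (le_trans ler01).
by rewrite ler_peMl// -[leLHS]mulr1 ler_pM.
Qed.

Section gronwall.
Context (R : realType) (J : finType) (F : seq int -> J -> R).
Variables (a : int -> R) (Bd : seq int -> R).
Hypothesis a_ge0 : forall l, 0 <= a l.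
Hypothesis Bd_mono : forall l ls, uniq (l :: ls) -> Bd ls <= Bd (l :: ls).
Hypothesis step : forall l ls j, uniq (l :: ls) ->
  `|F (l :: ls) j| <=
  `|F ls j| + a l * \sum_i `|F ls i| + (Bd (l :: ls) - Bd ls).

(** Summed over [j], one step multiplies the l1 norm by at most
    [1 + #|J| * a l <= expR (#|J| * a l)], while the source increments of [Bd] telescope. Only the
    sum of the [a l] enters, so a bound for it makes the estimate uniform in the length of the
    list. *)
Lemma gronwall ls : uniq ls ->
  \sum_j `|F ls j| <= expR (#|J|%:R * \sum_(l <- ls) a l) *
    (\sum_j `|F [::] j| + #|J|%:R * (Bd ls - Bd [::])).
Proof.
elim: ls => [_|l ls IH uls]; first by rewrite big_nil mulr0 expR0 subrr mulr0 addr0 mul1r.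
have uls' : uniq ls by case/andP : uls.
have {}IH := IH uls'.
set S := \sum_j `|F ls j| in IH *; set S0 := \sum_j `|F [::] j| in IH *.
set N := #|J|%:R in IH *; set D := Bd (l :: ls) - Bd ls.
have N0 : 0 <= N by exact: ler0n.
have D0 : 0 <= D by rewrite subr_ge0 Bd_mono.
have S1 : \sum_j `|F (l :: ls) j| <= (1 + N * a l) * S + N * D.
  apply: le_trans (ler_sum _ (fun j _ => step j uls)) _.
  rewrite big_split/= big_split/= -/S -/D !sumr_const.
  rewrite -[(a l * S) *+ _]mulr_natl -[D *+ _]mulr_natl.
  by rewrite mulrDl mul1r mulrA.
rewrite big_cons (mulrDr N (a l)) expRD.
have e1 : 1 + N * a l <= expR (N * a l) by exact: expR_ge1Dx.
have e0 : 1 <= expR (N * a l).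
  by rewrite -expR0 ler_expR mulr_ge0.
have e2 : 1 <= expR (N * \sum_(l <- ls) a l).
  by rewrite -expR0 ler_expR mulr_ge0// sumr_ge0.
have S_ge0 : 0 <= S by apply: sumr_ge0.
apply: (le_trans S1); apply: (@le_trans _ _ (expR (N * a l) * S + N * D)).
  by rewrite lerD2r ler_wpM2r.
rewrite (_ : Bd (l :: ls) - Bd [::] = (Bd ls - Bd [::]) + D); last by rewrite /D; ring.
by apply: gronwall_step => //; exact: mulr_ge0.
Qed.

End gronwall.

Section subset_recursion.
Context (R : realType) (s : nat).
Notation I := {set 'I_s}.
Variables (F : seq int -> I * I -> R) (q : int -> I -> I -> R).
Variables (S : int -> seq int -> I * I -> R) (a : int -> R) (Bd : seq int -> R).
Hypothesis F_cons : forall l ls (AB : I * I), uniq (l :: ls) -> F (l :: ls) AB =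
  \sum_(A : I | A \subset AB.1) \sum_(B : I | B \subset AB.2)
     q l (AB.1 :\: A) (AB.2 :\: B) * F ls (A, B) + S l ls AB.
Hypothesis q0 : forall l, q l finset.set0 finset.set0 = 1.
Hypothesis qa : forall l D D', (D, D') != (finset.set0, finset.set0) -> `|q l D D'| <= a l.
Hypothesis a_ge0 : forall l, 0 <= a l.
Hypothesis SB : forall l ls AB, uniq (l :: ls) ->
  `|S l ls AB| <= Bd (l :: ls) - Bd ls.

(** The term that removes nothing from either set has coefficient 1 and acts as the identity; all
    others are perturbations of size [a l]. *)
Lemma subset_recursion ls : uniq ls ->
  \sum_AB `|F ls AB| <= expR (#|{: I * I}|%:R * \sum_(l <- ls) a l) *
    (\sum_AB `|F [::] AB| + #|{: I * I}|%:R * (Bd ls - Bd [::])).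
Proof.
apply: gronwall => // [l ls' u|l ls' [A B] u].
  by rewrite -subr_ge0 (le_trans _ (SB (finset.set0, finset.set0) u)).
rewrite F_cons//=; apply: le_trans (ler_normD _ _) _; rewrite lerD ?SB//.
rewrite pair_big_dep/= (bigD1 (A, B))/= ?subxx// !finset.setDv q0 mul1r.
apply: le_trans (ler_normD _ _) _; rewrite lerD//.
apply: le_trans (ler_norm_sum _ _ _) _.
rewrite mulr_sumr.
rewrite big_mkcond/=; apply: ler_sum => -[A' B'] _.
case: ifPn => [/andP[/andP[/= sA sB] ne]|_]; last exact: mulr_ge0.
rewrite normrM ler_wpM2r//; apply: qa; apply: contra ne => /eqP[/eqP eA /eqP eB].
rewrite finset.setD_eq0 in eA; rewrite finset.setD_eq0 in eB.
by rewrite xpair_eqE !finset.eqEsubset sA sB eA eB.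
Qed.

End subset_recursion.

(** * Truncated products and their second moments *)

Section Cauchy_Schwarz.
Context d (T : measurableType d) (R : realType) (P : probability T R).

(** With bounds [u] and [v] given as positive numbers no square root is needed: the product is at
    most a weighted sum of the two squares, with weights for which each half contributes
    [u * v / 2]. *)
Lemma Ex_mul_le (f g : T -> R) (u v : R) :
  measurable_fun setT f -> measurable_fun setT g ->
  L1 P (fun w => f w ^+ 2) -> L1 P (fun w => g w ^+ 2) ->
  0 < u -> 0 < v ->
  Ex P (fun w => f w ^+ 2) <= u ^+ 2 -> Ex P (fun w => g w ^+ 2) <= v ^+ 2 ->
  `|Ex P (fun w => f w * g w)| <= u * v.
Proof.
move=> mf mg Lf Lg u0 v0 fu gv.
have Lfg := L1_sqr_mul mf mg Lf Lg.
apply: (le_trans (Ex_norm Lfg)).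
have Lb : L1 P (fun w => (v / u / 2) * f w ^+ 2 + (u / v / 2) * g w ^+ 2).
  by apply: L1D; exact: L1Z.
apply: (@le_trans _ _ (Ex P (fun w => (v / u / 2) * f w ^+ 2 + (u / v / 2) * g w ^+ 2))).
  apply: Ex_le => //; first exact: L1_norm.
  move=> w; rewrite normrM -(real_normK (num_real (f w))) -(real_normK (num_real (g w))).
  set a := `|f w|; set b := `|g w|.
  have -> : v / u / 2 * a ^+ 2 + u / v / 2 * b ^+ 2 =
     a * b + (v * a - u * b) ^+ 2 / (2 * u * v).
    by field; rewrite !gt_eqF.
  by rewrite lerDl divr_ge0 ?sqr_ge0// !mulr_ge0// ltW.
rewrite ExD; [|exact: L1Z..].
rewrite !ExZ//.
apply: (@le_trans _ _ ((v / u / 2) * u ^+ 2 + (u / v / 2) * v ^+ 2)).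
  by rewrite lerD// ler_wpM2l// !mulr_ge0// ?invr_ge0 ltW.
by rewrite le_eqVlt; apply/orP; left; apply/eqP; field; rewrite !gt_eqF.
Qed.

End Cauchy_Schwarz.

(** * Light and heavy sets of factors *)

Section truncated_products.
Context d (T : measurableType d) (R : realType) (P : probability T R).
Context d' (E : measurableType d') (Z : int -> T -> E).
Hypothesis iidZ : iid_family P Z.
Local Notation Lz := (@Lz _ T R P _ E Z).
Local Notation Mu := (@Mu _ T R P _ E Z).
Variables (s : nat) (y : int -> 'I_s -> E -> R) (N : 'I_s -> E -> R).
Variables (e : int -> R) (K : R).
Notation I := {set 'I_s}.
Implicit Types (A B D : I).

Definition light D := (#|D| * 2 <= maxn s 2)%N.
Definition prodD (f : 'I_s -> E -> R) D (x : E) : R := \prod_(r in D) f r x.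
Definition weight h D : R := e h ^+ minn #|D| 2.

Record product_model : Prop := ProductModel {
  pm_my : forall h r, measurable_fun setT (y h r);
  pm_mN : forall r, measurable_fun setT (N r);
  pm_N0 : forall r x, 0 <= N r x;
  pm_yN : forall h r x, `|y h r x| <= e h * N r x;
  pm_e0 : forall h, 0 < e h;
  pm_e1 : forall h, e h <= 1;
  pm_mean : forall h r, Mu (y h r) = 0;
  pm_K : 1 <= K;
  pm_light : forall D, light D ->
    L1 P (fun w => prodD N D (Z 0 w) ^+ 2) /\
    Ex P (fun w => prodD N D (Z 0 w) ^+ 2) <= K;
  pm_L1 : forall D, Lz (prodD N D) /\ Mu (prodD N D) <= K }.

Hypothesis pm : product_model.

Variables (M Lam : R).
Hypothesis Lam1 : 1 <= Lam.
Hypothesis heavy2 : forall D, ~~ light D ->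
  Mu (fun x => prodD N D x ^+ 2 * (prodD N D x <= M)%R%:R) <= K * Lam ^+ 2.

Let ytr h D x : R := prodD (y h) D x * (prodD N D x <= M)%R%:R.
(* [lam] is the whole coefficient for light [D], and the truncated mean otherwise;
   [zet] is the centred truncated part and [tau] the tail. *)
Definition lam h D x : R := if light D then prodD (y h) D x else Mu (ytr h D).
Definition zet h D x : R := if light D then 0 else ytr h D x - Mu (ytr h D).
Definition tau h D x : R :=
  if light D then 0 else prodD (y h) D x * (M < prodD N D x)%R%:R.

Lemma lam_light h D : light D -> lam h D = prodD (y h) D.
Proof. by move=> lD; apply/funext => x; rewrite /lam lD. Qed.

Lemma lam_heavy h D : ~~ light D -> lam h D = fun=> Mu (ytr h D).
Proof. by move=> /negbTE lD; apply/funext => x; rewrite /lam lD. Qed.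

Lemma zet_light h D : light D -> zet h D = fun=> 0.
Proof. by move=> lD; apply/funext => x; rewrite /zet lD. Qed.

Lemma zet_heavy h D : ~~ light D -> zet h D = fun x => ytr h D x - Mu (ytr h D).
Proof. by move=> /negbTE lD; apply/funext => x; rewrite /zet lD. Qed.

Lemma lam_zet_tau h D x : prodD (y h) D x = lam h D x + zet h D x + tau h D x.
Proof.
rewrite /lam /zet /tau /ytr; case: ifP => _; first by rewrite !addr0.
rewrite ltNge; case: leP => _ /=; rewrite ?mulr1 ?mulr0; ring.
Qed.

Lemma measurable_prodD (f : 'I_s -> E -> R) D :
  (forall r, measurable_fun setT (f r)) -> measurable_fun setT (prodD f D).
Proof.
move=> mf; rewrite /prodD; under eq_fun do rewrite big_mkcond.
by apply: measurable_prod => r _; case: (_ \in _).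
Qed.

Let mND D : measurable_fun setT (prodD N D).
Proof. apply: measurable_prodD => r; exact: pm_mN pm r. Qed.
Let myD h D : measurable_fun setT (prodD (y h) D).
Proof. apply: measurable_prodD => r; exact: pm_my pm h r. Qed.

Let mle D : measurable_fun setT (fun x => (prodD N D x <= M)%R%:R : R).
Proof.
rewrite (_ : (fun x => _) = \1_[set x | prodD N D x <= M]).
  apply: measurable_indic; rewrite -[X in measurable X]setTI.
  exact: measurable_fun_le.
by apply/funext => x; rewrite indicE mem_setE.
Qed.

Let mytr h D : measurable_fun setT (ytr h D).
Proof. exact: measurable_funM. Qed.

Lemma ND_ge0 D x : 0 <= prodD N D x.
Proof. by apply: prodr_ge0 => r _; exact: pm_N0 pm r x. Qed.

Let e_ge0 h : 0 <= e h. Proof. exact: ltW (pm_e0 pm h). Qed.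

Lemma weight_gt0 h D : 0 < weight h D.
Proof. by rewrite exprn_gt0// (pm_e0 pm). Qed.

Let weight_ge0 h D : 0 <= weight h D. Proof. exact/ltW/weight_gt0. Qed.

Lemma yD_le h D x : `|prodD (y h) D x| <= weight h D * prodD N D x.
Proof.
rewrite normr_prod; apply: (@le_trans _ _ (\prod_(r in D) (e h * N r x))).
  by apply: ler_prod => r _; rewrite normr_ge0 (pm_yN pm).
rewrite big_split/= prodr_const ler_wpM2r ?ND_ge0//.
by apply: ler_wiXn2l; rewrite ?(pm_e1 pm)// geq_minl.
Qed.

Lemma heavy_card D : ~~ light D -> (2 <= #|D|)%N.
Proof.
rewrite /light -ltnNge => /(leq_ltn_trans (leq_maxr s 2)).
by case: #|D| => [|[|]].
Qed.

Lemma weight_heavy h D : ~~ light D -> weight h D = e h ^+ 2.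
Proof. by move/heavy_card => H; rewrite /weight (minn_idPr H). Qed.

Let ytr_le h D x : `|ytr h D x| <= weight h D * (prodD N D x * (prodD N D x <= M)%R%:R).
Proof.
by rewrite /ytr normrM mulrA ler_pM// ?yD_le// ger0_norm.
Qed.

Let mZ0 (f : E -> R) : measurable_fun setT f -> measurable_fun setT (fun w => f (Z 0 w)).
Proof. by move=> mf; apply: measurableT_comp => //; exact: iid_measurable iidZ 0. Qed.

Let Lz_ytr h D : Lz (ytr h D).
Proof.
split=> //; apply: (@L1_le _ _ _ _ _ (fun w => weight h D * prodD N D (Z 0 w))).
- exact: mZ0.
- by apply: L1Z; have [[_ ?] _] := pm_L1 pm D.
- move=> w; apply: (le_trans (ytr_le h D (Z 0 w))).
  by rewrite ler_wpM2l// ler_piMr ?ND_ge0// lern1; case: (_ <= _).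
Qed.

Let Mu_ytr_le h D : `|Mu (ytr h D)| <= weight h D * K.
Proof.
have [[_ LN] MN] := pm_L1 pm D.
apply: (le_trans (Ex_norm (Lz_ytr h D).2)).
apply: (@le_trans _ _ (weight h D * Mu (prodD N D))); last by rewrite ler_wpM2l.
rewrite -ExZ//; apply: Ex_le.
- exact: L1_norm (Lz_ytr h D).2.
- exact: L1Z.
- move=> w; apply: (le_trans (ytr_le h D (Z 0 w))).
  by rewrite ler_wpM2l// ler_piMr ?ND_ge0// lern1; case: (_ <= _).
Qed.

Lemma lam0 h x : lam h finset.set0 x = 1.
Proof. by rewrite /lam /light cards0 mul0n leq0n /prodD big_set0. Qed.

Lemma measurable_lam h D : measurable_fun setT (lam h D).
Proof. have [lD|lD] := boolP (light D); first by rewrite lam_light.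
by rewrite lam_heavy//; exact: measurable_cst. Qed.

Lemma measurable_zet h D : measurable_fun setT (zet h D).
Proof.
have [lD|lD] := boolP (light D); first by rewrite zet_light//; exact: measurable_cst.
by rewrite zet_heavy//; exact: measurable_funB.
Qed.

Let K0 : 0 < K. Proof. exact: lt_le_trans ltr01 (pm_K pm). Qed.
Let Lam0 : 0 < Lam. Proof. exact: lt_le_trans ltr01 Lam1. Qed.
Let KK : K <= K ^+ 2. Proof. by rewrite expr2 ler_peMr// ?(pm_K pm)// ltW. Qed.

(** A heavy coefficient of [lam] is a constant, so the second moment of a heavy product, which may
    be infinite, never enters. *)
Lemma lam_L2 h D : L1 P (fun w => lam h D (Z 0 w) ^+ 2) /\
  Ex P (fun w => lam h D (Z 0 w) ^+ 2) <= (K * weight h D) ^+ 2.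
Proof.
have mlam : measurable_fun setT (fun w => lam h D (Z 0 w) ^+ 2).
  by apply: measurable_funX; apply: mZ0; exact: measurable_lam.
have [lD|lD] := boolP (light D); last first.
  rewrite lam_heavy//; split; first exact: L1_cst.
  by rewrite Ex_cst -(real_normK (num_real _)) lerXn2r// ?nnegrE ?mulr_ge0 1?mulrC// ltW.
rewrite lam_light// in mlam *; have [LN MN] := pm_light pm lD.
have H w : `|prodD (y h) D (Z 0 w) ^+ 2| <= weight h D ^+ 2 * prodD N D (Z 0 w) ^+ 2.
  by rewrite normrX -exprMn lerXn2r// ?nnegrE ?mulr_ge0 ?ND_ge0// yD_le.
have L : L1 P (fun w => prodD (y h) D (Z 0 w) ^+ 2).
  by apply: (L1_le mlam _ H); exact: L1Z.
split => //; apply: (@le_trans _ _ (weight h D ^+ 2 * K)).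
  apply: (@le_trans _ _ (weight h D ^+ 2 * Ex P (fun w => prodD N D (Z 0 w) ^+ 2))).
    rewrite -ExZ//; apply: Ex_le => //; first exact: L1Z.
    by move=> w; apply: le_trans (H w); exact: ler_norm.
  by rewrite ler_wpM2l// sqr_ge0.
by rewrite exprMn mulrC ler_wpM2r// sqr_ge0.
Qed.

Let heavy_L2 D : L1 P (fun w => prodD N D (Z 0 w) ^+ 2 * (prodD N D (Z 0 w) <= M)%R%:R).
Proof.
apply: (@L1_le _ _ _ _ _ (fun=> M ^+ 2)).
- apply: measurable_funM; last exact: (mZ0 (mle D)).
  by apply: measurable_funX; exact: (mZ0 (mND D)).
- exact: L1_cst.
- move=> w; case: (leP (prodD N D (Z 0 w)) M) => H /=; rewrite ?mulr1 ?mulr0 ?normr0 ?sqr_ge0//.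
  rewrite ger0_norm ?sqr_ge0// lerXn2r// nnegrE ?ND_ge0//.
  by rewrite (le_trans _ H)// ND_ge0.
Qed.

(** Centring only lowers the second moment, the truncated one is controlled by [heavy2], and a heavy
    set has weight [e h ^+ 2]. *)
Lemma zet_L2 h D : L1 P (fun w => zet h D (Z 0 w) ^+ 2) /\
  Ex P (fun w => zet h D (Z 0 w) ^+ 2) <= (K * Lam * e h ^+ 2) ^+ 2.
Proof.
have mzet : measurable_fun setT (fun w => zet h D (Z 0 w) ^+ 2).
  by apply: measurable_funX; apply: mZ0; exact: measurable_zet.
have [lD|lD] := boolP (light D).
  rewrite zet_light//; split; first exact: L1_cst.
  by rewrite Ex_cst expr0n/= sqr_ge0.
rewrite zet_heavy// in mzet *.
have H w : `|ytr h D (Z 0 w) ^+ 2| <= e h ^+ 2 ^+ 2 *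
    (prodD N D (Z 0 w) ^+ 2 * (prodD N D (Z 0 w) <= M)%R%:R).
  rewrite normrX -(weight_heavy h lD).
  apply: (@le_trans _ _ ((weight h D * (prodD N D (Z 0 w) * (prodD N D (Z 0 w) <= M)%R%:R)) ^+ 2)).
    by rewrite lerXn2r// ?nnegrE ?mulr_ge0 ?ND_ge0.
  by rewrite !exprMn; case: (leP (prodD N D (Z 0 w)) M) => _ /=; rewrite ?expr1n ?expr0n.
have Ly2 : L1 P (fun w => ytr h D (Z 0 w) ^+ 2).
  apply: (L1_le _ _ H); first by apply: measurable_funX; exact: mZ0.
  exact: L1Z.
have [_ Ly] := Lz_ytr h D.
have E1 : (fun w => (ytr h D (Z 0 w) - Mu (ytr h D)) ^+ 2) =
  (fun w => ytr h D (Z 0 w) ^+ 2 + (- 2 * Mu (ytr h D) * ytr h D (Z 0 w) + Mu (ytr h D) ^+ 2)).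
  by apply/funext => w; ring.
rewrite E1.
have L3 : L1 P (fun w => - 2 * Mu (ytr h D) * ytr h D (Z 0 w) + Mu (ytr h D) ^+ 2).
  by apply: L1D; [exact: L1Z|exact: L1_cst].
split; first exact: L1D.
rewrite ExD// ExD; [|exact: L1Z|exact: L1_cst].
rewrite ExZ// Ex_cst -/(Mu (ytr h D)).
apply: (@le_trans _ _ (Ex P (fun w => ytr h D (Z 0 w) ^+ 2))).
  by rewrite gerDl; have := sqr_ge0 (Mu (ytr h D)); nra.
apply: (@le_trans _ _ (e h ^+ 2 ^+ 2 * (K * Lam ^+ 2))).
  apply: (@le_trans _ _ (e h ^+ 2 ^+ 2 * Mu (fun x => prodD N D x ^+ 2 * (prodD N D x <= M)%R%:R))).
    rewrite -ExZ//; apply: Ex_le => //; first exact: L1Z.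
    by move=> w; apply: le_trans (H w); exact: ler_norm.
  by rewrite ler_wpM2l ?heavy2// exprn_ge0// sqr_ge0.
rewrite mulrC !exprMn ler_wpM2r ?exprn_ge0 ?sqr_ge0//.
by rewrite ler_wpM2r// sqr_ge0.
Qed.

Let mul_L1 (f g : E -> R) : measurable_fun setT f -> measurable_fun setT g ->
  L1 P (fun w => f (Z 0 w) ^+ 2) -> L1 P (fun w => g (Z 0 w) ^+ 2) ->
  Lz (fun x => f x * g x).
Proof.
move=> mf mg Lf Lg; split; first exact: measurable_funM.
by apply: L1_sqr_mul => //; exact: mZ0.
Qed.

Lemma Lz_lamlam h h' D D' : Lz (fun x => lam h D x * lam h' D' x).
Proof.
by apply: mul_L1; try exact: measurable_lam; [case: (lam_L2 h D)|case: (lam_L2 h' D')].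
Qed.
Lemma Lz_lamzet h h' D D' : Lz (fun x => lam h D x * zet h' D' x).
Proof.
by apply: mul_L1; [exact: measurable_lam|exact: measurable_zet|case: (lam_L2 h D)|case: (zet_L2 h' D')].
Qed.
Lemma Lz_zetzet h h' D D' : Lz (fun x => zet h D x * zet h' D' x).
Proof.
by apply: mul_L1; try exact: measurable_zet; [case: (zet_L2 h D)|case: (zet_L2 h' D')].
Qed.

Lemma Mu_lamlam h h' D D' :
  `|Mu (fun x => lam h D x * lam h' D' x)| <= K ^+ 2 * (weight h D * weight h' D').
Proof.
have [L2a Ea] := lam_L2 h D; have [L2b Eb] := lam_L2 h' D'.
have -> : K ^+ 2 * (weight h D * weight h' D') = (K * weight h D) * (K * weight h' D') by ring.
apply: Ex_mul_le => //; try by rewrite mulr_gt0// weight_gt0.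
- exact/mZ0/measurable_lam.
- exact/mZ0/measurable_lam.
Qed.

Lemma Mu_lamzet h h' D D' :
  `|Mu (fun x => lam h D x * zet h' D' x)| <= K ^+ 2 * Lam * (weight h D * e h' ^+ 2).
Proof.
have [L2a Ea] := lam_L2 h D; have [L2b Eb] := zet_L2 h' D'.
have -> : K ^+ 2 * Lam * (weight h D * e h' ^+ 2) = (K * weight h D) * (K * Lam * e h' ^+ 2) by ring.
apply: Ex_mul_le => //; try by rewrite !mulr_gt0// ?weight_gt0// (pm_e0 pm).
- exact/mZ0/measurable_lam.
- exact/mZ0/measurable_zet.
Qed.

Lemma Mu_zetzet h h' D D' :
  `|Mu (fun x => zet h D x * zet h' D' x)| <= K ^+ 2 * Lam ^+ 2 * (e h ^+ 2 * e h' ^+ 2).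
Proof.
have [L2a Ea] := zet_L2 h D; have [L2b Eb] := zet_L2 h' D'.
have -> : K ^+ 2 * Lam ^+ 2 * (e h ^+ 2 * e h' ^+ 2) = (K * Lam * e h ^+ 2) * (K * Lam * e h' ^+ 2) by ring.
apply: Ex_mul_le => //; try by rewrite !mulr_gt0// ?weight_gt0// (pm_e0 pm).
- exact/mZ0/measurable_zet.
- exact/mZ0/measurable_zet.
Qed.

Lemma Lz_lam h D : Lz (lam h D).
Proof.
have := Lz_lamlam h h D finset.set0.
by under [X in Lz X]eq_fun do rewrite lam0 mulr1.
Qed.

Lemma Mu_lam h D : `|Mu (lam h D)| <= K ^+ 2 * weight h D.
Proof.
have := Mu_lamlam h h D finset.set0.
under [X in Mu X]eq_fun do rewrite lam0 mulr1.
by rewrite /weight cards0 min0n expr0 mulr1.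
Qed.

(** A singleton is light and thus not truncated, so its mean stays exactly zero. *)
Lemma Mu_lam1 h D : #|D| = 1%N -> Mu (lam h D) = 0.
Proof.
move=> D1; have /cards1P[r rE] : #|D| == 1%N by apply/eqP.
rewrite rE -(pm_mean pm h r) /Mu; apply: eq_Ex => w.
by rewrite /lam /light cards1 mul1n leq_maxr /prodD big_set1.
Qed.

Lemma Mu_zet h D : Mu (zet h D) = 0.
Proof.
have [lD|lD] := boolP (light D); first by rewrite zet_light// /Mu Ex_cst.
rewrite zet_heavy// /Mu; have [_ Ly] := Lz_ytr h D.
by rewrite ExB// ?Ex_cst ?subrr//; exact: L1_cst.
Qed.

End truncated_products.

Ltac nonneg := repeat first [done | apply: sqr_ge0 | apply: exprn_ge0 |
  apply: mulr_ge0 | apply: addr_ge0 | exact: ler0n].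

Section algebra.
Variable R : realFieldType.
Implicit Types (a b c p q u v : R).

Lemma cov_split q c m m' u u' : q * c - u * m * (u' * m') =
  q * (c - m * m') + (q - u * u') * (m * m').
Proof. ring. Qed.

Lemma pull_Lam c n k l g : c * (0 + n * (n * (k * c) * l * g)) =
  c * (n * (n * (k * c))) * l * g.
Proof. ring. Qed.

Lemma pull_Lam2 c n k l g : c * (0 + n * (n * k * l * g)) =
  c * (n * (n * k * l)) * g.
Proof. ring. Qed.

Lemma quadratic_increment n k p q g a b :
  n * k * ((p * q) ^+ 2 + g + (p * q ^+ 2 + a) * (q * p ^+ 2 + b)) -
  n * k * (g + a * b) =
  n * (k * ((p * q) ^+ 2 + p * q ^+ 2 * b + q * p ^+ 2 * a
            + (p * q ^+ 2) * (q * p ^+ 2))).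
Proof. ring. Qed.

Lemma quadratic_source k c c1 l p q a b : 0 <= k -> 0 <= c -> 0 <= c1 ->
  0 <= p -> 0 <= q -> 0 <= a -> 0 <= b ->
  k * l * (p * q ^+ 2) * (c1 * l * b) + k * l * (q * p ^+ 2) * (c1 * l * a) +
    k * l ^+ 2 * (p ^+ 2 * q ^+ 2) * c <=
  k * (c1 + c) * l ^+ 2 * ((p * q) ^+ 2 + p * q ^+ 2 * b + q * p ^+ 2 * a).
Proof.
move=> *; rewrite -subr_ge0 [leRHS](_ : _ = k * l ^+ 2 *
  (c1 * (p * q) ^+ 2 + c * (p * q ^+ 2 * b) + c * (q * p ^+ 2 * a))); last by ring.
by nonneg.
Qed.

End algebra.

(** * Second moments of the truncated recursion *)

Section second_moments.
Context d (T : measurableType d) (R : realType) (P : probability T R).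
Context d' (E : measurableType d') (Z : int -> T -> E).
Hypothesis iidZ : iid_family P Z.
Local Notation Lz := (@Lz _ T R P _ E Z).
Local Notation Mu := (@Mu _ T R P _ E Z).
Context (s : nat) (y : int -> 'I_s -> E -> R) (N : 'I_s -> E -> R).
Context (e : int -> R) (K A0 : R).
Notation I := {set 'I_s}.
Implicit Types (A B D : I).
Hypothesis pm : product_model P Z y N e K.
Hypothesis eA : forall k ls, uniq ls -> \sum_(l <- ls) e (k - l) ^+ 2 <= A0.
Context (M Lam : R).
Hypothesis Lam1 : 1 <= Lam.
Hypothesis heavy2 : forall D, ~~ light D ->
  Mu (fun x => prodD N D x ^+ 2 * (prodD N D x <= M)%R%:R) <= K * Lam ^+ 2.
Local Notation lam := (lam P Z y N M).
Local Notation zet := (zet P Z y N M).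
Local Notation wt := (weight e).

(* In a state [(A, b)], the factors of [A] remain to be distributed, and [b] tells
   whether a centred part [zet] is still to come.  Two disjoint heavy sets do not fit
   into ['I_s], so there is never more than one. *)
Definition part (b c : bool) h D (x : E) : R :=
  if b == c then lam h D x else if b then zet h D x else 0.

Definition G h (j j' : I * bool) (x : E) : R :=
  if j'.1 \subset j.1 then part j.2 j'.2 h (j.1 :\: j'.1) x else 0.

(** When no innovation is left, a product of empty sums is 1 only over the empty set, and no centred
    part may be outstanding. *)
Definition init (j : I * bool) : R := ((j.1 == finset.set0) && ~~ j.2)%:R.

Local Notation sol := (lin Z G init).
Local Notation mom := (M2 P Z G init).

Lemma G_cases h j j' : [\/ exists D, G h j j' = lam h D,
  exists D, G h j j' = zet h D | G h j j' = fun=> 0].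
Proof.
have [s1|s1] := boolP (j'.1 \subset j.1); last first.
  by constructor 3; apply/funext => x; rewrite /G (negbTE s1).
have [jj|jj] := eqVneq j.2 j'.2.
  by constructor 1; exists (j.1 :\: j'.1); apply/funext => x; rewrite /G s1 /part jj eqxx.
have [j2|j2] := boolP j.2.
  by constructor 2; exists (j.1 :\: j'.1); apply/funext => x; rewrite /G s1 /part (negbTE jj) j2.
by constructor 3; apply/funext => x; rewrite /G s1 /part (negbTE jj) (negbTE j2).
Qed.

Lemma Lz_G h h' j j' i i' : Lz (fun x => G h j j' x * G h' i i' x).
Proof.
have [[D ->]|[D ->]|->] := G_cases h j j';
  have [[D' ->]|[D' ->]|->] := G_cases h' i i'.
- exact: (Lz_lamlam iidZ pm M).
- exact: (Lz_lamzet iidZ pm heavy2).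
- by under [X in Lz X]eq_fun do rewrite mulr0; exact: Lz_cst.
- under [X in Lz X]eq_fun do rewrite mulrC.
  exact: (Lz_lamzet iidZ pm heavy2).
- exact: (Lz_zetzet iidZ pm heavy2).
- by under [X in Lz X]eq_fun do rewrite mulr0; exact: Lz_cst.
- by under [X in Lz X]eq_fun do rewrite mul0r; exact: Lz_cst.
- by under [X in Lz X]eq_fun do rewrite mul0r; exact: Lz_cst.
- by under [X in Lz X]eq_fun do rewrite mul0r; exact: Lz_cst.
Qed.

Lemma M2_rec k k' l ls A B b b' : uniq (l :: ls) ->
  mom k k' (l :: ls) (A, b) (B, b') =
  \sum_(A' : I | A' \subset A) \sum_(B' : I | B' \subset B)
    \sum_c \sum_c' Mu (fun x => part b c (k - l) (A :\: A') x *
                                part b' c' (k' - l) (B :\: B') x) *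
                   mom k k' ls (A', c) (B', c').
Proof.
move=> u; rewrite (M2_cons iidZ _ Lz_G)//.
pose f A' c B' c' := Mu (fun x => G (k - l) (A, b) (A', c) x * G (k' - l) (B, b') (B', c') x) *
   mom k k' ls (A', c) (B', c').
transitivity (\sum_A' \sum_c \sum_B' \sum_c' f A' c B' c').
  rewrite [RHS]pair_bigA/=; apply: eq_bigr => -[A' c] _.
  by rewrite [RHS]pair_bigA/=; apply: eq_bigr => -[B' c'] _.
rewrite [RHS]big_mkcond/=; apply: eq_bigr => A' _.
rewrite exchange_big/=; case: ifPn => sA; last first.
  rewrite big1// => B' _; rewrite big1// => c _; rewrite big1// => c' _.
  rewrite /f; have -> : (fun x => G (k - l) (A, b) (A', c) x * G (k' - l) (B, b') (B', c') x) = fun=> 0.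
    by apply/funext => x; rewrite /G (negbTE sA) mul0r.
  by rewrite /Mu Ex_cst mul0r.
rewrite [RHS]big_mkcond/=; apply: eq_bigr => B' _.
case: ifPn => sB; last first.
  rewrite big1// => c _; rewrite big1// => c' _.
  rewrite /f; have -> : (fun x => G (k - l) (A, b) (A', c) x * G (k' - l) (B, b') (B', c') x) = fun=> 0.
    by apply/funext => x; rewrite /G /= (negbTE sB) mulr0.
  by rewrite /Mu Ex_cst mul0r.
apply: eq_bigr => c _; apply: eq_bigr => c' _; rewrite /f; congr (_ * _).
by apply: eq_Ex => w; rewrite /G/= sA sB.
Qed.

Lemma Mu_0l (f : E -> R) : Mu (fun x => 0 * f x) = 0.
Proof. by rewrite /Mu; under eq_Ex do rewrite mul0r; rewrite Ex_cst. Qed.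

Lemma Mu_0r (f : E -> R) : Mu (fun x => f x * 0) = 0.
Proof. by rewrite /Mu; under eq_Ex do rewrite mulr0; rewrite Ex_cst. Qed.

Let ML h h' D D' := Mu (fun x => lam h D x * lam h' D' x).
Let MZ h h' D D' := Mu (fun x => lam h D x * zet h' D' x).
Let MZZ h h' D D' := Mu (fun x => zet h D x * zet h' D' x).

Lemma M2_ff k k' l ls A B : uniq (l :: ls) ->
  mom k k' (l :: ls) (A, false) (B, false) =
  \sum_(A' : I | A' \subset A) \sum_(B' : I | B' \subset B)
    ML (k - l) (k' - l) (A :\: A') (B :\: B') * mom k k' ls (A', false) (B', false).
Proof.
move=> u; rewrite M2_rec//; apply: eq_bigr => A' _; apply: eq_bigr => B' _.
by rewrite !big_bool/= /part/= !Mu_0l Mu_0r !mul0r !add0r.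
Qed.

Lemma M2_ft k k' l ls A B : uniq (l :: ls) ->
  mom k k' (l :: ls) (A, false) (B, true) =
  \sum_(A' : I | A' \subset A) \sum_(B' : I | B' \subset B)
    ML (k - l) (k' - l) (A :\: A') (B :\: B') * mom k k' ls (A', false) (B', true) +
  \sum_(A' : I | A' \subset A) \sum_(B' : I | B' \subset B)
    MZ (k - l) (k' - l) (A :\: A') (B :\: B') * mom k k' ls (A', false) (B', false).
Proof.
move=> u; rewrite M2_rec// -big_split/=; apply: eq_bigr => A' _.
rewrite -big_split/=; apply: eq_bigr => B' _.
by rewrite !big_bool/= /part/= !Mu_0l !mul0r !add0r.
Qed.

Lemma M2_tt k k' l ls A B : uniq (l :: ls) ->
  mom k k' (l :: ls) (A, true) (B, true) =
  \sum_(A' : I | A' \subset A) \sum_(B' : I | B' \subset B)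
    ML (k - l) (k' - l) (A :\: A') (B :\: B') * mom k k' ls (A', true) (B', true) +
  \sum_(A' : I | A' \subset A) \sum_(B' : I | B' \subset B)
   (MZ (k - l) (k' - l) (A :\: A') (B :\: B') * mom k k' ls (A', true) (B', false) +
    MZ (k' - l) (k - l) (B :\: B') (A :\: A') * mom k k' ls (A', false) (B', true) +
    MZZ (k - l) (k' - l) (A :\: A') (B :\: B') * mom k k' ls (A', false) (B', false)).
Proof.
move=> u; rewrite M2_rec// -big_split/=; apply: eq_bigr => A' _.
rewrite -big_split/=; apply: eq_bigr => B' _.
rewrite !big_bool/= /part/=.
have -> : Mu (fun x => zet (k - l) (A :\: A') x * lam (k' - l) (B :\: B') x) =
    MZ (k' - l) (k - l) (B :\: B') (A :\: A').
  by apply: eq_Ex => w; rewrite mulrC.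
rewrite -/(ML _ _ _ _) -/(MZ _ _ _ _) -/(MZZ _ _ _ _) !addrA//.
Qed.

Lemma M2C k k' ls j i : mom k k' ls j i = mom k' k ls i j.
Proof. by apply: eq_Ex => w; rewrite mulrC. Qed.

Lemma M2_nil k k' j i : mom k k' [::] j i = init j * init i.
Proof. by rewrite /M2 /= Ex_cst. Qed.

Let e0 h : 0 < e h := pm_e0 pm h.
Let e_ge0 h : 0 <= e h := ltW (e0 h).
Let e1 h : e h <= 1 := pm_e1 pm h.
Let K1 : 1 <= K := pm_K pm.
Let K_ge0 : 0 <= K := le_trans ler01 K1.
Let K2_ge0 : 0 <= K ^+ 2. Proof. exact: sqr_ge0. Qed.

Lemma weight_le h D : D != finset.set0 -> wt h D <= e h.
Proof.
move=> D0; rewrite /weight -[leRHS]expr1 ler_wiXn2l//.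
by rewrite leq_min card_gt0 D0.
Qed.

Lemma ML0l h h' D : ML h h' finset.set0 D = Mu (lam h' D).
Proof. by apply: eq_Ex => w; rewrite lam0 mul1r. Qed.

Lemma MLC h h' D D' : ML h h' D D' = ML h' h D' D.
Proof. by apply: eq_Ex => w; rewrite mulrC. Qed.

(** Means are of second order in the weight: for one factor the mean vanishes, for more factors the
    weight is already a square. *)
Lemma Mu_lam_le h D : D != finset.set0 -> `|Mu (lam h D)| <= K ^+ 2 * e h ^+ 2.
Proof.
move=> D0; have [D1|D1] := eqVneq #|D| 1%N.
  by rewrite (Mu_lam1 pm)// normr0 mulr_ge0// sqr_ge0.
rewrite (le_trans (Mu_lam iidZ pm M h D))// ler_wpM2l//.
rewrite /weight (minn_idPr _)//.
by rewrite -card_gt0 in D0; case: #|D| D0 D1 => [|[|]].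
Qed.

(** This makes the perturbation of the identity summable over [l]. If one set is empty, a mean is
    left over; if neither is, the product [e h * e h'] is below the sum of squares. *)
Lemma ML_le h h' D D' : (D, D') != (finset.set0, finset.set0) ->
  `|ML h h' D D'| <= K ^+ 2 * (e h ^+ 2 + e h' ^+ 2).
Proof.
have [->|D0] := eqVneq D finset.set0.
  have [->|D0' _] := eqVneq D' finset.set0; first by rewrite eqxx.
  rewrite ML0l (le_trans (Mu_lam_le h' D0'))// ler_wpM2l// lerDr sqr_ge0//.
have [->|D0' _] := eqVneq D' finset.set0.
  by rewrite MLC ML0l (le_trans (Mu_lam_le h D0))// ler_wpM2l// lerDl sqr_ge0.
apply: (le_trans (Mu_lamlam iidZ pm M h h' D D')); rewrite ler_wpM2l//.
apply: (@le_trans _ _ (e h * e h')).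
  by rewrite ler_pM ?weight_le// ltW// (weight_gt0 pm).
by have := sqr_ge0 (e h - e h'); have := sqr_ge0 (e h + e h'); nra.
Qed.

Definition n2 : R := #|{: I * I}|%:R.
(** The Gronwall factor: [n2] counts the pairs of sets, and [2 * A0] bounds the summed squared
    weights at the two times. *)
Definition CE : R := expR (n2 * (K ^+ 2 * (2 * A0))).

Let a k k' l := K ^+ 2 * (e (k - l) ^+ 2 + e (k' - l) ^+ 2).
Let a_ge0 k k' l : 0 <= a k k' l.
Proof. by rewrite mulr_ge0// addr_ge0// sqr_ge0. Qed.
Let ML00' h h' : ML h h' finset.set0 finset.set0 = 1.
Proof. by rewrite ML0l /Mu; under eq_Ex do rewrite lam0; rewrite Ex_cst. Qed.

Let A0_ge0 : 0 <= A0.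
Proof. by have := @eA 0 [::] isT; rewrite big_nil. Qed.

Lemma CE_ge1 : 1 <= CE.
Proof. by rewrite /CE -expR0 ler_expR mulr_ge0// mulr_ge0// mulr_ge0. Qed.
Let CE_ge0 : 0 <= CE. Proof. exact: le_trans ler01 CE_ge1. Qed.

Let sum_a k k' ls : uniq ls -> expR (n2 * \sum_(l <- ls) a k k' l) <= CE.
Proof.
move=> u; rewrite /CE ler_expR ler_wpM2l// -mulr_sumr ler_wpM2l//.
by rewrite big_split/= mulr_natl mulr2n lerD// eA.
Qed.

(** All moments below share the same homogeneous recursion and differ only in source and initial
    values, so one estimate serves them all. *)
Lemma recursion_bound k k' (F : seq int -> I * I -> R) S Bd ls (F0 : R) :
  (forall l ls (AB : I * I), uniq (l :: ls) -> F (l :: ls) AB =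
    \sum_(A : I | A \subset AB.1) \sum_(B : I | B \subset AB.2)
     ML (k - l) (k' - l) (AB.1 :\: A) (AB.2 :\: B) * F ls (A, B) + S l ls AB) ->
  (forall l ls AB, uniq (l :: ls) -> `|S l ls AB| <= Bd (l :: ls) - Bd ls) ->
  \sum_AB `|F [::] AB| <= F0 -> 0 <= Bd [::] -> uniq ls ->
  forall AB, `|F ls AB| <= CE * (F0 + n2 * Bd ls).
Proof.
move=> Fc SB HF0 Bd0 u AB.
have := @subset_recursion _ _ F (fun l => ML (k - l) (k' - l)) S (a k k') Bd Fc
  (fun l => ML00' (k - l) (k' - l)) (fun l D D' => @ML_le (k - l) (k' - l) D D')
  (a_ge0 k k') SB ls u.
rewrite -/n2 => H.
apply: (@le_trans _ _ (\sum_AB `|F ls AB|)).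
  by rewrite (bigD1 AB)//= lerDl sumr_ge0.
apply: (le_trans H); apply: ler_pM.
- exact: expR_ge0.
- rewrite addr_ge0 ?sumr_ge0// mulr_ge0//.
  elim: ls u {H} => [|l ls IH u]; first by rewrite subrr.
  have u' : uniq ls by case/andP : u.
  have := SB l ls (finset.set0, finset.set0) u.
  by have := IH u'; have := normr_ge0 (S l ls (finset.set0, finset.set0)); lra.
- exact: sum_a.
- by rewrite lerD// ler_wpM2l//; lra.
Qed.

Let sum_init : \sum_(AB : I * I) `|init (AB.1, false) * init (AB.2, false)| = 1.
Proof.
rewrite (bigD1 (finset.set0, finset.set0))//= /init/= eqxx mulr1 normr1.
rewrite big1 ?addr0// => -[A B]; rewrite xpair_eqE negb_and => /orP[]/negbTE/= ->.
  by rewrite mul0r normr0.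
by rewrite mulr0 normr0.
Qed.

Lemma LL_le k k' ls A B : uniq ls ->
  `|mom k k' ls (A, false) (B, false)| <= CE.
Proof.
move=> u; rewrite -[leRHS]mulr1 -[X in _ * X]addr0 -(mulr0 n2).
apply: (@recursion_bound k k' (fun ls AB => mom k k' ls (AB.1, false) (AB.2, false))
  (fun _ _ _ => 0) (fun=> 0) ls 1 _ _ _ _ u (A, B)) => //=.
- by move=> l ls' AB u'; rewrite addr0 M2_ff.
- by move=> *; rewrite normr0 subrr.
- by under eq_bigr do rewrite M2_nil; rewrite sum_init.
Qed.

(* The value of the recursion at [(set0, false)] is 1, so that the last two moments
   are means. *)
Definition cov k k' ls (AB : I * I) := mom k k' ls (AB.1, false) (AB.2, false) -
  mom k k' ls (AB.1, false) (finset.set0, false) *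
  mom k k' ls (finset.set0, false) (AB.2, false).

Let mean k k' ls A := mom k k' ls (A, false) (finset.set0, false).

Lemma mean_cons k k' l ls A : uniq (l :: ls) ->
  mean k k' (l :: ls) A =
  \sum_(A' : I | A' \subset A) Mu (lam (k - l) (A :\: A')) * mean k k' ls A'.
Proof.
move=> u; rewrite /mean M2_ff//; apply: eq_bigr => A' _.
rewrite (big_pred1 finset.set0); last by move=> B; rewrite /= finset.subset0.
by rewrite finset.setDv MLC ML0l.
Qed.

Lemma mean_le k k' ls A : uniq ls -> `|mean k k' ls A| <= CE.
Proof. exact: LL_le. Qed.

Lemma Mu_lam_set0 h : Mu (lam h finset.set0) = 1.
Proof. by rewrite /Mu; under eq_Ex do rewrite lam0; rewrite Ex_cst. Qed.

(** The source is the covariance of the two coefficients times the means of the remaining solutions;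
    it appears when the recursion for the product of means is subtracted from that for the mixed
    moment. *)
Lemma cov_cons k k' l ls AB : uniq (l :: ls) -> cov k k' (l :: ls) AB =
  \sum_(A : I | A \subset AB.1) \sum_(B : I | B \subset AB.2)
    ML (k - l) (k' - l) (AB.1 :\: A) (AB.2 :\: B) * cov k k' ls (A, B) +
  \sum_(A : I | A \subset AB.1) \sum_(B : I | B \subset AB.2)
    (ML (k - l) (k' - l) (AB.1 :\: A) (AB.2 :\: B) -
     Mu (lam (k - l) (AB.1 :\: A)) * Mu (lam (k' - l) (AB.2 :\: B))) *
    (mean k k' ls A * mean k' k ls B).
Proof.
case: AB => A B u; rewrite /cov/= M2_ff//.
rewrite -/(mean k k' (l :: ls) A) (M2C k k' _ (finset.set0, false)).
rewrite -/(mean k' k (l :: ls) B) !mean_cons//.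
rewrite mulr_suml -sumrB -big_split/=; apply: eq_bigr => A' _.
rewrite mulr_sumr -sumrB -big_split/=; apply: eq_bigr => B' _.
by rewrite (M2C k k' _ (finset.set0, false)); exact: cov_split.
Qed.

Let sub_sum_le A B (f : I -> I -> R) (c : R) :
  (forall A' B', `|f A' B'| <= c) ->
  `|\sum_(A' : I | A' \subset A) \sum_(B' : I | B' \subset B) f A' B'| <= n2 * c.
Proof.
move=> fc; have c0 : 0 <= c := le_trans (normr_ge0 _) (fc finset.set0 finset.set0).
rewrite pair_big_dep/= (le_trans (ler_norm_sum _ _ _))//.
apply: (@le_trans _ _ (\sum_(p : I * I) c)).
  by rewrite big_mkcond/= ler_sum// => p _; case: ifP => _; rewrite ?fc.
by rewrite sumr_const /n2 mulr_natl.
Qed.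

(** The source vanishes if either removed set is empty, the coefficient being 1 there. Otherwise
    each of the two coefficients supplies at least one weight. The initial covariance is zero. *)
Lemma cov_le k k' ls AB : uniq ls ->
  `|cov k k' ls AB| <= CE * (n2 * (n2 * (2 * K ^+ 4 * CE ^+ 2) *
    \sum_(l <- ls) e (k - l) * e (k' - l))).
Proof.
move=> u; set C := n2 * (2 * K ^+ 4 * CE ^+ 2).
pose Bd ls := C * \sum_(l <- ls) e (k - l) * e (k' - l).
rewrite -/(Bd ls) -[X in _ * X]add0r.
apply: (@recursion_bound k k' (cov k k') _ Bd ls 0 (fun l ls AB u => @cov_cons k k' l ls AB u)).
- move=> l ls' [A B] u'; have u2 : uniq ls' by case/andP : u'.
  rewrite /Bd big_cons mulrDr addrK /C -mulrA.
  apply: sub_sum_le => A' B' /=.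
  (* The product of two means costs [K ^+ 4]; the bound [K ^+ 2] of the mixed moment is enlarged to
     match. *)
  have K4 : K ^+ 2 <= K ^+ 4.
    by rewrite ler_weXn2l.
  have ee : 0 <= e (k - l) * e (k' - l) by rewrite mulr_ge0.
  have [D0|D0] := eqVneq (A :\: A') finset.set0.
    rewrite D0 ML0l Mu_lam_set0 mul1r subrr mul0r normr0.
    by nonneg.
  have [D0'|D0'] := eqVneq (B :\: B') finset.set0.
    rewrite D0' MLC ML0l Mu_lam_set0 mulr1 subrr mul0r normr0.
    by nonneg.
  rewrite normrM mulrAC; apply: ler_pM => //.
    apply: (le_trans (ler_normB _ _)).
    have ww : wt (k - l) (A :\: A') * wt (k' - l) (B :\: B') <= e (k - l) * e (k' - l).
      by rewrite ler_pM ?weight_le// ltW// (weight_gt0 pm).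
    have h1 : `|ML (k - l) (k' - l) (A :\: A') (B :\: B')| <= K ^+ 4 * (e (k - l) * e (k' - l)).
      apply: (le_trans (Mu_lamlam iidZ pm M _ _ _ _)).
      by apply: ler_pM => //; rewrite mulr_ge0// ltW// (weight_gt0 pm).
    have h2 : `|Mu (lam (k - l) (A :\: A')) * Mu (lam (k' - l) (B :\: B'))| <= K ^+ 4 * (e (k - l) * e (k' - l)).
      rewrite normrM (_ : K ^+ 4 * _ = (K ^+ 2 * e (k - l)) * (K ^+ 2 * e (k' - l))); last by ring.
      apply: ler_pM => //; apply: le_trans (Mu_lam iidZ pm M _ _) _; by rewrite ler_wpM2l ?weight_le.
    by lra.
  by rewrite normrM expr2 ler_pM// mean_le.
- rewrite le_eqVlt; apply/orP; left; apply/eqP; rewrite big1// => -[A B] _.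
  rewrite /cov !M2_nil /init/= eqxx !andbT/=.
  by case: (A == _); case: (B == _); rewrite ?mulr1 ?mulr0 ?mul0r ?subrr normr0.
- by rewrite /Bd big_nil mulr0.
- exact: u.
Qed.

Definition g12 k k' (ls : seq int) : R := \sum_(l <- ls) e (k - l) * e (k' - l) ^+ 2.
Definition g22 k k' (ls : seq int) : R := \sum_(l <- ls) (e (k - l) * e (k' - l)) ^+ 2.
Definition C1 : R := CE * (n2 * (n2 * (K ^+ 2 * CE))).

Let Lam_ge0 : 0 <= Lam. Proof. exact: le_trans ler01 Lam1. Qed.

(** For empty [D] the coefficient is 1 and the centred part has mean zero. This is what supplies the
    factor [e h], without which the bound would show no decay in the distance of the two times. *)
Lemma MZ_le h h' D D' : `|MZ h h' D D'| <= K ^+ 2 * Lam * (e h * e h' ^+ 2).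
Proof.
have [->|D0] := eqVneq D finset.set0.
  rewrite /MZ (_ : Mu _ = 0); last first.
    by rewrite -(Mu_zet iidZ pm M h' D'); apply: eq_Ex => w; rewrite lam0 mul1r.
  by rewrite normr0 !mulr_ge0// sqr_ge0.
apply: le_trans (Mu_lamzet iidZ pm Lam1 heavy2 h h' D D') _.
by rewrite ler_wpM2l ?mulr_ge0// ler_wpM2r ?sqr_ge0// weight_le.
Qed.

(** With one flag set, the source consists of moments of [lam] against [zet] times moments without
    flags, which are bounded by [CE]. *)
Lemma LH_le k k' ls A B : uniq ls ->
  `|mom k k' ls (A, false) (B, true)| <= C1 * Lam * g12 k k' ls.
Proof.
move=> u; pose Bd ls := n2 * (K ^+ 2 * CE) * Lam * g12 k k' ls.
apply: (@le_trans _ _ (CE * (0 + n2 * Bd ls))); last first.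
  by rewrite /Bd /C1 pull_Lam.
apply: (@recursion_bound k k' (fun ls AB => mom k k' ls (AB.1, false) (AB.2, true))
  _ Bd ls 0 (fun l ls AB u => @M2_ft k k' l ls AB.1 AB.2 u) _ _ _ u (A, B)).
- move=> l ls' [A1 B1] u'; have u2 : uniq ls' by case/andP : u'.
  rewrite /Bd /g12 big_cons mulrDr addrK -!mulrA.
  apply: sub_sum_le => A' B' /=; rewrite normrM.
  rewrite (_ : _ * _ = K ^+ 2 * Lam * (e (k - l) * e (k' - l) ^+ 2) * CE); last by ring.
  by rewrite ler_pM// ?MZ_le// LL_le.
- rewrite le_eqVlt; apply/orP; left; apply/eqP; rewrite big1// => -[A1 B1] _.
  by rewrite !M2_nil /init/= andbF mulr0 normr0.
- by rewrite /Bd /g12 big_nil mulr0.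
Qed.

Lemma HL_le k k' ls A B : uniq ls ->
  `|mom k k' ls (A, true) (B, false)| <= C1 * Lam * g12 k' k ls.
Proof. by move=> u; rewrite M2C; exact: LH_le. Qed.

Let g12_ge0 k k' ls : 0 <= g12 k k' ls.
Proof. by apply: sumr_ge0 => l _; rewrite mulr_ge0// sqr_ge0. Qed.
Let C1_ge0 : 0 <= C1. Proof. by rewrite !mulr_ge0. Qed.

(** If both centred parts sit at the same [l], they give [g22]; at different indices they give cross
    terms. [Bd] contains the product of the two [g12] because its increment produces exactly these
    cross terms. *)
Lemma HH_le k k' ls A B : uniq ls ->
  `|mom k k' ls (A, true) (B, true)| <=
  CE * (n2 * (n2 * (K ^+ 2 * (C1 + CE)) * Lam ^+ 2)) *
    (g22 k k' ls + g12 k k' ls * g12 k' k ls).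
Proof.
move=> u; pose Bd ls := n2 * (K ^+ 2 * (C1 + CE)) * Lam ^+ 2 * (g22 k k' ls + g12 k k' ls * g12 k' k ls).
apply: (@le_trans _ _ (CE * (0 + n2 * Bd ls))); last first.
  by rewrite /Bd pull_Lam2.
apply: (@recursion_bound k k' (fun ls AB => mom k k' ls (AB.1, true) (AB.2, true))
  _ Bd ls 0 (fun l ls AB u => @M2_tt k k' l ls AB.1 AB.2 u) _ _ _ u (A, B)).
- move=> l ls' [A1 B1] u'; have u2 : uniq ls' by case/andP : u'.
  set p := e (k - l); set q := e (k' - l).
  have p0 : 0 <= p by exact: e_ge0.
  have q0 : 0 <= q by exact: e_ge0.
  set a1 := g12 k k' ls'; set a2 := g12 k' k ls'.
  have a10 : 0 <= a1 by exact: g12_ge0.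
  have a20 : 0 <= a2 by exact: g12_ge0.
  apply: (@le_trans _ _ (n2 * (K ^+ 2 * (C1 + CE) * Lam ^+ 2 *
    ((p * q) ^+ 2 + p * q ^+ 2 * a2 + q * p ^+ 2 * a1)))); last first.
    rewrite /Bd /g22 /a1 /a2 /g12 !big_cons -/p -/q -[n2 * _ * _]mulrA quadratic_increment.
    rewrite ler_wpM2l// ler_wpM2l//; last by rewrite lerDl; nonneg.
    by nonneg.
  apply: sub_sum_le => A' B' /=.
  have b1 : `|MZ (k - l) (k' - l) (A1 :\: A') (B1 :\: B') * mom k k' ls' (A', true) (B', false)|
     <= (K ^+ 2 * Lam * (p * q ^+ 2)) * (C1 * Lam * a2).
    by rewrite normrM ler_pM// ?MZ_le// HL_le.
  have b2 : `|MZ (k' - l) (k - l) (B1 :\: B') (A1 :\: A') * mom k k' ls' (A', false) (B', true)|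
     <= (K ^+ 2 * Lam * (q * p ^+ 2)) * (C1 * Lam * a1).
    by rewrite normrM ler_pM// ?MZ_le// LH_le.
  have b3 : `|MZZ (k - l) (k' - l) (A1 :\: A') (B1 :\: B') * mom k k' ls' (A', false) (B', false)|
     <= (K ^+ 2 * Lam ^+ 2 * (p ^+ 2 * q ^+ 2)) * CE.
    rewrite normrM ler_pM// ?LL_le//.
    exact: (Mu_zetzet iidZ pm Lam1 heavy2).
  apply: (le_trans (ler_normD _ _)); apply: (le_trans (lerD (ler_normD _ _) (lexx _))).
  apply: (le_trans (lerD (lerD b1 b2) b3)).
  exact: quadratic_source.
- rewrite le_eqVlt; apply/orP; left; apply/eqP; rewrite big1// => -[A1 B1] _.
  by rewrite !M2_nil /init/= !andbF mulr0 normr0.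
- by rewrite /Bd /g22 /g12 !big_nil mulr0 addr0 mulr0.
Qed.

(** After doubling, both sides are double sums over [l] and [m], and termwise it is
    [2 x z <= x^2 + z^2] with [x = p l * q l * p m] and [z = p m * q m * q l]. So the cross terms
    are no worse than [g22]. *)
Lemma g12_mul k k' ls : uniq ls -> g12 k k' ls * g12 k' k ls <= A0 * g22 k k' ls.
Proof.
move=> u; rewrite -(ler_pM2l (ltr0Sn R 1)).
pose p l := e (k - l); pose q l := e (k' - l).
have -> : 2 * (A0 * g22 k k' ls) = g22 k k' ls * A0 + A0 * g22 k k' ls by ring.
apply: (@le_trans _ _ (g22 k k' ls * (\sum_(m <- ls) p m ^+ 2) + (\sum_(l <- ls) q l ^+ 2) * g22 k k' ls)); last first.
  have g0 : 0 <= g22 k k' ls by apply: sumr_ge0 => l _; exact: sqr_ge0.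
  by rewrite lerD// ?ler_wpM2l ?ler_wpM2r// eA.
rewrite /g12 /g22 !mulr_suml mulr_sumr -big_split/=; apply: ler_sum => l _.
rewrite !mulr_sumr -big_split/=; apply: ler_sum => m _.
rewrite -/(p l) -/(p m) -/(q l) -/(q m) -subr_ge0.
rewrite (_ : _ - _ = (p l * q l * p m - p m * q m * q l) ^+ 2); last by ring.
exact: sqr_ge0.
Qed.

Definition C2 : R := CE * (n2 * (n2 * (K ^+ 2 * (C1 + CE)))) * (1 + A0).

Lemma HH_sum_le k k' ls A B : uniq ls ->
  `|mom k k' ls (A, true) (B, true)| <= C2 * Lam ^+ 2 * g22 k k' ls.
Proof.
move=> u; apply: (le_trans (HH_le k k' A B u)).
rewrite (_ : C2 * Lam ^+ 2 * g22 k k' ls = CE * (n2 * (n2 * (K ^+ 2 * (C1 + CE)) * Lam ^+ 2)) *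
  (g22 k k' ls + A0 * g22 k k' ls)); last by rewrite /C2; ring.
by rewrite ler_wpM2l ?lerD2l ?g12_mul//; nonneg.
Qed.

End second_moments.

(** * Exact decomposition of the product *)

Lemma prod_add_subsets (R : comNzRingType) (I : finType) (A : {set I}) (a b : I -> R) :
  \prod_(r in A) (a r + b r) =
  \sum_(B : {set I} | B \subset A) (\prod_(r in A :\: B) a r) * \prod_(r in B) b r.
Proof.
pose F r := if r \in A then b r else 0; pose G r := if r \in A then a r else 1.
transitivity (\prod_r (F r + G r)).
  rewrite big_mkcond/=; apply: eq_bigr => r _; rewrite /F /G.
  by case: ifP => _; [exact: addrC|rewrite add0r].
rewrite bigA_distr [RHS]big_mkcond/=; apply: eq_bigr => B _.
case: ifPn => [sBA|/fintype.subsetPn[r rB rA]]; last first.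
  by rewrite (bigD1 r)//= rB /F (negbTE rA) mul0r.
rewrite [X in X * _]big_mkcond [X in _ * X]big_mkcond/= -big_split/=.
apply: eq_bigr => r _; rewrite finset.in_setD /F /G.
have [rB|rB] := boolP (r \in B); last by rewrite /= mulr1.
by rewrite (fintype.subsetP sBA _ rB) /= mul1r.
Qed.

Section decomposition.
Context d (T : measurableType d) (R : realType) (P : probability T R).
Context d' (E : measurableType d') (Z : int -> T -> E).
Context (s : nat) (y : int -> 'I_s -> E -> R) (N : 'I_s -> E -> R) (M : R).
Notation I := {set 'I_s}.
Implicit Types (A B D : I).
Local Notation lam := (lam P Z y N M).
Local Notation zet := (zet P Z y N M).
Local Notation tauM := (tau y N M).
Local Notation sol := (lin Z (G P Z y N M) (@init R s)).

Definition prodX k ls A w : R := \prod_(r in A) \sum_(l <- ls) y (k - l) r (Z l w).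

(** The innovation with the tail is singled out and [sol] runs over the others, so that the two
    factors are independent when the list has no repetitions. *)
Definition tailpart k ls A w : R := \sum_(l <- ls) \sum_(A' : I | A' \subset A)
  tauM (k - l) (A :\: A') (Z l w) * sol k (rem l ls) (A', false) w.

Lemma prodX_cons k l ls A w : prodX k (l :: ls) A w =
  \sum_(A' : I | A' \subset A) prodD (y (k - l)) (A :\: A') (Z l w) * prodX k ls A' w.
Proof.
rewrite /prodX; under eq_bigr do rewrite big_cons.
exact: prod_add_subsets.
Qed.

Lemma sum_setbool (f : I * bool -> R) :
  \sum_j f j = \sum_A (f (A, true) + f (A, false)).
Proof.
transitivity (\sum_A \sum_b f (A, b)); first by rewrite pair_bigA; apply: eq_bigr => -[].
by apply: eq_bigr => A _; rewrite big_bool.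
Qed.

Lemma sol_false k l ls A w : sol k (l :: ls) (A, false) w =
  \sum_(A' : I | A' \subset A) lam (k - l) (A :\: A') (Z l w) * sol k ls (A', false) w.
Proof.
rewrite [LHS]/= sum_setbool [RHS]big_mkcond/=; apply: eq_bigr => A' _.
by rewrite /G/= /part/=; case: ifP => _; rewrite ?mul0r ?addr0 ?add0r.
Qed.

Lemma sol_true k l ls A w : sol k (l :: ls) (A, true) w =
  \sum_(A' : I | A' \subset A) (lam (k - l) (A :\: A') (Z l w) * sol k ls (A', true) w +
     zet (k - l) (A :\: A') (Z l w) * sol k ls (A', false) w).
Proof.
rewrite [LHS]/= sum_setbool [RHS]big_mkcond/=; apply: eq_bigr => A' _.
by rewrite /G/= /part/=; case: ifP => _; rewrite ?mul0r ?addr0 ?add0r.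
Qed.

Lemma lightS A B : A \subset B -> light B -> light A.
Proof.
by move=> sAB; apply: leq_trans; rewrite leq_pmul2r// fintype.subset_leq_card.
Qed.

(** [A :\: B] has more than [s / 2] elements and [A] at most [s]. Hence a heavy coefficient leaves
    only light ones to the other innovations. *)
Lemma light_compl A B : B \subset A -> ~~ light (A :\: B) -> light B.
Proof.
move=> sBA; rewrite /light -ltnNge => /(leq_ltn_trans (leq_maxl s 2)).
have := max_card (mem A); rewrite card_ord cardsD (finset.setIidPr sBA) => As.
move: (fintype.subset_leq_card sBA) As; move: #|A| #|B| => a b ba As H.
apply: leq_trans (leq_maxl _ _); rewrite mulnBl in H.
by lia.
Qed.

(** Lowering the flag takes a centred coefficient, which lives on a heavy set, and a light set has
    no heavy subset. *)
Lemma sol_light k ls A w : light A -> sol k ls (A, true) w = 0.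
Proof.
elim: ls A => [|l ls IH] A lA; first by rewrite /= /init/= andbF.
rewrite sol_true big1// => A' sA'.
rewrite IH ?(lightS sA')// mulr0 add0r zet_light ?mul0r//.
by apply: lightS lA; exact: finset.subsetDl.
Qed.

Lemma tau_light h D x : light D -> tauM h D x = 0.
Proof. by rewrite /tau => ->. Qed.

Lemma tailpart_light k ls A w : light A -> tailpart k ls A w = 0.
Proof.
move=> lA; rewrite /tailpart big1// => l _; rewrite big1// => A' _.
by rewrite tau_light ?mul0r//; apply: lightS lA; exact: finset.subsetDl.
Qed.

(** The second summand has the tail at [l] itself. In all other terms the tail is at some [j] of
    [ls] and is taken out before the step at [l]; the order of these two steps has to be
    reversed. *)
Lemma tailpart_cons k l ls A w : l \notin ls -> tailpart k (l :: ls) A w =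
  \sum_(A' : I | A' \subset A) (lam (k - l) (A :\: A') (Z l w) * tailpart k ls A' w +
     tauM (k - l) (A :\: A') (Z l w) * sol k ls (A', false) w).
Proof.
move=> lls; rewrite /tailpart big_cons big_split/= eqxx addrC; congr (_ + _).
rewrite (eq_big_seq (fun j => \sum_(A' : I | A' \subset A) \sum_(B : I | B \subset A')
  tauM (k - j) (A :\: A') (Z j w) * (lam (k - l) (A' :\: B) (Z l w) *
      sol k (rem j ls) (B, false) w))); last first.
  move=> j jls; apply: eq_bigr => A' _.
  have -> : (l == j) = false by apply/eqP => lj; rewrite lj jls in lls.
  by rewrite sol_false mulr_sumr.
under [RHS]eq_bigr do rewrite mulr_sumr.
rewrite [RHS]exchange_big/=; apply: eq_bigr => j _.
rewrite (exchange_big_dep (fun B : I => B \subset A))/=; last first.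
  by move=> A' B sA' sB; exact: fintype.subset_trans sB sA'.
under [RHS]eq_bigr do rewrite mulr_sumr.
rewrite [RHS](exchange_big_dep (fun B : I => B \subset A))/=; last first.
  by move=> A' B sA' sB; exact: fintype.subset_trans sB sA'.
apply: eq_bigr => B sB.
(* [h] is an involution on the sets between [B] and [A] and swaps the shares of [j] and [l]:
   [A :\: h A'] is [A' :\: B], and [h A' :\: B] is [A :\: A']. *)
pose h (A' : I) := B :|: (A :\: A').
have hK (A' : I) : (A' \subset A) && (B \subset A') -> h (h A') = A'.
  move=> /andP[s1 s2]; apply/finset.setP => r; rewrite !inE.
  have := fintype.subsetP s1 r; have := fintype.subsetP s2 r; have := fintype.subsetP sB r.
  by move=> /implyP + /implyP + /implyP; case: (r \in A); case: (r \in A'); case: (r \in B).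
have hE (A' : I) : (h A' \subset A) && (B \subset h A') && (h (h A') == A') =
    (A' \subset A) && (B \subset A').
  apply/idP/idP => [/andP[/andP[s1 s2] /eqP hh]|/andP[s1 s2]].
    apply/andP; split; last by rewrite -hh finset.subsetUl.
    by rewrite -hh; apply/fintype.subsetP => r; rewrite !inE => /orP[/(fintype.subsetP sB)//|/andP[]].
  rewrite hK ?s1// eqxx andbT finset.subsetUl andbT.
  by apply/fintype.subsetP => r; rewrite !inE => /orP[/(fintype.subsetP sB)//|/andP[]].
rewrite (reindex_onto h h)//=.
apply: eq_big => [A'|A']; rewrite hE// => /andP[s1 s2].
have e1 : A :\: h A' = A' :\: B.
  apply/finset.setP => r; rewrite !inE.
  have := fintype.subsetP s1 r; have := fintype.subsetP s2 r; have := fintype.subsetP sB r.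
  by move=> /implyP + /implyP + /implyP; case: (r \in A); case: (r \in A'); case: (r \in B).
have e2 : h A' :\: B = A :\: A'.
  apply/finset.setP => r; rewrite !inE.
  have := fintype.subsetP s1 r; have := fintype.subsetP s2 r; have := fintype.subsetP sB r.
  by move=> /implyP + /implyP + /implyP; case: (r \in A); case: (r \in A'); case: (r \in B).
by rewrite e1 e2 mulrCA.
Qed.

(** After a light coefficient all three parts continue by induction. After a heavy one the remaining
    set is light, so its product is [sol k ls (A', false) w] alone, and the three parts come from
    splitting the coefficient. *)
Lemma decomposition k ls A w : uniq ls ->
  prodX k ls A w = sol k ls (A, false) w + sol k ls (A, true) w + tailpart k ls A w.
Proof.
elim: ls A => [|l ls IH] A.
  move=> _; rewrite /prodX /tailpart !big_nil addr0 /= /init/= andbF addr0 andbT.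
  have [->|A0] := eqVneq A finset.set0; first by rewrite big_set0.
  have /finset.set0Pn[r rA] := A0.
  by rewrite (bigD1 r)//= big_nil mul0r.
move=> /andP[lls uls].
rewrite prodX_cons sol_false sol_true tailpart_cons// -!big_split/=.
apply: eq_bigr => A' sA'; rewrite IH//.
rewrite (lam_zet_tau P Z y N M).
have [lD|lD] := boolP (light (A :\: A')).
  by rewrite zet_light// tau_light//; ring.
have lA' := light_compl sA' lD.
by rewrite sol_light// tailpart_light//; ring.
Qed.

End decomposition.

(** * Integrability of the components and first moments of the tails *)

Section component_bounds.
Context d (T : measurableType d) (R : realType) (P : probability T R).
Context d' (E : measurableType d') (Z : int -> T -> E).
Hypothesis iidZ : iid_family P Z.
Local Notation Lz := (@Lz _ T R P _ E Z).
Local Notation Mu := (@Mu _ T R P _ E Z).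
Context (s : nat) (y : int -> 'I_s -> E -> R) (N : 'I_s -> E -> R).
Context (e : int -> R) (K A0 : R).
Notation I := {set 'I_s}.
Implicit Types (A B D : I).
Hypothesis pm : product_model P Z y N e K.
Hypothesis eA : forall k ls, uniq ls -> \sum_(l <- ls) e (k - l) ^+ 2 <= A0.
Context (M Lam del : R).
Hypothesis Lam1 : 1 <= Lam.
Hypothesis heavy2 : forall D, ~~ light D ->
  Mu (fun x => prodD N D x ^+ 2 * (prodD N D x <= M)%R%:R) <= K * Lam ^+ 2.
Hypothesis del0 : 0 <= del.
Hypothesis heavy1 : forall D, ~~ light D ->
  Mu (fun x => prodD N D x * (M < prodD N D x)%R%:R) <= K * del.
Local Notation lam := (lam P Z y N M).
Local Notation zet := (zet P Z y N M).
Local Notation tauM := (tau y N M).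
Local Notation wt := (weight e).
Local Notation GG := (G P Z y N M).
Local Notation sol := (lin Z GG (@init R s)).
Local Notation mom := (M2 P Z GG (@init R s)).
Local Notation CE := (CE s K A0).
Local Notation nR := (n2 R s).

Lemma measurable_sol k ls j : measurable_fun setT (sol k ls j).
Proof.
elim: ls j => [|l ls IH] j; first exact: measurable_cst.
apply: measurable_sum => j'; apply: measurable_funM; last exact: IH.
apply: measurableT_comp; last exact: iid_measurable iidZ l.
have [[D ->]|[D ->]|->] := G_cases P Z y N M (k - l) j j'.
- exact: measurable_lam pm M _ _.
- exact: measurable_zet pm M _ _.
- exact: measurable_cst.
Qed.

Lemma sol_set0 k ls w : sol k ls (finset.set0, false) w = 1.
Proof.
elim: ls => [|l ls IH]; first by rewrite /= /init/= eqxx.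
rewrite sol_false (big_pred1 finset.set0); last by move=> B; rewrite /= finset.subset0.
by rewrite IH finset.setD0 lam0 mulr1.
Qed.

Lemma sol_mul_L1 k k' ls j i : uniq ls -> L1 P (fun w => sol k ls j w * sol k' ls i w).
Proof.
move=> u; apply: (ind_L1 (ls := ls)).
by apply: (lin_ind iidZ _ (Lz_G iidZ pm heavy2)).
Qed.

Lemma sol_L2 k ls j : uniq ls -> L1 P (fun w => sol k ls j w ^+ 2).
Proof. by move=> u; exact: (sol_mul_L1 k k j j u). Qed.

Lemma covE k k' ls A B : cov P Z y N M k k' ls (A, B) =
  Ex P (fun w => sol k ls (A, false) w * sol k' ls (B, false) w) -
  Ex P (sol k ls (A, false)) * Ex P (sol k' ls (B, false)).
Proof.
rewrite /cov /M2 /=; congr (_ - _ * _); apply: eq_Ex => w.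
  by rewrite sol_set0 mulr1.
by rewrite sol_set0 mul1r.
Qed.

Let tl D (x : E) : R := prodD N D x * (M < prodD N D x)%R%:R.

Let mND D : measurable_fun setT (prodD N D).
Proof. by apply: measurable_prodD => r; exact: pm_mN pm r. Qed.

Lemma measurable_gtind D : measurable_fun setT (fun x => (M < prodD N D x)%R%:R : R).
Proof.
rewrite (_ : (fun x => _) = \1_(~` [set x | prodD N D x <= M])).
  apply: measurable_indic; apply: measurableC; rewrite -[X in measurable X]setTI.
  exact: measurable_fun_le.
apply/funext => x; rewrite indicE ltNge; case: leP => h.
  by rewrite memNset//=; apply.
by rewrite mem_set//= leNgt h.
Qed.

Let tl_ge0 D x : 0 <= tl D x.
Proof. by rewrite mulr_ge0// (ND_ge0 pm). Qed.

Lemma tau_heavy h D x : ~~ light D ->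
  tauM h D x = prodD (y h) D x * (M < prodD N D x)%R%:R.
Proof. by rewrite /tau => /negbTE ->. Qed.

Lemma tau_le h D x : ~~ light D -> `|tauM h D x| <= e h ^+ 2 * tl D x.
Proof.
move=> lD; rewrite (tau_heavy _ _ lD) normrM (ger0_norm (ler0n _ _)) mulrA.
by rewrite ler_wpM2r// -(weight_heavy e h lD) (yD_le pm).
Qed.

Lemma measurable_tau h D : measurable_fun setT (tauM h D).
Proof.
have [lD|lD] := boolP (light D).
  by rewrite (_ : tauM h D = fun=> 0); [exact: measurable_cst|apply/funext => x; rewrite tau_light].
rewrite (_ : tauM h D = fun x => prodD (y h) D x * (M < prodD N D x)%R%:R).
  apply: measurable_funM; last exact: measurable_gtind.
  by apply: measurable_prodD => r; exact: pm_my pm h r.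
by apply/funext => x; rewrite (tau_heavy _ _ lD).
Qed.

Let Lz_tl D : Lz (tl D).
Proof.
have mt : measurable_fun setT (tl D) by apply: measurable_funM => //; exact: measurable_gtind.
split => //; have [[_ LN] _] := pm_L1 pm D.
apply: (L1_le _ LN); first by apply: measurableT_comp => //; exact: iid_measurable iidZ 0.
move=> w; rewrite ger0_norm// ler_piMr ?(ND_ge0 pm)//.
by rewrite lern1; case: (_ < _).
Qed.

(** The tail has only a first moment. The solution is bounded by [1 + x ^+ 2], whose expectation is
    known; as [l] is removed from its list, the expectation of the product factors. *)
Lemma tailterm k l ls D A : uniq ls -> l \in ls ->
  L1 P (fun w => tauM (k - l) D (Z l w) * sol k (rem l ls) (A, false) w) /\
  Ex P (fun w => `|tauM (k - l) D (Z l w) * sol k (rem l ls) (A, false) w|) <=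
    e (k - l) ^+ 2 * (K * del * (1 + CE)).
Proof.
move=> u lls; have u' : uniq (rem l ls) by exact: rem_uniq.
have lr : l \notin rem l ls by rewrite mem_rem_uniqF.
have CE0 : 0 <= 1 + CE by rewrite addr_ge0// (le_trans ler01)// (CE_ge1 s K eA).
have K0 : 0 <= K by rewrite (le_trans ler01)// (pm_K pm).
have [lD|lD] := boolP (light D).
  under [X in L1 _ X]eq_fun do rewrite tau_light// mul0r.
  under [X in Ex _ X]eq_fun do rewrite tau_light// mul0r normr0.
  split; first exact: L1_cst.
  by rewrite Ex_cst mulr_ge0 ?sqr_ge0// !mulr_ge0.
pose f w := 1 + sol k (rem l ls) (A, false) w * sol k (rem l ls) (A, false) w.
have If : ind P Z (rem l ls) f.
  apply: ind_D; first exact: ind_cst.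
  exact: (lin_ind iidZ _ (Lz_G iidZ pm heavy2)).
have [/ind_L1 LF EF] := ind_cons lr If (Lz_tl D).
have bd w : `|tauM (k - l) D (Z l w) * sol k (rem l ls) (A, false) w| <=
    e (k - l) ^+ 2 * (tl D (Z l w) * f w).
  rewrite normrM mulrA ler_pM ?tau_le// /f -expr2.
  rewrite -(real_normK (num_real (sol _ _ _ _))).
  set a := `|_|; have : 0 <= a by exact: normr_ge0.
  by have := sqr_ge0 (a - 1); nra.
have m1 : measurable_fun setT (fun w => tauM (k - l) D (Z l w) * sol k (rem l ls) (A, false) w).
  apply: measurable_funM; last exact: measurable_sol.
  by apply: measurableT_comp; [exact: measurable_tau|exact: iid_measurable iidZ l].
have L : L1 P (fun w => tauM (k - l) D (Z l w) * sol k (rem l ls) (A, false) w).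
  by apply: (L1_le m1 _ bd); exact: L1Z.
split => //; apply: (@le_trans _ _ (Ex P (fun w => e (k - l) ^+ 2 * (tl D (Z l w) * f w)))).
  by apply: Ex_le => //; [exact: L1_norm|exact: L1Z].
rewrite ExZ// EF ler_wpM2l ?sqr_ge0//.
apply: ler_pM.
- by apply: Ex_ge0 => w; exact: tl_ge0.
- by apply: Ex_ge0 => w; rewrite addr_ge0// -expr2 sqr_ge0.
- exact: heavy1.
rewrite ExD ?Ex_cst; [|exact: L1_cst|exact: sol_mul_L1].
rewrite lerD2l (le_trans (ler_norm _))//.
exact: (LL_le iidZ pm eA heavy2 k k A A u').
Qed.

(** A heavy set carries the weight [e (k - l) ^+ 2], so the sum over [l] is at most [A0] for every
    window. *)
Lemma tailpart_le k ls A : uniq ls ->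
  L1 P (tailpart P Z y N M k ls A) /\
  Ex P (fun w => `|tailpart P Z y N M k ls A w|) <= nR * (A0 * (K * del * (1 + CE))).
Proof.
move=> u.
(* The value 0 off the list is needed since [L1_sum] asks for integrability at every index, while
   [tailterm] requires [l \in ls]. *)
pose t l A' w := if l \in ls then tauM (k - l) (A :\: A') (Z l w) * sol k (rem l ls) (A', false) w else 0.
have tE : tailpart P Z y N M k ls A = fun w => \sum_(l <- ls) \sum_(A' : I | A' \subset A) t l A' w.
  by apply/funext => w; apply: eq_big_seq => l lls; apply: eq_bigr => A' _; rewrite /t lls.
have Lt l A' : L1 P (t l A').
  rewrite /t; have [lls|lls] := boolP (l \in ls); last exact: L1_cst.
  by have [] := tailterm k (A :\: A') A' u lls.
have LV : L1 P (tailpart P Z y N M k ls A).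
  by rewrite tE; apply: L1_sum => l; apply: L1_sum => A'; exact: Lt.
split => //.
apply: (@le_trans _ _ (Ex P (fun w => \sum_(l <- ls) \sum_(A' : I | A' \subset A) `|t l A' w|))).
  apply: Ex_le; first exact: L1_norm.
    by apply: L1_sum => l; apply: L1_sum => A'; exact: L1_norm.
  move=> w; rewrite tE (le_trans (ler_norm_sum _ _ _))// ler_sum// => l _.
  exact: ler_norm_sum.
rewrite Ex_sum; last by move=> l; apply: L1_sum => A'; exact: L1_norm.
have CE0 : 0 <= 1 + CE by rewrite addr_ge0// (le_trans ler01)// (CE_ge1 s K eA).
have K0 : 0 <= K by rewrite (le_trans ler01)// (pm_K pm).
apply: (@le_trans _ _ (\sum_(l <- ls) nR * (e (k - l) ^+ 2 * (K * del * (1 + CE))))).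
  rewrite big_seq [leRHS]big_seq; apply: ler_sum => l lls.
  rewrite Ex_sum; last by move=> A'; exact: L1_norm.
  apply: (@le_trans _ _ (\sum_(A' : I) e (k - l) ^+ 2 * (K * del * (1 + CE)))).
    rewrite big_mkcond/=; apply: ler_sum => A' _; case: ifP => _.
      have [_] := tailterm k (A :\: A') A' u lls.
      by rewrite /t lls.
    by rewrite mulr_ge0 ?sqr_ge0// !mulr_ge0.
  rewrite sumr_const -mulr_natl ler_wpM2r//.
    by rewrite mulr_ge0 ?sqr_ge0// !mulr_ge0.
  rewrite /n2 ler_nat card_prod.
  have : (0 < #|{: I}|)%N by apply/card_gt0P; exists finset.set0.
  by case: #|{: I}| => // n _; rewrite leq_pmulr.
rewrite -mulr_sumr ler_wpM2l ?ler0n// -mulr_suml ler_wpM2r ?eA//.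
by rewrite !mulr_ge0.
Qed.

End component_bounds.

(** * Sharper covariances for two factors *)

Section two_factors.
Context d (T : measurableType d) (R : realType) (P : probability T R).
Context d' (E : measurableType d') (Z : int -> T -> E).
Hypothesis iidZ : iid_family P Z.
Local Notation Lz := (@Lz _ T R P _ E Z).
Local Notation MU := (@Mu _ T R P _ E Z).
Context (s : nat) (y : int -> 'I_s -> E -> R) (N : 'I_s -> E -> R).
Context (e : int -> R) (K : R).
Notation I := {set 'I_s}.
Implicit Types (A B D : I).
Hypothesis pm : product_model P Z y N e K.
Context (M Lam : R).
Hypothesis heavy2 : forall D, ~~ light D ->
  MU (fun x => prodD N D x ^+ 2 * (prodD N D x <= M)%R%:R) <= K * Lam ^+ 2.
Local Notation lamM := (lam P Z y N M).
Local Notation sol := (lin Z (G P Z y N M) (@init R s)).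
Local Notation covM := (cov P Z y N M).
Local Notation ML h h' D D' := (MU (fun x => lamM h D x * lamM h' D' x)).
Local Notation mean k ls A := (Ex P (sol k ls (A, false))).
Variable er : int -> 'I_s -> R.
Hypothesis er0 : forall h r, 0 < er h r.
Hypothesis yer : forall h r x, `|y h r x| <= er h r * N r x.
Hypothesis s2 : s = 2%N.

(** The weights [er] retain the decay of each factor separately, which the common weight [e]
    forgets; for [s = 2] the rate depends on the sum of both exponents. *)
Definition erD h D : R := \prod_(r in D) er h r.
Definition gD k k' ls A B : R := \sum_(l <- ls) erD (k - l) A * erD (k' - l) B.

Let erD_ge0 h D : 0 <= erD h D. Proof. by apply: prodr_ge0 => r _; exact: ltW. Qed.
Let gD_ge0 k k' ls A B : 0 <= gD k k' ls A B.
Proof. by apply: sumr_ge0 => l _; rewrite mulr_ge0. Qed.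
Let K0 : 0 < K. Proof. exact: lt_le_trans ltr01 (pm_K pm). Qed.

Lemma cov_cons_sum k k' l ls A B : uniq (l :: ls) -> covM k k' (l :: ls) (A, B) =
  \sum_(A' : I | A' \subset A) \sum_(B' : I | B' \subset B)
   (ML (k - l) (k' - l) (A :\: A') (B :\: B') * covM k k' ls (A', B') +
    (ML (k - l) (k' - l) (A :\: A') (B :\: B') -
     MU (lamM (k - l) (A :\: A')) * MU (lamM (k' - l) (B :\: B'))) *
    (mean k ls A' * mean k' ls B')).
Proof.
move=> u; rewrite (cov_cons iidZ pm heavy2)//= -big_split/=.
apply: eq_bigr => A' _; rewrite -big_split/=; apply: eq_bigr => B' _.
congr (_ + _ * (_ * _)); apply: eq_Ex => w; rewrite sol_set0 mulr1//.
Qed.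

Lemma cov_step k k' l ls A B (X : I -> I -> R) : uniq (l :: ls) ->
  (forall A' B', 0 <= X A' B') ->
  (forall A' B', A' \subset A -> B' \subset B -> (A', B') != (A, B) ->
    `|ML (k - l) (k' - l) (A :\: A') (B :\: B') * covM k k' ls (A', B') +
    (ML (k - l) (k' - l) (A :\: A') (B :\: B') -
     MU (lamM (k - l) (A :\: A')) * MU (lamM (k' - l) (B :\: B'))) *
    (mean k ls A' * mean k' ls B')| <= X A' B') ->
  `|covM k k' (l :: ls) (A, B)| <= `|covM k k' ls (A, B)| + \sum_A' \sum_B' X A' B'.
Proof.
move=> u X0 HX; rewrite cov_cons_sum// pair_big_dep/= (bigD1 (A, B)) ?fintype.subxx//=.
have M00 h h' : ML h h' finset.set0 finset.set0 = 1.
  by rewrite /Mu; under eq_Ex do rewrite !lam0 mulr1; rewrite Ex_cst.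
rewrite !finset.setDv M00 mul1r !Mu_lam_set0 mulr1 subrr mul0r addr0.
apply: (le_trans (ler_normD _ _)); rewrite lerD2l.
apply: (le_trans (ler_norm_sum _ _ _)).
rewrite pair_big_dep/= big_mkcond/=; apply: ler_sum => -[A' B'] _ /=.
by case: ifPn => // /andP[/andP[sA sB] ne]; exact: HX.
Qed.

Lemma cov_set0l k k' ls B : covM k k' ls (finset.set0, B) = 0.
Proof.
rewrite covE; under eq_Ex do rewrite sol_set0 mul1r.
have -> : mean k ls finset.set0 = 1.
  by under eq_Ex do rewrite sol_set0; rewrite Ex_cst.
by rewrite mul1r subrr.
Qed.

Lemma cov_set0r k k' ls A : covM k k' ls (A, finset.set0) = 0.
Proof.
rewrite covE; under eq_Ex do rewrite sol_set0 mulr1.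
have -> : mean k' ls finset.set0 = 1.
  by under eq_Ex do rewrite sol_set0; rewrite Ex_cst.
by rewrite mulr1 subrr.
Qed.

(** Along the recursion a singleton either stays or is removed with a coefficient of mean zero, and
    its initial value is zero. *)
Lemma mean1 k ls A : uniq ls -> #|A| = 1%N -> mean k ls A = 0.
Proof.
move=> u A1; have meanE ls' B : mean k ls' B = M2 P Z (G P Z y N M) (@init R s) k k ls' (B, false) (finset.set0, false).
  by apply: eq_Ex => w; rewrite sol_set0 mulr1.
elim: ls u => [|l ls IH] u.
  rewrite meanE M2_nil /init/=; have [A0|_] := eqVneq A finset.set0.
    by rewrite A0 cards0 in A1.
  by rewrite mul0r.
rewrite meanE (mean_cons iidZ pm heavy2)// big1// => A' sA.
have [AA|AA] := eqVneq A' A.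
  by rewrite AA -meanE IH ?mulr0//; case/andP : u.
have -> : A' = finset.set0.
  apply/eqP; rewrite -cards_eq0 -leqn0 -ltnS -A1.
  by apply: fintype.proper_card; rewrite finset.properEneq AA.
by rewrite finset.setD0 (Mu_lam1 pm)// mul0r.
Qed.

Lemma ML1_le h h' D D' : #|D| = 1%N -> #|D'| = 1%N ->
  `|ML h h' D D'| <= K ^+ 2 * (erD h D * erD h' D').
Proof.
move=> /eqP/cards1P[r ->] /eqP/cards1P[r' ->].
have l1 (t : 'I_s) : light [set t]%SET by rewrite /light cards1 mul1n leq_maxr.
have yN h1 t : L1 P (fun w => y h1 t (Z 0 w) ^+ 2) /\
    Ex P (fun w => y h1 t (Z 0 w) ^+ 2) <= (K * er h1 t) ^+ 2.
  have [] := pm_light pm (l1 t); rewrite /prodD.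
  under [X in L1 _ X]eq_fun do rewrite big_set1.
  under [X in Ex _ X]eq_fun do rewrite big_set1.
  move=> L LK.
  have b w : `|y h1 t (Z 0 w) ^+ 2| <= er h1 t ^+ 2 * N t (Z 0 w) ^+ 2.
    rewrite normrX -exprMn lerXn2r ?nnegrE ?mulr_ge0 ?(pm_N0 pm)//.
    exact: ltW.
  have m1 : measurable_fun setT (fun w => y h1 t (Z 0 w) ^+ 2).
    apply: measurable_funX; apply: measurableT_comp; first exact: pm_my pm h1 t.
    exact: iid_measurable iidZ 0.
  have L' : L1 P (fun w => y h1 t (Z 0 w) ^+ 2) by apply: (L1_le m1 _ b); exact: L1Z.
  split => //; apply: (@le_trans _ _ (er h1 t ^+ 2 * Ex P (fun w => N t (Z 0 w) ^+ 2))).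
    rewrite -ExZ//; apply: Ex_le => //; first exact: L1Z.
    by move=> w; apply: le_trans (b w); exact: ler_norm.
  rewrite exprMn mulrC ler_wpM2r ?sqr_ge0// (le_trans LK)//.
  by rewrite expr2 ler_peMl ?(pm_K pm)// ltW.
have [La Ea] := yN h r; have [Lb Eb] := yN h' r'.
rewrite /erD !big_set1 (_ : K ^+ 2 * _ = (K * er h r) * (K * er h' r')); last by ring.
have -> : ML h h' [set r]%SET [set r']%SET = Ex P (fun w => y h r (Z 0 w) * y h' r' (Z 0 w)).
  by apply: eq_Ex => w; rewrite !lam_light// /prodD !big_set1.
apply: Ex_mul_le => //; try by rewrite mulr_gt0.
- by apply: measurableT_comp; [exact: pm_my pm h r|exact: iid_measurable iidZ 0].
- by apply: measurableT_comp; [exact: pm_my pm h' r'|exact: iid_measurable iidZ 0].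
Qed.

(** With one factor on each side, only the removal of both at the same [l] is a source: removing one
    alone leaves a mean equal to zero. *)
Lemma cov1_le k k' ls A B : uniq ls -> #|A| = 1%N -> #|B| = 1%N ->
  `|covM k k' ls (A, B)| <= K ^+ 2 * gD k k' ls A B.
Proof.
move=> u A1 B1; elim: ls u => [|l ls IH] u.
  rewrite /gD big_nil mulr0 covE /=.
  have -> : Ex P (fun w : T => init R (A, false) * init R (B, false)) =
      init R (A, false) * init R (B, false) by rewrite Ex_cst.
  by rewrite !Ex_cst subrr normr0.
have u' : uniq ls by case/andP : u.
have sub1 (C C' : I) : #|C| = 1%N -> C' \subset C -> C' != C -> C' = finset.set0.
  move=> C1 sC CC; apply/eqP; rewrite -cards_eq0 -leqn0 -ltnS -C1.
  by apply: fintype.proper_card; rewrite finset.properEneq CC.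
pose X (A' B' : I) := if (A' == finset.set0) && (B' == finset.set0)
  then K ^+ 2 * (erD (k - l) A * erD (k' - l) B) else 0.
have X0 A' B' : 0 <= X A' B'.
  by rewrite /X; case: ifP => _ //; rewrite mulr_ge0 ?sqr_ge0// mulr_ge0.
have := @cov_step k k' l ls A B X u X0.
have -> : \sum_A' \sum_B' X A' B' = K ^+ 2 * (erD (k - l) A * erD (k' - l) B).
  rewrite (bigD1 finset.set0)//= (bigD1 finset.set0)//= /X !eqxx/=.
  rewrite big1 ?addr0; last by move=> B' /negbTE ->.
  by rewrite big1 ?addr0// => A' /negbTE ->; rewrite big1.
move=> H; apply: (@le_trans _ _ (`|covM k k' ls (A, B)| + K ^+ 2 * (erD (k - l) A * erD (k' - l) B))); last first.
  by rewrite /gD big_cons mulrDr addrC lerD2l; exact: IH.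
apply: H => A' B' sA sB ne.
have M0l h h' D : ML h h' finset.set0 D = MU (lamM h' D) by apply: eq_Ex => w; rewrite lam0 mul1r.
have M0r h h' D : ML h h' D finset.set0 = MU (lamM h D) by apply: eq_Ex => w; rewrite lam0 mulr1.
have [AA|AA] := eqVneq A' A.
  have BB : B' != B by apply: contra ne => /eqP ->; rewrite AA.
  rewrite (sub1 _ _ B1 sB BB) cov_set0r mulr0 add0r AA finset.setDv M0l.
  by rewrite Mu_lam_set0 mul1r subrr mul0r normr0.
rewrite (sub1 _ _ A1 sA AA) cov_set0l mulr0 add0r finset.setD0 (Mu_lam1 pm)// mul0r subr0.
have [BB|BB] := eqVneq B' B.
  by rewrite BB finset.setDv M0r (Mu_lam1 pm)// mul0r normr0.
rewrite (sub1 _ _ B1 sB BB) finset.setD0 /X !eqxx/=.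
have -> : mean k ls finset.set0 = 1 by under eq_Ex do rewrite sol_set0; rewrite Ex_cst.
have -> : mean k' ls finset.set0 = 1 by under eq_Ex do rewrite sol_set0; rewrite Ex_cst.
by rewrite !mulr1 ML1_le.
Qed.

Local Notation TT := [set: 'I_s]%SET.

(** The full set is heavy, so its coefficient in [lam] is constant and correlates with nothing;
    singletons have mean zero. There remain the steps that remove one factor on each side and leave
    one on each side. Inserting [cov1_le] there gives a product of two overlap sums. *)
Lemma cov2_le k k' ls : uniq ls ->
  `|covM k k' ls (TT, TT)| <= K ^+ 4 *
   \sum_(A : I | #|A| == 1%N) \sum_(B : I | #|B| == 1%N)
     gD k k' ls A B * gD k k' ls (TT :\: A) (TT :\: B).
Proof.
move=> u; have cT : #|TT| = 2%N by rewrite cardsT card_ord s2.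
have K4 : 0 <= K ^+ 4 by rewrite exprn_ge0// ltW.
elim: ls u => [|l ls IH] u.
  rewrite covE /=.
  have -> : Ex P (fun w : T => init R (TT, false) * init R (TT, false)) =
      init R (TT, false) * init R (TT, false) by rewrite Ex_cst.
  rewrite !Ex_cst subrr normr0; apply: mulr_ge0; first exact: K4.
  by apply: sumr_ge0 => A _; apply: sumr_ge0 => B _; rewrite mulr_ge0.
have u' : uniq ls by case/andP : u.
have heavyT : ~~ light TT by rewrite /light cT s2.
pose X (A B : I) := if (#|A| == 1%N) && (#|B| == 1%N) then
  K ^+ 4 * (gD k k' ls A B * (erD (k - l) (TT :\: A) * erD (k' - l) (TT :\: B))) else 0.
have X0 A' B' : 0 <= X A' B'.
  by rewrite /X; case: ifP => _ //; apply: mulr_ge0; rewrite ?K4// !mulr_ge0.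
apply: (@le_trans _ _ (`|covM k k' ls (TT, TT)| + \sum_A' \sum_B' X A' B')); last first.
  apply: (le_trans (lerD (IH u') (lexx _))).
  rewrite (_ : \sum_A' \sum_B' X A' B' = K ^+ 4 * \sum_(A : I | #|A| == 1%N) \sum_(B : I | #|B| == 1%N)
     gD k k' ls A B * (erD (k - l) (TT :\: A) * erD (k' - l) (TT :\: B))); last first.
    rewrite mulr_sumr [RHS]big_mkcond/=; apply: eq_bigr => A _.
    rewrite mulr_sumr [in RHS]big_mkcond/= /X; case: ifP => _; last by rewrite big1.
    by apply: eq_bigr => B _.
  rewrite -mulrDr -big_split/=; apply: ler_wpM2l; first exact: K4.
  apply: ler_sum => A _; rewrite -big_split/=; apply: ler_sum => B _.
  (* A product of two sums grows by three terms when both are extended; one of them is the required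
     source. *)
  rewrite [in leRHS]/gD !big_cons -/(gD k k' ls A B) -/(gD k k' ls (TT :\: A) (TT :\: B)).
  set x := erD _ A * _; set x' := erD _ (TT :\: A) * _.
  have x0 : 0 <= x by rewrite mulr_ge0.
  have x'0 : 0 <= x' by rewrite mulr_ge0.
  have := gD_ge0 k k' ls A B; have := gD_ge0 k k' ls (TT :\: A) (TT :\: B).
  by move: (gD _ _ _ _ _) (gD _ _ _ _ _) => a b a0 b0; have := mulr_ge0 x0 x'0; have := mulr_ge0 x0 a0; nra.
apply: cov_step => // A' B' _ _ ne.
have M0l h h' D : ML h h' finset.set0 D = MU (lamM h' D) by apply: eq_Ex => w; rewrite lam0 mul1r.
have M0r h h' D : ML h h' D finset.set0 = MU (lamM h D) by apply: eq_Ex => w; rewrite lam0 mulr1.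
have MTl h h' D : ML h h' TT D = MU (lamM h TT) * MU (lamM h' D).
  rewrite lam_heavy// /Mu Ex_cst -ExZ//; exact: (Lz_lam iidZ pm M h' D).2.
have MTr h h' D : ML h h' D TT = MU (lamM h D) * MU (lamM h' TT).
  rewrite mulrC -MTl; apply: eq_Ex => w; exact: mulrC.
have c3 (A : I) : [\/ A = finset.set0, #|A| = 1%N | A = TT].
  have := max_card (mem A); rewrite card_ord [X in (_ <= X)%N]s2.
  case cA : #|A| => [|[|[|n]]]// _.
  - by constructor 1; apply/eqP; rewrite -cards_eq0 cA.
  - by constructor 2.
  - by constructor 3; apply/eqP; rewrite finset.eqEcard finset.subsetT cT cA.
have [A0|A1|AT] := c3 A'.
- by rewrite A0 cov_set0l mulr0 add0r finset.setD0 MTl subrr mul0r normr0.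
- have [B0|B1|BT] := c3 B'.
  + by rewrite B0 cov_set0r mulr0 add0r finset.setD0 MTr subrr mul0r normr0.
  + rewrite mean1// mul0r mulr0 addr0 /X A1 B1 !eqxx/=.
    have cD (C : I) : #|C| = 1%N -> #|TT :\: C| = 1%N.
      by move=> C1; rewrite cardsD finset.setTI cT C1.
    rewrite normrM mulrC (_ : K ^+ 4 * _ = (K ^+ 2 * gD k k' ls A' B') *
      (K ^+ 2 * (erD (k - l) (TT :\: A') * erD (k' - l) (TT :\: B')))); last by ring.
    by rewrite ler_pM// ?cov1_le// ML1_le// cD.
  + have D1 : #|TT :\: A'| = 1%N by rewrite cardsD finset.setTI cT A1.
    by rewrite BT finset.setDv M0r (Mu_lam1 pm)// !mul0r subrr mul0r addr0 normr0.
- have [B0|B1|BT] := c3 B'.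
  + by rewrite B0 cov_set0r mulr0 add0r finset.setD0 MTr subrr mul0r normr0.
  + have D1 : #|TT :\: B'| = 1%N by rewrite cardsD finset.setTI cT B1.
    by rewrite AT finset.setDv M0l (Mu_lam1 pm _ _ D1) mulr0 !mul0r subrr mul0r addr0 normr0.
  + by rewrite AT BT eqxx in ne.
Qed.

End two_factors.

(** * Power weights on the integers *)

Section power_sums.
Context (R : realType).
Implicit Types (x t : R).

Lemma geo_sum_le (q : R) n : 0 <= q -> q < 1 -> \sum_(0 <= i < n) q ^+ i <= (1 - q)^-1.
Proof.
move=> q0 q1; have q1' : 0 < 1 - q by rewrite subr_gt0.
have H : (1 - q) * \sum_(0 <= i < n) q ^+ i = 1 - q ^+ n.
  elim: n => [|n IH]; first by rewrite big_nil expr0 subrr mulr0.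
  by rewrite big_nat_recr//= mulrDr IH exprS; ring.
rewrite -(ler_pM2l q1') H divff ?gt_eqF//.
by rewrite gerBl exprn_ge0.
Qed.

Lemma powR_lt1 (a x : R) : 1 < a -> x < 0 -> a `^ x < 1.
Proof.
move=> a1 x0; have a0 : 0 < a := lt_trans ltr01 a1.
rewrite -(opprK x) powRN invf_lt1 ?powR_gt0//.
have -> : 1 = 1 `^ (- x) by rewrite powR1.
by rewrite gt0_ltr_powR ?oppr_gt0// nnegrE ltW.
Qed.

(** The shift by one gives the value 1 at [i = 0], where a plain negative power would be
    degenerate. *)
Definition pwn t (i : nat) : R := i.+1%:R `^ (- t).

Lemma pwn_ge0 t i : 0 <= pwn t i. Proof. exact: powR_ge0. Qed.

(** Dyadic condensation: the block from [2 ^ j] to [2 ^ j.+1] contributes at most [q ^+ j]. *)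
Lemma riemann_bound t : 1 < t -> exists2 C : R, 0 <= C &
  forall n, \sum_(0 <= i < n) pwn t i <= C.
Proof.
move=> t1; pose q : R := 2 `^ (1 - t).
have q0 : 0 <= q by exact: powR_ge0.
have q1 : q < 1.
  by apply: powR_lt1; lra.
have H j : \sum_(0 <= i < 2 ^ j) pwn t i <= 1 + \sum_(0 <= i < j) q ^+ i.
  elim: j => [|j IH].
    by rewrite expn0 big_nat1 big_nil addr0 /pwn powR1.
  rewrite (@big_cat_nat _ _ _ (2 ^ j))//=; last by rewrite leq_exp2l.
  rewrite big_nat_recr//= addrA lerD//.
  apply: (@le_trans _ _ (\sum_(2 ^ j <= i < 2 ^ j.+1) (2 ^ j)%:R `^ (- t))).
    rewrite big_nat_cond [leRHS]big_nat_cond; apply: ler_sum => i /andP[/andP[ji _] _].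
    rewrite /pwn !powRN lef_pV2 ?posrE ?powR_gt0 ?ltr0n ?expn_gt0//.
    rewrite ge0_ler_powR ?nnegrE ?ler0n//; first by lra.
    by rewrite ler_nat (leq_trans ji).
  rewrite sumr_const_nat (_ : (2 ^ j.+1 - 2 ^ j)%N = (2 ^ j)%N); last by rewrite expnS; lia.
  rewrite -[_ *+ _]mulr_natr.
  rewrite -[X in _ * X]powRr1// -powRD; last by rewrite pnatr_eq0 expn_eq0 implybT.
  rewrite natrX -powR_mulrn// -powRrM /q -powR_mulrn ?powR_ge0// -powRrM.
  by rewrite (mulrC j%:R) (addrC 1).
exists (1 + (1 - q)^-1); first by rewrite addr_ge0// invr_ge0 subr_ge0 ltW.
move=> n; apply: (@le_trans _ _ (\sum_(0 <= i < 2 ^ n) pwn t i)).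
  rewrite [leRHS](@big_cat_nat _ _ _ n)//=; last by rewrite ltnW// ltn_expl.
  by rewrite lerDl sumr_ge0// => i _; exact: pwn_ge0.
by apply: (le_trans (H n)); rewrite lerD2l geo_sum_le.
Qed.

Lemma sum_uniq_nat (f : nat -> R) (s : seq nat) : (forall i, 0 <= f i) -> uniq s ->
  exists n, \sum_(i <- s) f i <= \sum_(0 <= i < n) f i.
Proof.
move=> f0 us; exists (\max_(i <- s) i.+1)%N.
rewrite (perm_big [seq i <- index_iota 0 (\max_(i <- s) i.+1)%N | i \in s]); last first.
  apply: uniq_perm => //; first by rewrite filter_uniq// iota_uniq.
  move=> i; rewrite mem_filter mem_index_iota /=; case: (boolP (i \in s)) => //= si.
  by apply/esym; exact: (leq_bigmax_seq (F := fun i => i.+1)).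
rewrite big_filter [leRHS](bigID (fun i => i \in s))/= lerDl.
by apply: sumr_ge0.
Qed.

Lemma pwn_anti t a b : 0 <= t -> (b <= a)%N -> pwn t a <= pwn t b.
Proof.
move=> t0 ba; rewrite /pwn !powRN lef_pV2 ?posrE ?powR_gt0//.
by rewrite ge0_ler_powR ?nnegrE// ler_nat.
Qed.

Definition pw t (h : int) : R := pwn t (absz h).

Lemma pw_gt0 t h : 0 < pw t h. Proof. by rewrite powR_gt0. Qed.
Lemma pw_ge0 t h : 0 <= pw t h. Proof. exact: powR_ge0. Qed.

Lemma pw_le1 t h : 0 <= t -> pw t h <= 1.
Proof.
move=> t0; rewrite /pw /pwn -[leRHS](powRr0 (absz h).+1%:R).
by rewrite ler_powR ?ler1n// oppr_le0.
Qed.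

Lemma pwN t h : pw t (- h) = pw t h. Proof. by rewrite /pw abszN. Qed.

Lemma pwD t t' h : pw (t + t') h = pw t h * pw t' h.
Proof.
by rewrite /pw /pwn opprD powRD// pnatr_eq0 implybT.
Qed.

Lemma sqr_pw t h : pw t h ^+ 2 = pw (2 * t) h.
Proof. by rewrite expr2 -pwD; congr pw; ring. Qed.

Lemma ler_pw t t' h : t <= t' -> pw t' h <= pw t h.
Proof. by move=> tt; rewrite /pw /pwn ler_powR ?ler1n// lerN2. Qed.

Lemma pw_sum_bound t : 1 < t -> exists2 C : R, 0 <= C &
  forall ls, uniq ls -> \sum_(l <- ls) pw t l <= C.
Proof.
move=> t1; have [C C0 HC] := riemann_bound t1; exists (C + C); first exact: addr_ge0.
move=> ls u; rewrite (bigID (fun l => 0 <= l))/=; apply: lerD.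
  have um : uniq [seq absz l | l <- ls & 0 <= l].
    rewrite map_inj_in_uniq ?filter_uniq// => a b.
    by rewrite !mem_filter => /andP[a0 _] /andP[b0 _]; lia.
  have [n Hn] := sum_uniq_nat (pwn_ge0 t) um.
  by apply: le_trans (HC n); apply: le_trans Hn; rewrite big_map big_filter.
have um : uniq [seq absz l | l <- ls & ~~ (0 <= l)].
  rewrite map_inj_in_uniq ?filter_uniq// => a b.
  by rewrite !mem_filter => /andP[a0 _] /andP[b0 _]; lia.
have [n Hn] := sum_uniq_nat (pwn_ge0 t) um.
by apply: le_trans (HC n); apply: le_trans Hn; rewrite big_map big_filter.
Qed.

Lemma pw_shift_bound t : 1 < t -> exists2 C : R, 0 <= C &
  forall k ls, uniq ls -> \sum_(l <- ls) pw t (k - l) <= C.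
Proof.
move=> t1; have [C C0 HC] := pw_sum_bound t1; exists C => // k ls u.
rewrite -(big_map (fun l => k - l) xpredT (pw t)); apply: HC.
rewrite map_inj_in_uniq// => a b _ _; lia.
Qed.

(** The larger of the lags [|k - l|] and [|k' - l|] is at least half of [|k - k'|]. A power [x] of
    its weight is traded for [2 ^ x * pw x (k - k')]; what remains is bounded at the smaller lag
    with the summable exponent [u + v - x > 1]. *)
Lemma pw_conv (u v x : R) : 0 <= x -> x <= u -> x <= v -> x < u + v - 1 ->
  exists2 C : R, 0 <= C & forall k k' ls, uniq ls ->
  \sum_(l <- ls) pw u (k - l) * pw v (k' - l) <= C * pw x (k - k').
Proof.
move=> x0 xu xv xuv; have t1 : 1 < u + v - x by lra.
have [C C0 HC] := pw_shift_bound t1.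
exists (2 `^ x * (C + C)); first by rewrite mulr_ge0 ?powR_ge0 ?addr_ge0.
have key (a b H : nat) : (H.+1 <= 2 * a.+1)%N -> (b <= a)%N ->
    forall u v, x <= u -> pwn u a * pwn v b <= 2 `^ x * pwn x H * pwn (u + v - x) b.
  move=> Ha ba u' v' xu'.
  have e1 : pwn u' a = pwn x a * pwn (u' - x) a.
    by rewrite /pwn -powRD ?pnatr_eq0 ?implybT//; congr (_ `^ _); ring.
  have e2 : pwn (u' + v' - x) b = pwn (u' - x) b * pwn v' b.
    by rewrite /pwn -powRD ?pnatr_eq0 ?implybT//; congr (_ `^ _); ring.
  rewrite e1 e2 -mulrA; apply: ler_pM; rewrite ?pwn_ge0 ?mulr_ge0 ?pwn_ge0//; last first.
    by rewrite ler_wpM2r ?pwn_ge0// pwn_anti//; lra.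
  rewrite /pwn !powRN ler_pdivlMr ?powR_gt0// mulrC ler_pdivrMr ?powR_gt0//.
  by rewrite -powRM// ge0_ler_powR ?nnegrE ?mulr_ge0// -natrM ler_nat.
move=> k k' ls us.
apply: (@le_trans _ _ (\sum_(l <- ls) 2 `^ x * pw x (k - k') * (pw (u + v - x) (k - l) + pw (u + v - x) (k' - l)))).
  apply: ler_sum => l _; rewrite mulrDr.
  have h0 (z : int) : 0 <= 2 `^ x * pw x (k - k') * pw (u + v - x) z.
    by rewrite !mulr_ge0 ?powR_ge0 ?pw_ge0.
  have [ab|ba] := leqP (absz (k - l)) (absz (k' - l)).
    apply: (@le_trans _ _ (2 `^ x * pw x (k - k') * pw (u + v - x) (k - l))); last by rewrite lerDl.
    rewrite mulrC (addrC u); apply: key => //; lia.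
  apply: (@le_trans _ _ (2 `^ x * pw x (k - k') * pw (u + v - x) (k' - l))); last by rewrite lerDr.
  apply: key => //; lia.
rewrite -mulr_sumr big_split/= mulrAC ler_wpM2r ?pw_ge0// ler_wpM2l ?powR_ge0//.
by rewrite lerD// HC.
Qed.

(** Lags inside the block are below [n], so a power [th - 1] of the lag is traded for the same power
    of [n]; the remaining exponent [th + b - 1] exceeds 1. *)
Lemma pw_block b th : 0 <= b -> 1 <= th -> 2 - b < th ->
  exists2 C : R, 0 <= C & forall n : nat, (0 < n)%N ->
  \sum_(0 <= i < n) \sum_(0 <= j < n) pw b (i%:Z - j%:Z) <= C * n%:R `^ th.
Proof.
move=> b0 th1 bth; have t1 : 1 < th + b - 1 by lra.
have [C C0 HC] := pw_shift_bound t1; exists C => // n n0.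
have H (h : int) : (absz h < n)%N -> pw b h <= n%:R `^ (th - 1) * pw (th + b - 1) h.
  move=> hn; have -> : th + b - 1 = (th - 1) + b by ring.
  rewrite pwD mulrA ler_peMl ?pw_ge0// /pw /pwn powRN -ler_pdivrMr ?invr_gt0 ?powR_gt0//.
  by rewrite mul1r invrK ge0_ler_powR ?nnegrE ?subr_ge0// ler_nat.
apply: (@le_trans _ _ (\sum_(0 <= i < n) n%:R `^ (th - 1) * C)).
  rewrite big_nat_cond [leRHS]big_nat_cond; apply: ler_sum => i /andP[/andP[_ ik] _].
  apply: (@le_trans _ _ (\sum_(0 <= j < n) n%:R `^ (th - 1) * pw (th + b - 1) (i%:Z - j%:Z))).
    rewrite big_nat_cond [leRHS]big_nat_cond; apply: ler_sum => j /andP[/andP[_ jk] _].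
    by apply: H; lia.
  rewrite -mulr_sumr ler_wpM2l ?powR_ge0//.
  rewrite -(big_map Posz xpredT (fun j => pw (th + b - 1) (i%:Z - j))).
  by apply: HC; rewrite map_inj_uniq ?iota_uniq// => p q [].
rewrite sumr_const_nat subn0 -(mulr_natr (n%:R `^ (th - 1) * C) n).
have -> : n%:R `^ th = n%:R `^ (th - 1) * n%:R :> R.
  rewrite -[X in _ * X](powRr1 (ler0n R n)) -powRD ?subrK//.
  by rewrite pnatr_eq0 -lt0n n0 implybT.
by rewrite (mulrC _ C) mulrA.
Qed.

End power_sums.

(** * Dyadic chaining and almost sure convergence *)

Section dyadic_chaining.
Context (R : realType).
Implicit Types (u : nat -> R).

(* The sum of the squared sums of [u] over all dyadic subblocks of [a, a + 2^j). *)
Fixpoint dyadQ (j a : nat) u : R :=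
  if j is j'.+1 then dyadQ j' a u + dyadQ j' (a + 2 ^ j') u +
    (\sum_(a <= i < a + 2 ^ j) u i) ^+ 2
  else u a ^+ 2.

Lemma dyadQ_ge0 j a u : 0 <= dyadQ j a u.
Proof.
elim: j a => [|j IH] a /=; first exact: sqr_ge0.
by rewrite !addr_ge0// sqr_ge0.
Qed.

Lemma dyadQ_block j a u : (\sum_(a <= i < a + 2 ^ j) u i) ^+ 2 <= dyadQ j a u.
Proof.
case: j => [|j] /=; first by rewrite expn0 addn1 big_nat1.
by rewrite lerDr addr_ge0// dyadQ_ge0.
Qed.

(** The pathwise half of a Rademacher-Menshov inequality. A segment lies in the left half, or it is
    the left half plus a segment of the right one; the square is split with weights for which the
    factor grows by one per level. *)
Lemma dyadic_chaining j a n u : (n <= 2 ^ j)%N ->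
  (\sum_(a <= i < a + n) u i) ^+ 2 <= j.+1%:R * dyadQ j a u.
Proof.
elim: j a n => [|j IH] a n nj.
  rewrite mul1r; case: n nj => [|[|]]// _.
    by rewrite addn0 big_geq// expr0n/= sqr_ge0.
  by rewrite addn1 big_nat1.
have [nj'|nj'] := leqP n (2 ^ j).
  apply: (le_trans (IH a n nj')); apply: ler_pM => //; rewrite ?dyadQ_ge0 ?ler_nat//=.
  by rewrite -addrA lerDl addr_ge0 ?sqr_ge0// dyadQ_ge0.
have n' : (n - 2 ^ j <= 2 ^ j)%N by rewrite leq_subLR addnn -mul2n -expnS.
rewrite (@big_cat_nat _ _ _ (a + 2 ^ j))/= ?leq_addr//; last by rewrite leq_add2l ltnW.
have h1 := dyadQ_block j a u.
have h2 := IH (a + 2 ^ j)%N _ n'.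
rewrite -addnA subnKC in h2; last exact: ltnW.
set x := \sum_(a <= _ < _) _ in h1 *; set z := \sum_(_ + _ <= _ < _) _ in h2 *.
apply: (@le_trans _ _ (j.+2%:R * (dyadQ j a u + dyadQ j (a + 2 ^ j) u))); last first.
  by rewrite ler_wpM2l//= lerDl sqr_ge0.
have J0 : 0 < j.+1%:R :> R by rewrite ltr0n.
have q1 := dyadQ_ge0 j (a + 2 ^ j) u.
rewrite mulrDr; move: h1 h2 q1; set q := dyadQ j a u; set q' := dyadQ j _ u.
rewrite -[j.+2%:R]natr1; move: j.+1%:R J0 => J J0 h1 h2 q1.
(* (x + z)^2 <= (1 + J) x^2 + (1 + 1/J) z^2 *)
have e : (x + z) ^+ 2 <= (J + 1) * x ^+ 2 + (1 + J^-1) * z ^+ 2.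
  rewrite -subr_ge0 [leRHS](_ : _ = (J * x - z) ^+ 2 / J); last by field; rewrite gt_eqF.
  by rewrite divr_ge0 ?sqr_ge0// ltW.
apply: (le_trans e); apply: lerD.
  by rewrite ler_wpM2l// addr_ge0// ltW.
rewrite [leRHS](_ : _ = (1 + J^-1) * (J * q')); last by field; rewrite gt_eqF.
by rewrite ler_wpM2l// addr_ge0// invr_ge0 ltW.
Qed.

Lemma sum_geo1 (q : R) n : 0 <= q < 1 -> \sum_(0 <= j < n) j.+1%:R * q ^+ j <= (1 - q)^-1 * (1 - q)^-1.
Proof.
move=> /andP[q0 q1]; have q1' : 0 < 1 - q by rewrite subr_gt0.
have H : (1 - q) * (\sum_(0 <= j < n) j.+1%:R * q ^+ j) + n%:R * q ^+ n = \sum_(0 <= j < n) q ^+ j.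
  elim: n => [|n IH]; first by rewrite !big_nil mulr0 mul0r addr0.
  rewrite !big_nat_recr//= -IH exprS -natr1; ring.
rewrite ler_pdivlMl//; apply: le_trans (geo_sum_le n q0 q1).
by rewrite -H lerDl mulr_ge0// exprn_ge0.
Qed.

Lemma sum_geo2 (q : R) n : 0 <= q < 1 ->
  \sum_(0 <= j < n) j.+1%:R ^+ 2 * q ^+ j <= (1 - q)^-1 * (2 * ((1 - q)^-1 * (1 - q)^-1)).
Proof.
move=> /andP[q0 q1]; have q1' : 0 < 1 - q by rewrite subr_gt0.
have H : (1 - q) * (\sum_(0 <= j < n) j.+1%:R * j.+2%:R * q ^+ j) + n%:R * n.+1%:R * q ^+ n =
  2 * \sum_(0 <= j < n) j.+1%:R * q ^+ j.
  elim: n => [|n IH]; first by rewrite !big_nil !mulr0 mul0r mul0r addr0.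
  rewrite !big_nat_recr//= [in RHS]mulrDr -IH exprS.
  by move: (\sum_(0 <= j < n) _) => S; ring.
apply: (@le_trans _ _ (\sum_(0 <= j < n) j.+1%:R * j.+2%:R * q ^+ j)).
  by apply: ler_sum => j _; rewrite ler_wpM2r ?exprn_ge0// expr2 ler_wpM2l// ler_nat.
rewrite ler_pdivlMl//; apply: (@le_trans _ _ (2 * \sum_(0 <= j < n) j.+1%:R * q ^+ j)).
  by rewrite -H lerDl !mulr_ge0// exprn_ge0.
by rewrite ler_wpM2l// sum_geo1// q0.
Qed.

Lemma trunc_log2_cvg : trunc_log 2 n @[n --> \oo] --> \oo.
Proof.
move=> A [N _ HN]; exists (2 ^ N)%N => //= n Nn.
apply: HN => /=; apply: trunc_log_max => //.
Qed.

(** The partial sums at powers of 2 converge by comparison with [m], and between two such powers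
    they move by at most [m j], which tends to 0. *)
Lemma block_cvg u (m : nat -> R) : cvgn (series m) ->
  (forall j n, (n <= 2 ^ j)%N -> `|\sum_(2 ^ j <= i < 2 ^ j + n) u i| <= m j) ->
  cvgn (series u).
Proof.
move=> cm Hm; pose b j := \sum_(2 ^ j <= i < 2 ^ j.+1) u i.
have bE j : b j = \sum_(2 ^ j <= i < 2 ^ j + 2 ^ j) u i.
  by rewrite /b expnS mul2n addnn.
have cb : cvgn (series b).
  apply: normed_cvg; apply: series_le_cvg cm => //= j.
    by rewrite (le_trans _ (Hm j 0%N _))// normr_ge0.
  by rewrite bE; exact: Hm.
(* The dyadic blocks start at 1, so the term of index 0 is left over. *)
have Sb j : \sum_(0 <= i < 2 ^ j) u i = u 0%N + series b j.
  elim: j => [|j IH]; first by rewrite expn0 big_nat1 /series/= big_nil addr0.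
  rewrite (@big_cat_nat _ _ _ (2 ^ j))//= ?IH; last by rewrite leq_exp2l.
  by rewrite /series/= big_nat_recr//= addrA.
have m0 : m j @[j --> \oo] --> 0 by exact: cvg_series_cvg_0.
pose t n := trunc_log 2 n.
have c1 : (u 0%N + series b (t n)) @[n --> \oo] --> u 0%N + limn (series b).
  apply: cvgD; first exact: cvg_cst.
  exact: (cvg_comp _ _ trunc_log2_cvg cb).
have c2 : (series u n - (u 0%N + series b (t n))) @[n --> \oo] --> 0.
  apply/norm_cvg0P; apply: (@squeeze_cvgr _ _ _ _ (fun=> 0) (fun n => m (t n))).
  - near=> n; have n0 : (0 < n)%N by near: n; exists 1%N.
    rewrite normr_ge0/= -Sb /series/=.
    have /andP[ln un] := trunc_log_bounds (isT : 1 < 2)%N n0.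
    rewrite (@big_cat_nat _ _ _ (2 ^ t n) 0 n)//= addrAC subrr add0r.
    rewrite -{2}(subnKC ln); apply: Hm.
    by rewrite leq_subLR addnn -mul2n -expnS ltnW.
  - exact: cvg_cst.
  - exact: (cvg_comp _ _ trunc_log2_cvg m0).
apply/cvg_ex; exists (u 0%N + limn (series b)).
rewrite -[X in _ --> X]addr0
  -[X in X @ _ --> _](_ : (fun n => (u 0%N + series b (t n)) + (series u n - (u 0%N + series b (t n)))) = series u).
  exact: cvgD.
by apply/funext => n; rewrite addrC subrK.
Unshelve. all: by end_near. Qed.

End dyadic_chaining.

(** * Almost sure convergence from bounds on expectations *)

Section almost_sure.
Context d (T : measurableType d) (R : realType) (P : probability T R).

Lemma L1_sqrD (f g : T -> R) : measurable_fun setT f -> measurable_fun setT g ->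
  L1 P (fun w => f w ^+ 2) -> L1 P (fun w => g w ^+ 2) ->
  L1 P (fun w => (f w + g w) ^+ 2).
Proof.
move=> mf mg Lf Lg.
rewrite (_ : (fun w => _) = fun w => f w ^+ 2 + (2 * (f w * g w) + g w ^+ 2)); last first.
  by apply/funext => w; ring.
by apply: L1D => //; apply: L1D => //; apply: L1Z; exact: L1_sqr_mul.
Qed.

Lemma L1_sqr_sum (I : Type) (s : seq I) (F : I -> T -> R) :
  (forall i, measurable_fun setT (F i)) -> (forall i, L1 P (fun w => F i w ^+ 2)) ->
  L1 P (fun w => (\sum_(i <- s) F i w) ^+ 2).
Proof.
move=> mF LF; elim: s => [|i s IH].
  by under eq_fun do rewrite big_nil; exact: L1_cst.
under eq_fun do rewrite big_cons.
by apply: L1_sqrD => //; exact: measurable_sum.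
Qed.

(** Superadditivity of [b] lets each of the [j.+1] levels contribute at most [b j a]. *)
Lemma Ex_dyadQ (U : nat -> T -> R) (b : nat -> nat -> R) :
  (forall i, measurable_fun setT (U i)) -> (forall i, L1 P (fun w => U i w ^+ 2)) ->
  (forall j a, Ex P (fun w => (\sum_(a <= i < a + 2 ^ j) U i w) ^+ 2) <= b j a) ->
  (forall j a, b j a + b j (a + 2 ^ j)%N <= b j.+1 a) ->
  forall j a, L1 P (fun w => dyadQ j a (U^~ w)) /\
    Ex P (fun w => dyadQ j a (U^~ w)) <= j.+1%:R * b j a.
Proof.
move=> mU LU Ub bb.
have LS a n : L1 P (fun w => (\sum_(a <= i < n) U i w) ^+ 2) by exact: L1_sqr_sum.
have b0 j a : 0 <= b j a.
  by apply: le_trans (Ub j a); apply: Ex_ge0 => w; exact: sqr_ge0.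
elim=> [|j IH] a /=.
  split; first exact: LU.
  have := Ub 0%N a; rewrite expn0 mul1r; congr (_ <= _).
  by apply: eq_Ex => w; rewrite addn1 big_nat1.
have [L1' E1] := IH a; have [L2' E2] := IH (a + 2 ^ j)%N.
split; first by apply: L1D => //; exact: L1D.
rewrite ExD//; last exact: L1D.
rewrite ExD// -[j.+2%:R]natr1 mulrDl mul1r lerD ?Ub//.
apply: (le_trans (lerD E1 E2)); rewrite -mulrDr ler_wpM2l//.
Qed.

(** The sum of all [f j] is integrable as an extended real function, hence finite almost
    everywhere. *)
Lemma ae_series_cvg (f : nat -> T -> R) (C : R) :
  (forall j w, 0 <= f j w) -> (forall j, L1 P (f j)) ->
  (forall n, \sum_(0 <= j < n) Ex P (f j) <= C) ->
  {ae P, forall w, cvgn (series (f^~ w))}.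
Proof.
move=> f0 Lf fC.
pose g w : \bar R := (\sum_(0 <= j <oo) (f j w)%:E)%E.
have mf j : measurable_fun setT (fun w => (f j w)%:E).
  by apply/measurable_EFinP; exact: L1_measurable (Lf j).
have ig : P.-integrable setT g.
  apply/integrableP; split.
    by apply: ge0_emeasurable_sum => // *; rewrite lee_fin.
  under eq_integral => w _.
    rewrite gee0_abs; last by apply: nneseries_ge0 => *; rewrite lee_fin.
    over.
  rewrite integral_nneseries//; last by move=> *; rewrite lee_fin.
  apply: (@le_lt_trans _ _ C%:E); last exact: ltry.
  apply: lime_le; first by apply: is_cvg_nneseries => n _ _; apply: integral_ge0 => *; rewrite lee_fin.
  near=> n; rewrite (eq_bigr (fun j => (Ex P (f j))%:E)); last by move=> j _; rewrite L1_integral.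
  by rewrite sumEFin lee_fin.
have := integrable_ae measurableT ig; apply: filterS => w /(_ I) gw.
apply: nondecreasing_is_cvgn.
  by apply: nondecreasing_series => n _ _; exact: f0.
exists (fine (g w)) => _ [n _ <-].
rewrite -lee_fin fineK// /series/= -sumEFin.
by apply: nneseries_lim_ge => *; rewrite lee_fin.
Unshelve. all: by end_near. Qed.

Lemma Ex_bounded_cvg (f_ : nat -> T -> R) (f : T -> R) (C : R) :
  (forall n, measurable_fun setT (f_ n)) -> measurable_fun setT f ->
  {ae P, forall w, f_ n w @[n --> \oo] --> f w} ->
  (forall n w, `|f_ n w| <= C) ->
  Ex P (f_ n) @[n --> \oo] --> Ex P f.
Proof.
move=> mf_ mf cf fC.
have Lf n : L1 P (f_ n) by apply: (L1_le (mf_ n) (L1_cst P C)).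
have [ | | | | | + _ +] := @dominated_convergence _ T R P setT measurableT
  (fun n w => (f_ n w)%:E) (EFin \o f) (fun=> C%:E).
- by move=> n; exact/measurable_EFinP.
- exact/measurable_EFinP.
- by apply: filterS cf => w fw _; apply: cvg_EFin => //; exact: nearW.
- exact: (L1_cst P C).
- by apply: aeW => w n _; rewrite lee_fin.
move=> If cv; apply: (fine_cvg (f := fun n => (\int[P]_w (f_ n w)%:E)%E)).
by rewrite /Ex /Rintegral fineK//; exact: integrable_fin_num.
Qed.

Lemma Ex_fatou (f_ : nat -> T -> R) (f : T -> R) (C : R) :
  (forall n w, 0 <= f_ n w) -> measurable_fun setT f -> (forall w, 0 <= f w) ->
  (forall n, L1 P (f_ n)) -> (forall n, Ex P (f_ n) <= C) ->
  {ae P, forall w, f_ n w @[n --> \oo] --> f w} ->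
  L1 P f /\ Ex P f <= C.
Proof.
move=> f0_ mf f0 Lf fC cf.
have mf_ n : measurable_fun setT (EFin \o f_ n) by apply/measurable_EFinP; exact: L1_measurable (Lf n).
have H : (\int[P]_w (f w)%:E <= C%:E)%E.
  have -> : (\int[P]_w (f w)%:E = \int[P]_w limn_einf (fun n => (f_ n w)%:E))%E.
    apply: ae_eq_integral => //.
    - exact/measurable_EFinP.
    - apply: measurableT_comp => //; apply: measurable_fun_limn_esup => n.
      by apply: measurableT_comp => //; exact: mf_.
    apply: filterS cf => w fw _; apply/esym.
    have cw : (f_ n w)%:E @[n --> \oo] --> (f w)%:E by apply: cvg_EFin => //; exact: nearW.
    by rewrite is_cvg_limn_einfE; [exact/cvg_lim|apply/cvg_ex; exists (f w)%:E].
  apply: (le_trans (fatou _ measurableT mf_ _)); first by move=> n w _; rewrite lee_fin.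
  rewrite limn_einf_lim; apply: lime_le; first exact: is_cvg_einfs.
  apply: nearW => n; apply: (@le_trans _ _ (\int[P]_w (f_ n w)%:E)%E).
    by apply: ereal_inf_lbound; exists n => //=.
  by rewrite L1_integral// lee_fin.
have Lf' : L1 P f by apply: L1_ge0 => //; rewrite (le_lt_trans H)// ltry.
by split => //; rewrite -lee_fin -L1_integral.
Qed.

End almost_sure.

Section random_series.
Context d (T : measurableType d) (R : realType) (P : probability T R).

Lemma sum_pwn_block (t : R) j : 0 <= t ->
  \sum_(2 ^ j <= i < 2 ^ j + 2 ^ j) pwn t i <= (2 `^ (1 - t)) ^+ j.
Proof.
move=> t0; apply: (@le_trans _ _ (\sum_(2 ^ j <= i < 2 ^ j + 2 ^ j) (2 ^ j)%:R `^ (- t))).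
  rewrite big_nat_cond [leRHS]big_nat_cond; apply: ler_sum => i /andP[/andP[ji _] _].
  rewrite /pwn !powRN lef_pV2 ?posrE ?powR_gt0 ?ltr0n ?expn_gt0//.
  by rewrite ge0_ler_powR ?nnegrE ?ler0n// ler_nat (leq_trans ji).
rewrite sumr_const_nat addnK -[_ *+ _]mulr_natr.
rewrite -[X in _ * X]powRr1// -powRD; last by rewrite pnatr_eq0 expn_eq0 implybT.
rewrite natrX -powR_mulrn// -powRrM -powR_mulrn ?powR_ge0// -powRrM.
by rewrite (mulrC j%:R) (addrC 1).
Qed.

(** Second moments of dyadic blocks are of order [q ^+ (2 * j)]. Multiplying the chaining bound by
    [q^-1 ^+ j] keeps it summable in expectation, and [x <= x^2 / z + z] with [z = q ^+ j] returns
    the absolute values that [block_cvg] needs. *)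
Lemma series_ae_cvg (U : nat -> T -> R) (K t : R) : 1 < t -> 0 <= K ->
  (forall i, measurable_fun setT (U i)) -> (forall i, L1 P (fun w => U i w ^+ 2)) ->
  (forall a n, Ex P (fun w => (\sum_(a <= i < a + n) U i w) ^+ 2) <=
     K * \sum_(a <= i < a + n) pwn t i) ->
  {ae P, forall w, cvgn (series (U^~ w))}.
Proof.
move=> t1 K0 mU LU HU.
pose q : R := 2 `^ (- ((t - 1) / 2)).
have q0 : 0 < q by exact: powR_gt0.
have q1 : q < 1 by apply: powR_lt1 => //; lra.
have qq : q ^+ 2 = 2 `^ (1 - t).
  by rewrite expr2 -powRD ?pnatr_eq0 ?implybT//; congr (_ `^ _); lra.
pose b j a : R := K * \sum_(a <= i < a + 2 ^ j) pwn t i.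
have bb j a : b j a + b j (a + 2 ^ j)%N <= b j.+1 a.
  rewrite -mulrDr ler_wpM2l//.
  rewrite [leRHS](@big_cat_nat _ _ _ (a + 2 ^ j))/= ?leq_addr//; last by rewrite leq_add2l leq_exp2l.
  by rewrite expnS mul2n -addnn addnA.
have HQ := Ex_dyadQ mU LU (fun j a => HU a (2 ^ j)%N) bb.
pose f j w := q^-1 ^+ j * (j.+1%:R * dyadQ j (2 ^ j) (U^~ w)) + q ^+ j.
have f0 j w : 0 <= f j w.
  by rewrite addr_ge0 ?mulr_ge0 ?exprn_ge0 ?dyadQ_ge0 ?invr_ge0// ltW.
have Lf j : L1 P (f j).
  by apply: L1D; [do 2 apply: L1Z; case: (HQ j (2 ^ j)%N)|exact: L1_cst].
have Ef j : Ex P (f j) <= K * (j.+1%:R ^+ 2 * q ^+ j) + q ^+ j.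
  have [LQ EQ] := HQ j (2 ^ j)%N.
  rewrite ExD ?Ex_cst; [|do 2 apply: L1Z; exact: LQ|exact: L1_cst].
  rewrite lerD2r ExZ; last exact: L1Z.
  rewrite ExZ// exprVn ler_pdivrMl ?exprn_gt0//.
  apply: (@le_trans _ _ (j.+1%:R * (j.+1%:R * (K * (q ^+ 2) ^+ j)))).
    rewrite ler_wpM2l// (le_trans EQ)// ler_wpM2l// /b ler_wpM2l// qq.
    by apply: sum_pwn_block; lra.
  by rewrite -exprM mulnC exprM [leRHS](_ : _ = j.+1%:R * (j.+1%:R * (K * (q ^+ j) ^+ 2)))//; ring.
have Sf n : \sum_(0 <= j < n) Ex P (f j) <= K * ((1 - q)^-1 * (2 * ((1 - q)^-1 * (1 - q)^-1))) + (1 - q)^-1.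
  apply: (le_trans (ler_sum _ (fun j _ => Ef j))); rewrite big_split/= -mulr_sumr.
  by rewrite lerD ?ler_wpM2l ?sum_geo2 ?geo_sum_le// ?q1 ?andbT// ltW.
have := ae_series_cvg f0 Lf Sf; apply: filterS => w cw.
apply: (block_cvg cw) => j n nj.
apply: (@le_trans _ _ (q^-1 ^+ j * (\sum_(2 ^ j <= i < 2 ^ j + n) U i w) ^+ 2 + q ^+ j)); last first.
  rewrite lerD2r; apply: ler_wpM2l; first by rewrite exprn_ge0// invr_ge0 ltW.
  exact: dyadic_chaining.
rewrite -(real_normK (num_real (\sum_(_ <= _ < _) _))).
set x := `|_|; have x0 : 0 <= x by exact: normr_ge0.
have Q0 : 0 < q ^+ j by rewrite exprn_gt0.
rewrite exprVn; move: (q ^+ j) Q0 => z z0.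
rewrite -subr_ge0 (_ : _ - _ = ((x - z) ^+ 2 + x * z) / z); last by field; rewrite gt_eqF.
by rewrite divr_ge0 ?addr_ge0 ?sqr_ge0 ?mulr_ge0// ltW.
Qed.

End random_series.

(** * Maxima over dyadic times and the strong law *)

Section maxima.
Context (R : realType).
Implicit Types (u v : nat -> R).

Lemma cvg_maxr u v (a b : R) : u n @[n --> \oo] --> a -> v n @[n --> \oo] --> b ->
  Num.max (u n) (v n) @[n --> \oo] --> Num.max a b.
Proof.
move=> ua vb; rewrite maxr_absE (_ : (fun n => _) = fun n => (u n + v n + `|u n - v n|) / 2).
  by apply: cvgMl; apply: cvgD; [exact: cvgD|apply: cvg_norm; exact: cvgB].
by apply/funext => n; rewrite maxr_absE.
Qed.

Lemma cvg_minr u v (a b : R) : u n @[n --> \oo] --> a -> v n @[n --> \oo] --> b ->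
  Num.min (u n) (v n) @[n --> \oo] --> Num.min a b.
Proof.
move=> ua vb; rewrite minr_absE (_ : (fun n => _) = fun n => (u n + v n - `|u n - v n|) / 2).
  by apply: cvgMl; apply: cvgB; [exact: cvgD|apply: cvg_norm; exact: cvgB].
by apply/funext => n; rewrite minr_absE.
Qed.

Fixpoint maxabs (N : nat) u : R :=
  if N is n.+1 then Num.max (maxabs n u) `|u n| else 0.

Lemma maxabs_S N u : maxabs N.+1 u = Num.max (maxabs N u) `|u N|.
Proof. by []. Qed.

Lemma maxabs_ge0 N u : 0 <= maxabs N u.
Proof.
by elim: N => // N IH; rewrite maxabs_S le_max IH.
Qed.

Lemma maxabs_ge N u n : (n < N)%N -> `|u n| <= maxabs N u.
Proof.
elim: N => // N IH; rewrite ltnS leq_eqVlt => /predU1P[->|nN].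
  by rewrite maxabs_S le_max lexx orbT.
by rewrite maxabs_S le_max IH.
Qed.

Lemma maxabs_le N u (c : R) : 0 <= c -> (forall n, (n < N)%N -> `|u n| <= c) ->
  maxabs N u <= c.
Proof.
move=> c0; elim: N => [//|N IH] uc.
by rewrite maxabs_S ge_max uc// IH// => n nN; apply: uc; rewrite ltnS ltnW.
Qed.

Lemma cvg_maxabs N (v : nat -> nat -> R) u :
  (forall n, v m n @[m --> \oo] --> u n) -> maxabs N (v m) @[m --> \oo] --> maxabs N u.
Proof.
move=> vu; elim: N => [|N IH]; first exact: cvg_cst.
rewrite maxabs_S; under eq_fun do rewrite maxabs_S.
by apply: cvg_maxr => //; exact: cvg_norm.
Qed.

Lemma measurable_maxabs d (T : measurableType d) N (S : nat -> T -> R) :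
  (forall n, measurable_fun setT (S n)) ->
  measurable_fun setT (fun w => maxabs N (S^~ w)).
Proof.
move=> mS; elim: N => [|N IH]; first exact: measurable_cst.
under eq_fun do rewrite maxabs_S.
by apply: measurable_maxr => //; exact: measurableT_comp.
Qed.

End maxima.

Section strong_law.
Context d (T : measurableType d) (R : realType) (P : probability T R).

(** [maxabs] looks at indices strictly below its first argument; the successor includes the time
    [2 ^ j]. *)
Definition blockmax (p : R) (S : nat -> T -> R) (j : nat) (w : T) : R :=
  2 `^ (- (j%:R / p)) * maxabs (2 ^ j).+1 (S^~ w).

Lemma blockmax_ge0 p S j w : 0 <= blockmax p S j w.
Proof. by rewrite mulr_ge0 ?powR_ge0 ?maxabs_ge0. Qed.

(** Truncation at 1 does not affect convergence to 0, so summable expectations suffice. A time [n]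
    lies in the block with [j = (trunc_log 2 n).+1], whose normalisation differs from that of [n] by
    a factor of at most [2 ^ (1 / p)]. *)
Lemma strong_law_blocks (S : nat -> T -> R) (p q C : R) : 0 < p -> 0 <= q < 1 -> 0 <= C ->
  (forall j, L1 P (fun w => Num.min (blockmax p S j w) 1 ^+ 2)) ->
  (forall j, Ex P (fun w => Num.min (blockmax p S j w) 1 ^+ 2) <= C * (j.+1%:R ^+ 2 * q ^+ j)) ->
  {ae P, forall w, n%:R `^ (- p^-1) * S n w @[n --> \oo] --> 0}.
Proof.
move=> p0 q01 C0 Lf Ef.
have f0 j w : 0 <= Num.min (blockmax p S j w) 1 ^+ 2 by exact: sqr_ge0.
have Sf n : \sum_(0 <= j < n) Ex P (fun w => Num.min (blockmax p S j w) 1 ^+ 2) <=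
    C * ((1 - q)^-1 * (2 * ((1 - q)^-1 * (1 - q)^-1))).
  apply: (le_trans (ler_sum _ (fun j _ => Ef j))); rewrite -mulr_sumr.
  by rewrite ler_wpM2l ?sum_geo2.
have := ae_series_cvg f0 Lf Sf; apply: filterS => w /cvg_series_cvg_0 cw.
have c0 : blockmax p S j w @[j --> \oo] --> 0.
  apply/cvgrPdist_lt => /= e e0; pose e' := Num.min e 1.
  have e'0 : 0 < e' by rewrite lt_min e0 ltr01.
  near=> j; rewrite sub0r normrN ger0_norm ?blockmax_ge0//.
  have : Num.min (blockmax p S j w) 1 ^+ 2 < e' ^+ 2.
    near: j; have /cvgrPdist_lt/(_ (e' ^+ 2)) := cw.
    move=> /(_ (exprn_gt0 _ e'0)); apply: filterS => j.
    by rewrite sub0r normrN ger0_norm.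
  rewrite ltr_pXn2r ?nnegrE ?le_min ?blockmax_ge0 ?ler01 ?ltW//.
  by rewrite /e' gt_min !lt_min ltxx andbF orbF => /andP[].
have c1 : blockmax p S (trunc_log 2 n).+1 w @[n --> \oo] --> 0.
  have tl : (trunc_log 2 n).+1 @[n --> \oo] --> \oo.
    move=> A [N _ HN]; have [M _ HM] := trunc_log2_cvg (nbhs_infty_ge N).
    by exists M => //= n Mn; apply: HN => /=; rewrite ltnW// ltnS; exact: HM.
  exact: (cvg_comp _ _ tl c0).
apply/norm_cvg0P; apply: (@squeeze_cvgr _ _ _ _ (fun=> 0)
    (fun n => 2 `^ (p^-1) * blockmax p S (trunc_log 2 n).+1 w)).
- near=> n; have n0 : (0 < n)%N by near: n; exists 1%N.
  rewrite normr_ge0/=; set j := (trunc_log 2 n).+1.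
  have /andP[ln un] := trunc_log_bounds (isT : 1 < 2)%N n0.
  rewrite normrM ger0_norm ?powR_ge0// /blockmax mulrA; apply: ler_pM.
  + exact: powR_ge0.
  + exact: normr_ge0.
  + have -> : 2 `^ p^-1 * 2 `^ (- (j%:R / p)) = ((2 ^ (trunc_log 2 n))%:R : R) `^ (- p^-1).
      rewrite -powRD ?pnatr_eq0 ?implybT// natrX -powR_mulrn// -powRrM; congr (_ `^ _).
      by rewrite /j -natr1; field; rewrite gt_eqF.
    rewrite !powRN lef_pV2 ?posrE ?powR_gt0 ?ltr0n ?expn_gt0//.
    by rewrite ge0_ler_powR ?nnegrE ?ler0n ?ler_nat// invr_ge0 ltW.
  + by apply: maxabs_ge; rewrite ltnS ltnW.
- exact: cvg_cst.
- rewrite -[X in _ --> X](mulr0 (2 `^ p^-1)); apply: cvgMr; exact: c1.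
Unshelve. all: by end_near. Qed.

End strong_law.

(** * Passage from finite windows to the whole series *)

Section variance_of_sums.
Context d (T : measurableType d) (R : realType) (P : probability T R).

Lemma var_sum (r : seq nat) (F : nat -> T -> R) :
  (forall i, measurable_fun setT (F i)) -> (forall i, L1 P (fun w => F i w ^+ 2)) ->
  Ex P (fun w => (\sum_(i <- r) (F i w - Ex P (F i))) ^+ 2) =
  \sum_(i <- r) \sum_(j <- r) (Ex P (fun w => F i w * F j w) - Ex P (F i) * Ex P (F j)).
Proof.
move=> mF LF.
have L i : L1 P (F i) by exact: L1_sqr.
have LM i j : L1 P (fun w => F i w * F j w) by exact: L1_sqr_mul.
have E1 i j : Ex P (fun w => (F i w - Ex P (F i)) * (F j w - Ex P (F j))) =
    Ex P (fun w => F i w * F j w) - Ex P (F i) * Ex P (F j).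
  rewrite (_ : (fun w => _) = fun w => F i w * F j w +
     ((- Ex P (F j)) * F i w + ((- Ex P (F i)) * F j w + Ex P (F i) * Ex P (F j)))); last first.
    by apply/funext => w; ring.
  have l1 := L1Z (- Ex P (F j)) (L i); have l2 := L1Z (- Ex P (F i)) (L j).
  have l3 := L1_cst P (Ex P (F i) * Ex P (F j)).
  have l4 := L1D l2 l3; have l5 := L1D l1 l4.
  rewrite (ExD (LM i j) l5) (ExD l1 l4) (ExD l2 l3) (ExZ _ (L i)) (ExZ _ (L j)) Ex_cst.
  by ring.
have LL i j : L1 P (fun w => (F i w - Ex P (F i)) * (F j w - Ex P (F j))).
  apply: L1_sqr_mul; try by apply: measurable_funB.
  - by apply: (L1_sqrD (g := fun=> - Ex P (F i))) => //; exact: L1_cst.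
  - by apply: (L1_sqrD (g := fun=> - Ex P (F j))) => //; exact: L1_cst.
rewrite (_ : (fun w => _) = fun w => \sum_(i <- r) \sum_(j <- r)
   (F i w - Ex P (F i)) * (F j w - Ex P (F j))); last first.
  by apply/funext => w; rewrite expr2 mulr_suml; apply: eq_bigr => i _; rewrite mulr_sumr.
rewrite Ex_sum; last by move=> i; apply: L1_sum.
apply: eq_bigr => i _; rewrite Ex_sum//.
by apply: eq_bigr => j _.
Qed.

Lemma var_sum_le (r : seq nat) (F : nat -> T -> R) :
  (forall i, measurable_fun setT (F i)) -> (forall i, L1 P (fun w => F i w ^+ 2)) ->
  Ex P (fun w => (\sum_(i <- r) (F i w - Ex P (F i))) ^+ 2) <=
  \sum_(i <- r) \sum_(j <- r) Ex P (fun w => F i w * F j w).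
Proof.
move=> mF LF; rewrite var_sum//.
under eq_bigr do rewrite sumrB -mulr_sumr.
by rewrite sumrB -mulr_suml -expr2 gerBl sqr_ge0.
Qed.

(** Joins a part [a] known in L2 with a part [b] known only in L1: thanks to the truncation a first
    moment suffices for [b]. *)
Lemma min_sqr_le (r a b c : R) : 0 <= r -> 0 <= a -> 0 <= b -> r <= a + b ->
  a ^+ 2 <= c -> Num.min r 1 ^+ 2 <= 2 * c + 2 * b.
Proof.
move=> r0 a0 b0 rab ac; set m := Num.min r 1.
have m0 : 0 <= m by rewrite le_min r0 ler01.
have m1 : m <= 1 by rewrite ge_min lexx orbT.
have mr : m <= r by rewrite ge_min lexx.
have c0 : 0 <= c by apply: le_trans ac; exact: sqr_ge0.
have [b1|b1] := leP (2^-1) b; first by nra.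
have := sqr_ge0 (a - b).
by nra.
Qed.

End variance_of_sums.

(* The [n]-th partial sums of the two halves of [seriesZ]. *)
Definition window (n : nat) : seq int :=
  [seq i%:Z | i <- index_iota 0 n] ++ [seq - (i.+1)%:Z | i <- index_iota 0 n].

Lemma window_uniq n : uniq (window n).
Proof.
rewrite cat_uniq !map_inj_uniq ?iota_uniq//=; [|by move=> i j; lia..].
rewrite andbT; apply/hasPn => _ /mapP[i _ ->]; apply/negP => /mapP[j _]; lia.
Qed.

Lemma sum_window (V : nmodType) n (f : int -> V) : \sum_(l <- window n) f l =
  \sum_(0 <= l < n) f l%:Z + \sum_(0 <= l < n) f (- (l.+1)%:Z).
Proof. by rewrite /window big_cat/= !big_map. Qed.

Lemma subz_SS (i j : nat) : i.+1%:Z - j.+1%:Z = i%:Z - j%:Z.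
Proof. lia. Qed.

Lemma subz_addn (a i j : nat) : (i + a)%:Z - (j + a)%:Z = i%:Z - j%:Z.
Proof. lia. Qed.

Lemma Posz_S_inj : injective (fun j : nat => j.+1%:Z).
Proof. by move=> i j []. Qed.

(** * Clipping and uniform integrability *)

Section clipping.
Context (R : realType).
Implicit Types (c x : R).

Definition clip c x : R := Num.max (- c) (Num.min c x).
(** A continuous substitute for [|x|] on the event [|x| > c], so that it passes to almost sure
    limits. *)
Definition excess c x : R := Num.max (`|x| - c) 0.

Lemma excess_ge0 c x : 0 <= excess c x.
Proof. by rewrite /excess le_max lexx orbT. Qed.

Lemma clip_le c x : 0 <= c -> `|clip c x| <= c.
Proof.
move=> c0; rewrite ler_norml /clip le_max lexx/= ge_max ge_min lexx/= andbT.
by rewrite -subr_ge0 opprK addr_ge0.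
Qed.

Lemma clip_dist c x : 0 <= c -> `|x - clip c x| <= excess c x.
Proof.
move=> c0; rewrite /clip /excess le_max.
have [xc|cx] := leP x c.
  have [xc'|cx'] := leP (- c) x; first by rewrite subrr normr0 lexx orbT.
  by rewrite opprK !ltr0_norm; [|lra..]; apply/orP; left; lra.
have [_|cc] := leP (- c) c; last by exfalso; lra.
by rewrite !gtr0_norm; [|lra..]; apply/orP; left.
Qed.

(** A square integrable part [u] is suppressed by a high level, as [|u| - c <= u ^+ 2 / c]; the part
    [v] is kept whole. *)
Lemma excess_split c x (u v : R) : 0 < c -> `|x| <= `|u| + `|v| ->
  excess c x <= c^-1 * u ^+ 2 + `|v|.
Proof.
move=> c0 xuv; have u2 : 0 <= c^-1 * u ^+ 2 by rewrite mulr_ge0 ?sqr_ge0// invr_ge0 ltW.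
rewrite /excess ge_max addr_ge0// andbT.
have : `|u| - c <= c^-1 * u ^+ 2.
  rewrite -(real_normK (num_real u)); set a := `|u|.
  rewrite -subr_ge0 (_ : _ - _ = ((a - c / 2) ^+ 2 + 3 / 4 * c ^+ 2) / c); last by field; rewrite gt_eqF.
  by rewrite divr_ge0 ?addr_ge0 ?sqr_ge0 ?mulr_ge0 ?sqr_ge0// ltW.
lra.
Qed.

Lemma cvg_clip c (u : nat -> R) (a : R) : u n @[n --> \oo] --> a ->
  clip c (u n) @[n --> \oo] --> clip c a.
Proof.
by move=> ua; apply: cvg_maxr; [exact: cvg_cst|apply: cvg_minr => //; exact: cvg_cst].
Qed.

Lemma cvg_excess c (u : nat -> R) (a : R) : u n @[n --> \oo] --> a ->
  excess c (u n) @[n --> \oo] --> excess c a.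
Proof.
move=> ua; apply: cvg_maxr; last exact: cvg_cst.
by apply: cvgB; [exact: cvg_norm|exact: cvg_cst].
Qed.

Lemma measurable_clip c d (T : measurableType d) (f : T -> R) :
  measurable_fun setT f -> measurable_fun setT (fun w => clip c (f w)).
Proof. by move=> mf; apply: measurable_maxr => //; exact: measurable_minr. Qed.

Lemma measurable_excess c d (T : measurableType d) (f : T -> R) :
  measurable_fun setT f -> measurable_fun setT (fun w => excess c (f w)).
Proof.
move=> mf; apply: measurable_maxr => //; apply: measurable_funB => //.
exact: measurableT_comp.
Qed.

Lemma cvg_prodr (I : Type) (r : seq I) (Q : pred I) (f : I -> nat -> R) (a : I -> R) :
  (forall i, f i n @[n --> \oo] --> a i) ->
  \prod_(i <- r | Q i) f i n @[n --> \oo] --> \prod_(i <- r | Q i) a i.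
Proof.
move=> fa; elim: r => [|i r IH].
  by rewrite big_nil; under eq_fun do rewrite big_nil; exact: cvg_cst.
rewrite big_cons; under eq_fun do rewrite big_cons; case: (Q i) => //.
exact: cvgM.
Qed.

Lemma cvg_sumr (I : Type) (r : seq I) (f : I -> nat -> R) (a : I -> R) :
  (forall i, f i n @[n --> \oo] --> a i) ->
  \sum_(i <- r) f i n @[n --> \oo] --> \sum_(i <- r) a i.
Proof.
move=> fa; elim: r => [|i r IH].
  by rewrite big_nil; under eq_fun do rewrite big_nil; exact: cvg_cst.
rewrite big_cons; under eq_fun do rewrite big_cons.
exact: cvgD.
Qed.

End clipping.

Section uniform_integrability.
Context d (T : measurableType d) (R : realType) (P : probability T R).
Variables (Y_ : nat -> T -> R) (Y : T -> R).
Hypothesis mY : measurable_fun setT Y.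
Hypothesis LY_ : forall n, L1 P (Y_ n).
Hypothesis cY : {ae P, forall w, Y_ n w @[n --> \oo] --> Y w}.
Hypothesis ui : forall eps : R, 0 < eps -> exists2 c : R, 0 < c &
  forall n, Ex P (fun w => excess c (Y_ n w)) <= eps.

Let LexY_ c n : 0 <= c -> L1 P (fun w => excess c (Y_ n w)).
Proof.
move=> c0; have LN := L1_norm (LY_ n).
apply: (L1_le _ LN); first by apply: measurable_excess; exact: L1_measurable (LY_ n).
move=> w; rewrite ger0_norm ?excess_ge0// /excess ge_max normr_ge0 andbT.
by rewrite lerBlDr lerDl.
Qed.

Let LexY c (eps : R) : 0 < c -> (forall n, Ex P (fun w => excess c (Y_ n w)) <= eps) ->
  L1 P (fun w => excess c (Y w)) /\ Ex P (fun w => excess c (Y w)) <= eps.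
Proof.
move=> c0 He; apply: (@Ex_fatou _ _ _ P (fun n w => excess c (Y_ n w))) => //.
- by move=> n w; exact: excess_ge0.
- exact: measurable_excess.
- by move=> w; exact: excess_ge0.
- by move=> n; apply: LexY_; exact: ltW.
- by apply: filterS cY => w; exact: cvg_excess.
Qed.

Lemma ui_L1 : L1 P Y.
Proof.
have [c c0 Hc] := ui ltr01; have [L _] := LexY c0 Hc.
apply: (@L1_le _ _ _ _ _ (fun w => c + excess c (Y w))) => //.
  by apply: L1D => //; exact: L1_cst.
by move=> w; rewrite -lerBlDl /excess le_max lexx.
Qed.

(** Bounded convergence applies to the clipped variables. Clipping changes each expectation by at
    most the excess, uniformly in [n], and Fatou carries the excess bound over to [Y]. *)
Lemma ui_cvg : Ex P (Y_ n) @[n --> \oo] --> Ex P Y.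
Proof.
apply/cvgrPdist_le => /= eps eps0.
have e3 : 0 < eps / 3 by rewrite divr_gt0.
have [c c0 Hc] := ui e3; have [L EL] := LexY c0 Hc.
have c0' := ltW c0.
have mY_ n : measurable_fun setT (Y_ n) by exact: L1_measurable (LY_ n).
have cc : Ex P (fun w => clip c (Y_ n w)) @[n --> \oo] --> Ex P (fun w => clip c (Y w)).
  apply: (@Ex_bounded_cvg _ _ _ P (fun n w => clip c (Y_ n w)) _ c).
  - by move=> n; exact: measurable_clip.
  - exact: measurable_clip.
  - by apply: filterS cY => w; exact: cvg_clip.
  - by move=> n w; exact: clip_le.
have near_clip (f : T -> R) : L1 P f -> L1 P (fun w => excess c (f w)) ->
    Ex P (fun w => excess c (f w)) <= eps / 3 ->
    `|Ex P f - Ex P (fun w => clip c (f w))| <= eps / 3.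
  move=> Lf Le Ee; have mf := L1_measurable Lf.
  have Lc : L1 P (fun w => clip c (f w)).
    by apply: (L1_le _ (L1_cst P c)); [exact: measurable_clip|move=> w; exact: clip_le].
  rewrite -ExB//; apply: le_trans Ee; apply: (le_trans (Ex_norm (L1B Lf Lc))).
  by apply: Ex_le => //; [exact/L1_norm/L1B|move=> w; exact: clip_dist].
have hY := near_clip _ ui_L1 L EL.
near=> n.
have hn := near_clip _ (LY_ n) (LexY_ n c0') (Hc n).
have hm : `|Ex P (fun w => clip c (Y w)) - Ex P (fun w => clip c (Y_ n w))| <= eps / 3.
  by near: n; move/cvgrPdist_le : cc; exact.
move: hY hn hm; rewrite !ler_norml => /andP[a1 a2] /andP[a3 a4] /andP[a5 a6].
by apply/andP; split; lra.
Unshelve. all: by end_near. Qed.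

End uniform_integrability.

(** [t] is the normalisation of a block, [J] the chaining factor, and [M2], [M1] stand for
    [M ^ (2 - al)] and [M ^ (1 - al)]. The covariances, the centred parts and the tails are each
    reduced to the same rate [q]. *)
Lemma block_algebra (R : realFieldType) (J t x1 x2 cc ct ch aa th M2 M1 n q : R) :
  1 <= J -> 0 <= cc -> 0 <= ct -> 0 <= ch -> 0 <= aa -> 0 <= t -> 0 <= q ->
  t ^+ 2 * th <= q -> t ^+ 2 * (M2 * n) <= q -> t * (n * M1) <= q ->
  x1 <= J * (2 * (cc * th) + 2 * (ch * M2 * (n * aa))) ->
  x2 <= n * (2 * (ct * M1)) ->
  2 * (t ^+ 2 * (J * x1)) + 2 * (t * x2) <=
  (4 * cc + 4 * (ch * aa) + 4 * ct) * (J ^+ 2 * q).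
Proof.
move=> J1 cc0 ct0 ch0 aa0 t0 q0 r1 r2 r3 E1 E2.
have J0 : 0 <= J := le_trans ler01 J1.
apply: (@le_trans _ _ (2 * (t ^+ 2 * (J * (J * (2 * (cc * th) + 2 * (ch * M2 * (n * aa)))))) +
    2 * (t * (n * (2 * (ct * M1)))))).
  by apply: lerD; apply: ler_wpM2l => //; apply: ler_wpM2l; rewrite ?sqr_ge0//; exact: ler_wpM2l.
rewrite [leLHS](_ : _ = J ^+ 2 * (4 * cc * (t ^+ 2 * th) + 4 * (ch * aa) * (t ^+ 2 * (M2 * n))) +
   4 * ct * (t * (n * M1))); last by ring.
apply: (@le_trans _ _ (J ^+ 2 * (4 * cc * q + 4 * (ch * aa) * q) + 4 * ct * q)).
  apply: lerD; last by apply: ler_wpM2l => //; apply: mulr_ge0.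
  apply: ler_wpM2l; first exact: sqr_ge0.
  by apply: lerD; apply: ler_wpM2l => //; repeat apply: mulr_ge0.
rewrite -subr_ge0 (_ : _ - _ = (J ^+ 2 - 1) * (4 * ct * q)); last by ring.
apply: mulr_ge0; last by repeat apply: mulr_ge0.
by rewrite subr_ge0 expr_ge1.
Qed.

(** * Estimates uniform in the window *)

Section finite_windows.
Context d (T : measurableType d) (R : realType) (P : probability T R).
Context d' (E : measurableType d') (Z : int -> T -> E).
Hypothesis iidZ : iid_family P Z.
Local Notation Mu := (@Mu _ T R P _ E Z).
Context (s : nat) (y : int -> 'I_s -> E -> R) (N : 'I_s -> E -> R).
Context (sg K A0 : R).
Notation I := {set 'I_s}.
Local Notation e := (pw sg).
Hypothesis pm : product_model P Z y N e K.
Hypothesis eA : forall k ls, uniq ls -> \sum_(l <- ls) e (k - l) ^+ 2 <= A0.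
Context (al : R).
Hypothesis al12 : 1 < al < 2.
Hypothesis heavy_sqr : forall M D, 1 <= M -> ~~ light D ->
  Mu (fun x => prodD N D x ^+ 2 * (prodD N D x <= M)%R%:R) <= K * M `^ (2 - al).
Hypothesis heavy_tail : forall M D, 1 <= M -> ~~ light D ->
  Mu (fun x => prodD N D x * (M < prodD N D x)%R%:R) <= K * M `^ (1 - al).
Local Notation TT := [set: 'I_s]%SET.
Local Notation CE := (CE s K A0).
Local Notation n2 := (n2 R s).
Local Notation CH := (C2 s K A0).
Local Notation sol M := (lin Z (G P Z y N M) (@init R s)).
Local Notation L M k ls := (sol M k ls (TT, false)).
Local Notation H M k ls := (sol M k ls (TT, true)).
Local Notation V M k ls := (tailpart P Z y N M k ls TT).

(** The square of this is [M ^ (2 - al)], the growth of the truncated second moments. *)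
Let Lam M : R := M `^ (1 - al / 2).

Let Lam1 M : 1 <= M -> 1 <= Lam M.
Proof.
move=> M1; rewrite /Lam -[leLHS](powRr0 M) ler_powR//; by move: al12; lra.
Qed.

Let sqr_Lam M : 1 <= M -> Lam M ^+ 2 = M `^ (2 - al).
Proof.
move=> M1; have M0 : M != 0 by rewrite gt_eqF// (lt_le_trans ltr01 M1).
rewrite /Lam expr2 -powRD; last by rewrite M0 implybT.
by congr (_ `^ _); lra.
Qed.

Let heavy2 M D : 1 <= M -> ~~ light D ->
  Mu (fun x => prodD N D x ^+ 2 * (prodD N D x <= M)%R%:R) <= K * Lam M ^+ 2.
Proof. by move=> M1 hD; rewrite sqr_Lam//; exact: heavy_sqr. Qed.

Let K0 : 0 <= K. Proof. exact: le_trans ler01 (pm_K pm). Qed.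
Let A0_ge0 : 0 <= A0. Proof. by have := @eA 0 [::] isT; rewrite big_nil. Qed.
Let CE1 : 1 <= CE. Proof. exact: CE_ge1 eA. Qed.
Let CE0 : 0 <= CE. Proof. exact: le_trans ler01 CE1. Qed.
Let C2_ge0 : 0 <= CH. Proof. by rewrite /C2 /C1; nonneg. Qed.

Definition ctail : R := n2 * (A0 * (K * (1 + CE))).

Lemma ctail_ge0 : 0 <= ctail. Proof. by rewrite /ctail; nonneg. Qed.

Lemma prodX_decomp M k ls w : uniq ls ->
  prodX Z y k ls TT w = L M k ls w + H M k ls w + V M k ls w.
Proof. exact: decomposition. Qed.

Lemma V_le M k ls : 1 <= M -> uniq ls ->
  L1 P (V M k ls) /\ Ex P (fun w => `|V M k ls w|) <= ctail * M `^ (1 - al).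
Proof.
move=> M1 u; have d0 : 0 <= M `^ (1 - al) by exact: powR_ge0.
have [LV EV] := tailpart_le iidZ pm eA (fun D => @heavy2 M D M1) d0 (fun D => heavy_tail M1) k TT u.
split => //; apply: (le_trans EV).
by rewrite le_eqVlt /ctail; apply/orP; left; apply/eqP; ring.
Qed.

Let msol M k ls j : measurable_fun setT (sol M k ls j).
Proof. exact: (measurable_sol iidZ pm). Qed.

Let sol2 M k ls j : 1 <= M -> uniq ls -> L1 P (fun w => sol M k ls j w ^+ 2).
Proof. by move=> M1 u; exact: (sol_L2 iidZ pm (fun D => @heavy2 M D M1)). Qed.

Lemma HH_window M k k' ls : 1 <= M -> uniq ls ->
  Ex P (fun w => H M k ls w * H M k' ls w) <=
  CH * M `^ (2 - al) * \sum_(l <- ls) (e (k - l) * e (k' - l)) ^+ 2.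
Proof.
move=> M1 u; rewrite -sqr_Lam//; apply: le_trans (ler_norm _) _.
exact: (HH_sum_le iidZ pm eA (Lam1 M1) (fun D => @heavy2 M D M1)).
Qed.

Definition U M k ls w : R :=
  (L M k ls w - Ex P (L M k ls)) + (H M k ls w - Ex P (H M k ls)).

Lemma measurable_U M k ls : measurable_fun setT (U M k ls).
Proof. by apply: measurable_funD; apply: measurable_funB. Qed.

Let cent2 M k ls j : 1 <= M -> uniq ls ->
  L1 P (fun w => (sol M k ls j w - Ex P (sol M k ls j)) ^+ 2).
Proof.
move=> M1 u; apply: (L1_sqrD (g := fun=> - Ex P (sol M k ls j))) => //.
  exact: sol2.
exact: L1_cst.
Qed.

Lemma U_L2 M k ls : 1 <= M -> uniq ls -> L1 P (fun w => U M k ls w ^+ 2).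
Proof.
by move=> M1 u; apply: L1_sqrD; [exact: measurable_funB|exact: measurable_funB|exact: cent2..].
Qed.

Lemma prodX_L1 k ls : uniq ls -> L1 P (prodX Z y k ls TT).
Proof.
move=> u; rewrite (_ : prodX _ _ _ _ _ = fun w => L 1 k ls w + H 1 k ls w + V 1 k ls w); last first.
  by apply/funext => w; exact: prodX_decomp.
apply: L1D; last by have [] := V_le k (lexx 1) u.
by apply: L1D; apply: L1_sqr => //; exact: sol2.
Qed.

Lemma prodX_centered M k ls w : 1 <= M -> uniq ls ->
  prodX Z y k ls TT w - Ex P (prodX Z y k ls TT) =
  U M k ls w + (V M k ls w - Ex P (V M k ls)).
Proof.
move=> M1 u; have LL : L1 P (L M k ls) by apply: L1_sqr => //; exact: sol2.
have LH : L1 P (H M k ls) by apply: L1_sqr => //; exact: sol2.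
have [LV _] := V_le k M1 u.
have -> : Ex P (prodX Z y k ls TT) = Ex P (L M k ls) + Ex P (H M k ls) + Ex P (V M k ls).
  by rewrite -ExD// -ExD//; [apply: eq_Ex => w'; exact: prodX_decomp|exact: L1D].
by rewrite (prodX_decomp M)// /U; ring.
Qed.

Lemma prodX_split M k ls w : uniq ls ->
  `|prodX Z y k ls TT w| <= `|L M k ls w + H M k ls w| + `|V M k ls w|.
Proof. by move=> u; rewrite (prodX_decomp M)// ler_normD. Qed.

Lemma LH_sqr M k ls : 1 <= M -> uniq ls ->
  L1 P (fun w => (L M k ls w + H M k ls w) ^+ 2) /\
  Ex P (fun w => (L M k ls w + H M k ls w) ^+ 2) <=
    2 * CE + 2 * (CH * M `^ (2 - al) * (A0 * A0)).
Proof.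
move=> M1 u; have L2 : L1 P (fun w => (L M k ls w + H M k ls w) ^+ 2).
  by apply: L1_sqrD => //; exact: sol2.
split => //; have l2 := sol2 k (TT, false) M1 u; have h2 := sol2 k (TT, true) M1 u.
apply: (@le_trans _ _ (Ex P (fun w => 2 * L M k ls w ^+ 2 + 2 * H M k ls w ^+ 2))).
  apply: Ex_le => //; first by apply: L1D; exact: L1Z.
  by move=> w; have := sqr_ge0 (L M k ls w - H M k ls w); nra.
rewrite ExD ?ExZ//; [|exact: L1Z|exact: L1Z].
apply: lerD; rewrite ler_wpM2l//.
  exact: le_trans (ler_norm _) (LL_le iidZ pm eA (fun D => @heavy2 M D M1) k k TT TT u).
apply: (le_trans (HH_window k k M1 u)).
apply: ler_wpM2l; first by apply: mulr_ge0; [exact: C2_ge0|exact: powR_ge0].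
have e2 l : e (k - l) ^+ 2 <= A0 by have := @eA k [:: l] isT; rewrite big_seq1.
apply: (@le_trans _ _ (\sum_(l <- ls) A0 * e (k - l) ^+ 2)).
  by apply: ler_sum => l _; rewrite exprMn ler_wpM2r ?sqr_ge0.
by rewrite -mulr_sumr ler_wpM2l// eA.
Qed.

Context (b Cb th Cth : R).
Hypothesis covb : forall M k k' ls, 1 <= M -> uniq ls ->
  `|cov P Z y N M k k' ls (TT, TT)| <= Cb * pw b (k - k').
Hypothesis Cb0 : 0 <= Cb.
Hypothesis blockb : forall n, (0 < n)%N ->
  \sum_(0 <= i < n) \sum_(0 <= j < n) pw b (i%:Z - j%:Z) <= Cth * n%:R `^ th.

(** For the part without centred coefficient the covariances decay like [pw b]. For the other part
    the second moments summed over all partners of one time are at most [A0 * A0] up to the factor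
    in [M]: squared weights are summed first over the times, then over [l]. *)
Lemma U_block M ls a n : 1 <= M -> uniq ls -> (0 < n)%N ->
  Ex P (fun w => (\sum_(a <= i < a + n) U M i.+1%:Z ls w) ^+ 2) <=
  2 * (Cb * (Cth * n%:R `^ th)) + 2 * (CH * M `^ (2 - al) * (n%:R * (A0 * A0))).
Proof.
move=> M1 u n0.
pose F i := L M i.+1%:Z ls; pose F' i := H M i.+1%:Z ls.
have mF i : measurable_fun setT (F i) by exact: msol.
have mF' i : measurable_fun setT (F' i) by exact: msol.
have LF i : L1 P (fun w => F i w ^+ 2) by exact: sol2.
have LF' i : L1 P (fun w => F' i w ^+ 2) by exact: sol2.
have LS (Q : nat -> T -> R) : (forall i, measurable_fun setT (Q i)) -> (forall i, L1 P (fun w => Q i w ^+ 2)) ->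
    L1 P (fun w => (\sum_(a <= i < a + n) (Q i w - Ex P (Q i))) ^+ 2).
  move=> mQ LQ; apply: L1_sqr_sum => i; first exact: measurable_funB.
  by apply: (L1_sqrD (g := fun=> - Ex P (Q i))) => //; exact: L1_cst.
apply: (@le_trans _ _ (Ex P (fun w => 2 * (\sum_(a <= i < a + n) (F i w - Ex P (F i))) ^+ 2 +
   2 * (\sum_(a <= i < a + n) (F' i w - Ex P (F' i))) ^+ 2))).
  apply: Ex_le.
  - by apply: L1_sqr_sum => i; [exact: measurable_U|exact: U_L2].
  - by apply: L1D; apply: L1Z; exact: LS.
  - move=> w; rewrite /U big_split/= -/(F _) -/(F' _).
    set x := \sum_(a <= i < a + n) (F _ _ - _); set z := \sum_(a <= i < a + n) (F' _ _ - _).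
    by have := sqr_ge0 (x - z); nra.
rewrite ExD; [|by apply: L1Z; exact: LS..].
rewrite !ExZ; [|exact: LS|exact: LS].
apply: lerD; rewrite ler_wpM2l//.
  rewrite var_sum//.
  apply: (@le_trans _ _ (\sum_(a <= i < a + n) \sum_(a <= j < a + n) Cb * pw b (i%:Z - j%:Z))).
    apply: ler_sum => i _; apply: ler_sum => j _.
    have := covb i.+1%:Z j.+1%:Z M1 u; rewrite covE -/(F i) -/(F j).
    by move=> h; apply: le_trans (le_trans (ler_norm _) h) _; rewrite subz_SS.
  under eq_bigr do rewrite -mulr_sumr.
  rewrite -mulr_sumr ler_wpM2l//.
  apply: le_trans (blockb n0); rewrite -{1 3}(add0n a) (addnC a n) !big_addn addnK le_eqVlt; apply/orP; left.
  apply/eqP; apply: eq_bigr => i _; rewrite big_addn addnK; apply: eq_bigr => j _.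
  by rewrite subz_addn.
apply: (le_trans (var_sum_le _ mF' LF')).
apply: (@le_trans _ _ (\sum_(a <= i < a + n) \sum_(a <= j < a + n) CH * M `^ (2 - al) *
   \sum_(l <- ls) (e (i.+1%:Z - l) * e (j.+1%:Z - l)) ^+ 2)).
  by apply: ler_sum => i _; apply: ler_sum => j _; exact: HH_window.
under eq_bigr do rewrite -mulr_sumr.
rewrite -mulr_sumr.
apply: ler_wpM2l; first by apply: mulr_ge0; [exact: C2_ge0|exact: powR_ge0].
apply: (@le_trans _ _ (\sum_(a <= i < a + n) A0 * A0)); last first.
  by rewrite sumr_const_nat addKn mulr_natl.
apply: ler_sum => i _; rewrite exchange_big/=.
apply: (@le_trans _ _ (\sum_(l <- ls) e (i.+1%:Z - l) ^+ 2 * A0)); last first.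
  by rewrite -mulr_suml ler_wpM2r// eA.
apply: ler_sum => l _; under eq_bigr do rewrite exprMn.
rewrite -mulr_sumr ler_wpM2l ?sqr_ge0//.
(* The weight is even in the lag, so the sum over times takes the form of a sum over a list as in
   [eA]. *)
rewrite (eq_bigr (fun j : nat => e (l - j.+1%:Z) ^+ 2)); last first.
  by move=> j _; rewrite -pwN opprB.
rewrite -(big_map (fun j : nat => j.+1%:Z) xpredT (fun m => e (l - m) ^+ 2)).
by apply: eA; rewrite map_inj_uniq ?iota_uniq//; exact: Posz_S_inj.
Qed.

Context (p : R) (Xl : int -> 'I_s -> T -> R).
Hypothesis p1 : 1 < p.
Hypothesis pal : p < al.
Hypothesis th1 : 1 <= th.
Hypothesis th2 : th < 2 / p.
Hypothesis Cth0 : 0 <= Cth.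
Hypothesis mXl : forall k r, measurable_fun setT (Xl k r).
Hypothesis cXl : {ae P, forall w, forall k r,
  \sum_(l <- window n) y (k - l) r (Z l w) @[n --> \oo] --> Xl k r w}.

Local Notation Y k w := (\prod_r Xl k r w).
Local Notation Xn n k := (prodX Z y k (window n) TT).

Let mY k : measurable_fun setT (fun w => Y k w).
Proof. by apply: measurable_prod => r _; exact: mXl. Qed.

Let cY : {ae P, forall w, forall k, Xn n k w @[n --> \oo] --> Y k w}.
Proof.
apply: filterS cXl => w cw k; rewrite /prodX.
under eq_fun do under eq_bigl do rewrite finset.in_setT.
by apply: cvg_prodr => r; exact: cw.
Qed.

Let cY1 k : {ae P, forall w, Xn n k w @[n --> \oo] --> Y k w}.
Proof. by apply: filterS cY => w; exact. Qed.

(** [LH_sqr] and [V_le] do not depend on the window. First [M] is taken so large that the tail costs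
    at most [eps / 2], then [c] so large that the square integrable part costs no more. *)
Lemma prodX_ui k (eps : R) : 0 < eps -> exists2 c : R, 0 < c &
  forall n, Ex P (fun w => excess c (Xn n k w)) <= eps.
Proof.
move=> e0; have al1 : 0 < al - 1 by move: al12; lra.
pose x := Num.max 1 (ctail / (eps / 2)).
have x1 : 1 <= x by rewrite /x le_max lexx.
have x0 : 0 < x := lt_le_trans ltr01 x1.
(* With this exponent [M ^ (1 - al)] is [x^-1]. *)
pose M := x `^ (al - 1)^-1.
have M1 : 1 <= M.
  by rewrite -[leLHS](powRr0 x) /M ler_powR// invr_ge0 ltW.
have tM : ctail * M `^ (1 - al) <= eps / 2.
  rewrite /M -powRrM (_ : (al - 1)^-1 * (1 - al) = - 1); last by field; rewrite gt_eqF.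
  rewrite powRN powRr1; last exact: ltW.
  rewrite ler_pdivrMr// mulrC -ler_pdivrMr ?divr_gt0//.
  by rewrite /x le_max lexx orbT.
pose B := 2 * CE + 2 * (CH * M `^ (2 - al) * (A0 * A0)).
have B0 : 0 <= B.
  by have hC := C2_ge0; have hM := powR_ge0 M (2 - al); rewrite /B; nonneg.
have c0 : 0 < 1 + B / (eps / 2) by rewrite ltr_wpDr// divr_ge0// divr_ge0 ?ltW.
exists (1 + B / (eps / 2)) => // n; set c := 1 + _.
have u := window_uniq n.
have [LLH ELH] := LH_sqr k M1 u; have [LV EV] := V_le k M1 u.
apply: (@le_trans _ _ (Ex P (fun w => c^-1 * (L M k (window n) w + H M k (window n) w) ^+ 2 +
   `|V M k (window n) w|))).
  apply: Ex_le.
  - have LX := prodX_L1 k u; apply: (L1_le _ (L1_norm LX)).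
      by apply: measurable_excess; exact: L1_measurable LX.
    move=> w; rewrite ger0_norm ?excess_ge0// /excess ge_max normr_ge0 andbT.
    by rewrite lerBlDr lerDl ltW.
  - by apply: L1D; [exact: L1Z|exact: L1_norm].
  - by move=> w; apply: excess_split => //; exact: prodX_split.
rewrite ExD; [|exact: L1Z|exact: L1_norm].
rewrite ExZ// [leRHS](splitr eps); apply: lerD; last exact: le_trans EV tM.
rewrite mulrC ler_pdivrMr//; apply: (le_trans ELH); rewrite -/B.
by rewrite /c mulrDr mulr1 mulrCA divff ?gt_eqF ?divr_gt0// mulr1 lerDr ltW// divr_gt0.
Qed.

Let LXn n k : L1 P (Xn n k). Proof. by apply: prodX_L1; exact: window_uniq. Qed.

Let Ex_prod_limit k : Ex P (Xn n k) @[n --> \oo] --> Ex P (fun w => Y k w).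
Proof. exact: (ui_cvg (mY k) (fun n => LXn n k) (cY1 k) (prodX_ui k)). Qed.

Let SW m n w := \sum_(0 <= i < n) (Xn m i.+1%:Z w - Ex P (Xn m i.+1%:Z)).
Let S n w := \sum_(0 <= i < n) (Y i.+1%:Z w - Ex P (fun w' => Y i.+1%:Z w')).

Let mSN m n : measurable_fun setT (SW m n).
Proof.
apply: measurable_sum => i; apply: measurable_funB => //.
exact: L1_measurable (LXn _ _).
Qed.

Let mS n : measurable_fun setT (S n).
Proof. by apply: measurable_sum => i; exact: measurable_funB. Qed.

Let cS : {ae P, forall w, forall n, SW m n w @[m --> \oo] --> S n w}.
Proof.
apply: filterS cY => w cw n; apply: cvg_sumr => i.
by apply: cvgB; [exact: cw|exact: Ex_prod_limit].
Qed.

Let L1_clipmax (Q : nat -> T -> R) j : (forall n, measurable_fun setT (Q n)) ->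
  L1 P (fun w => Num.min (blockmax p Q j w) 1 ^+ 2).
Proof.
move=> mQ; apply: (L1_le _ (L1_cst P 1)).
  apply: measurable_funX; apply: measurable_minr => //.
  by apply: measurable_funM => //; exact: measurable_maxabs.
move=> w; rewrite ger0_norm ?sqr_ge0// expr_le1// ?le_min ?blockmax_ge0 ?ler01//.
by rewrite ge_min lexx orbT.
Qed.

(** The smaller of two margins, of [th] below [2 / p] and of [p] below [al]; it governs the
    geometric decay of all three rates. *)
Let del := Num.min (2 / p - th) (p^-1 - al^-1).
Let q : R := 2 `^ (- del).

Let q01 : 0 <= q < 1.
Proof.
rewrite powR_ge0/=; apply: powR_lt1; first by rewrite ltr1n.
by rewrite oppr_lt0 lt_min !subr_gt0 th2 ltf_pV2 ?posrE//; move: p1 pal; lra.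
Qed.

Let le_q j x : del <= x -> 2 `^ (j%:R * (- x)) <= q ^+ j.
Proof.
move=> dx; rewrite /q -powR_mulrn ?powR_ge0// -powRrM mulrC ler_powR ?ler1n//.
by rewrite ler_wpM2r// lerN2.
Qed.

Let rate_mom j : (2 `^ (- (j%:R / p))) ^+ 2 * ((2 ^ j)%:R `^ th) <= q ^+ j.
Proof.
apply: le_trans (le_q j (_ : _ <= 2 / p - th)); last by rewrite ge_min lexx.
rewrite natrX -!powR_mulrn ?powR_ge0// -!powRrM -powRD ?pnatr_eq0 ?implybT//.
by rewrite le_eqVlt; apply/orP; left; apply/eqP; congr (_ `^ _); field; rewrite gt_eqF// (lt_trans ltr01).
Qed.

(* This level makes [2^j M^(2 - al)] and [(2^j M^(1 - al))^2] of the same order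
   [2^(2 j / al)]. *)
Let M_ j : R := 2 `^ (j%:R / al).
Let al0 : al != 0. Proof. by rewrite gt_eqF//; move: al12; lra. Qed.
Let p0 : p != 0. Proof. by rewrite gt_eqF//; move: p1; lra. Qed.

Let M_1 j : 1 <= M_ j.
Proof.
rewrite -[leLHS](powRr0 2) ler_powR ?ler1n// divr_ge0//; move: al12; lra.
Qed.

Let rate_heavy j : (2 `^ (- (j%:R / p))) ^+ 2 * (M_ j `^ (2 - al) * (2 ^ j)%:R) <= q ^+ j.
Proof.
have ppal : 0 < p^-1 - al^-1.
  by rewrite subr_gt0 ltf_pV2 ?posrE//; move: p1 pal; lra.
apply: le_trans (le_q j (_ : _ <= 2 * (p^-1 - al^-1))); last first.
  by rewrite ge_min (_ : p^-1 - al^-1 <= _) ?orbT//; lra.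
rewrite natrX -!powR_mulrn ?powR_ge0// -!powRrM -!powRD ?pnatr_eq0 ?implybT//.
rewrite le_eqVlt; apply/orP; left; apply/eqP; congr (_ `^ _).
by field; rewrite ?p0 ?al0.
Qed.

Let rate_tail j : 2 `^ (- (j%:R / p)) * ((2 ^ j)%:R * M_ j `^ (1 - al)) <= q ^+ j.
Proof.
apply: le_trans (le_q j (_ : _ <= p^-1 - al^-1)); last by rewrite ge_min lexx orbT.
rewrite natrX -!powR_mulrn ?powR_ge0// -!powRrM -!powRD ?pnatr_eq0 ?implybT//.
rewrite le_eqVlt; apply/orP; left; apply/eqP; congr (_ `^ _).
by field; rewrite ?p0 ?al0.
Qed.

Let bU M m : R := 2 * (Cb * (Cth * (2 ^ m)%:R `^ th)) + 2 * (CH * M `^ (2 - al) * ((2 ^ m)%:R * (A0 * A0))).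

(** Superadditivity over the halves of a block, as [Ex_dyadQ] requires; it rests on [th >= 1]. *)
Let bU_double M m : 1 <= M -> bU M m + bU M m <= bU M m.+1.
Proof.
move=> M1; rewrite -mulr2n -mulr_natl /bU expnS natrM powRM ?ler0n// mulrDr.
have h : 2 <= 2 `^ th :> R by rewrite -[leLHS]powRr1 ?ler_powR ?ler1n.
apply: lerD; last by rewrite le_eqVlt; apply/orP; left; apply/eqP; ring.
have z0 : 0 <= 2 * (Cb * (Cth * (2 ^ m)%:R `^ th)) by nonneg; exact: powR_ge0.
have -> : 2 * (Cb * (Cth * (2 `^ th * (2 ^ m)%:R `^ th))) =
   2 `^ th * (2 * (Cb * (Cth * (2 ^ m)%:R `^ th))) by ring.
exact: ler_wpM2r.
Qed.

Let CC := 4 * (Cb * Cth) + 4 * (CH * (A0 * A0)) + 4 * ctail.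

Let CC0 : 0 <= CC.
Proof.
by have ct0 := ctail_ge0; have ch0 := C2_ge0; rewrite /CC; nonneg.
Qed.

(** The maximum over the block is at most a chained square root for [U] plus the sum of all absolute
    tails. The tails need no chaining, since their first moments are small enough even when added
    over the whole block. *)
Let block_bound j m :
  Ex P (fun w => Num.min (blockmax p (SW m) j w) 1 ^+ 2) <= CC * (j.+1%:R ^+ 2 * q ^+ j).
Proof.
have u := window_uniq m; have M1 := M_1 j; set M := M_ j in M1 *.
pose ls := window m.
pose F i := U M i.+1%:Z ls; pose W i := V M i.+1%:Z ls.
have mF i : measurable_fun setT (F i) by exact: measurable_U.
have LF i : L1 P (fun w => F i w ^+ 2) by exact: U_L2.
have pos k : (0 < 2 ^ k)%N by rewrite expn_gt0.
have [LQ EQ] := Ex_dyadQ mF LF (fun k a => U_block a M1 u (pos k)) (fun k a => bU_double k M1) j 0%N.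
have LW i : L1 P (W i) by have [] := V_le i.+1%:Z M1 u.
have EW i : Ex P (fun w => `|W i w|) <= ctail * M `^ (1 - al) by have [] := V_le i.+1%:Z M1 u.
pose t : R := 2 `^ (- (j%:R / p)).
have t0 : 0 <= t by exact: powR_ge0.
pose a w := t * Num.sqrt (j.+1%:R * dyadQ j 0 (F^~ w)).
pose bb w := t * \sum_(0 <= i < 2 ^ j) (`|W i w| + Ex P (fun w => `|W i w|)).
have W0 i w : 0 <= `|W i w| + Ex P (fun w => `|W i w|).
  by apply: addr_ge0 => //; apply: Ex_ge0.
have a0 w : 0 <= a w by apply: mulr_ge0 => //; exact: sqrtr_ge0.
have bb0 w : 0 <= bb w by apply: mulr_ge0 => //; exact: sumr_ge0.
have dQ0 w : 0 <= j.+1%:R * dyadQ j 0 (F^~ w).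
  by apply: mulr_ge0; [exact: ler0n|exact: dyadQ_ge0].
have a2 w : a w ^+ 2 <= t ^+ 2 * (j.+1%:R * dyadQ j 0 (F^~ w)).
  by rewrite exprMn sqr_sqrtr.
have ab w : blockmax p (SW m) j w <= a w + bb w.
  rewrite /blockmax -/t -mulrDr; apply: ler_wpM2l => //.
  apply: maxabs_le => [|n]; first by apply: addr_ge0; [exact: sqrtr_ge0|exact: sumr_ge0].
  rewrite ltnS => nj; rewrite /SW.
  have -> : \sum_(0 <= i < n) (Xn m i.+1%:Z w - Ex P (Xn m i.+1%:Z)) =
      \sum_(0 <= i < n) F i w + \sum_(0 <= i < n) (W i w - Ex P (W i)).
    by rewrite -big_split/=; apply: eq_bigr => i _; rewrite (prodX_centered _ _ M1 u).
  apply: (le_trans (ler_normD _ _)); apply: lerD.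
    rewrite -sqrtr_sqr; apply: ler_wsqrtr.
    by have := dyadic_chaining 0 (F^~ w) nj; rewrite add0n.
  apply: (le_trans (ler_norm_sum _ _ _)).
  apply: (@le_trans _ _ (\sum_(0 <= i < n) (`|W i w| + Ex P (fun w => `|W i w|)))).
    apply: ler_sum => i _; apply: (le_trans (ler_normB _ _)); rewrite lerD2l.
    exact: Ex_norm.
  rewrite [leRHS](@big_cat_nat _ _ _ n)//= lerDl.
  exact: sumr_ge0.
have LW' : L1 P (fun w => \sum_(0 <= i < 2 ^ j) (`|W i w| + Ex P (fun w => `|W i w|))).
  by apply: L1_sum => i; apply: L1D; [exact: L1_norm|exact: L1_cst].
have EW' : Ex P (fun w => \sum_(0 <= i < 2 ^ j) (`|W i w| + Ex P (fun w => `|W i w|))) <=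
    (2 ^ j)%:R * (2 * (ctail * M `^ (1 - al))).
  rewrite Ex_sum; last by move=> i; apply: L1D; [exact: L1_norm|exact: L1_cst].
  apply: (@le_trans _ _ (\sum_(0 <= i < 2 ^ j) 2 * (ctail * M `^ (1 - al)))); last first.
    by rewrite sumr_const_nat subn0 -[leLHS]mulr_natl.
  apply: ler_sum => i _; rewrite ExD; [|exact/L1_norm|exact: L1_cst].
  by rewrite Ex_cst mulr_natl mulr2n lerD.
have La : L1 P (fun w => 2 * (t ^+ 2 * (j.+1%:R * dyadQ j 0 (F^~ w)))) by do 3 apply: L1Z.
have Lb : L1 P (fun w => 2 * bb w) by do 2 apply: L1Z.
apply: (@le_trans _ _ (Ex P (fun w => 2 * (t ^+ 2 * (j.+1%:R * dyadQ j 0 (F^~ w))) + 2 * bb w))).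
  apply: Ex_le; [exact: L1_clipmax|exact: L1D|].
  by move=> w; apply: min_sqr_le (a2 w) => //; exact: blockmax_ge0.
have LL := L1Z j.+1%:R LQ.
rewrite (ExD La Lb) (ExZ _ (L1Z _ LL)) (ExZ _ LL) (ExZ _ LQ) (ExZ _ (L1Z t LW')) (ExZ _ LW').
move: (ctail_ge0) C2_ge0 (rate_mom j) (rate_heavy j) (rate_tail j) EQ EW'.
rewrite -/t -/(M_ j) -/M /bU.
set x1 := Ex P _; set x2 := Ex P _.
move=> ct0 ch0 r1 r2 r3 E1 E2.
have J1 : 1 <= j.+1%:R :> R by rewrite ler1n.
have q0 : 0 <= q ^+ j by apply: exprn_ge0; case/andP: q01.
have cc0 : 0 <= Cb * Cth by exact: mulr_ge0.
have aa0 : 0 <= A0 * A0 by exact: mulr_ge0.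
rewrite (mulrA Cb Cth) in E1.
exact: (block_algebra J1 cc0 ct0 ch0 aa0 t0 q0 r1 r2 r3 E1 E2).
Qed.

(** The constant in [block_bound] is the same for all windows, so Fatou gives the estimate for the
    infinite series. *)
Theorem truncated_strong_law :
  {ae P, forall w, n%:R `^ (- p^-1) *
    (\sum_(0 <= i < n) (Y i.+1%:Z w - Ex P (fun w' => Y i.+1%:Z w'))) @[n --> \oo] --> 0}.
Proof.
have H j : L1 P (fun w => Num.min (blockmax p S j w) 1 ^+ 2) /\
    Ex P (fun w => Num.min (blockmax p S j w) 1 ^+ 2) <= CC * (j.+1%:R ^+ 2 * q ^+ j).
  apply: (@Ex_fatou _ _ _ P (fun m w => Num.min (blockmax p (SW m) j w) 1 ^+ 2)).
  - by move=> m w; exact: sqr_ge0.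
  - exact: L1_measurable (L1_clipmax j mS).
  - by move=> w; exact: sqr_ge0.
  - by move=> m; exact: L1_clipmax.
  - by move=> m; exact: block_bound.
  - apply: filterS cS => w cw; rewrite expr2; under eq_fun do rewrite expr2.
    have h : Num.min (blockmax p (SW m) j w) 1 @[m --> \oo] --> Num.min (blockmax p S j w) 1.
      by apply: cvg_minr; [apply: cvgMr; exact: cvg_maxabs|exact: cvg_cst].
    exact: cvgM.
apply: (@strong_law_blocks _ _ _ P S p q CC) => //; first exact: lt_trans p1.
- by move=> j; case: (H j).
- by move=> j; case: (H j).
Qed.

End finite_windows.

(** * Products of linear series *)

(** Replaces the lag by the summation index of a half series, at the cost of a constant depending on
    the fixed time. *)
Lemma pw_shift (R : realType) (t : R) m h i : 0 <= t -> (i.+1 <= m * (absz h).+1)%N ->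
  pw t h <= m%:R `^ t * pwn t i.
Proof.
move=> t0 imh; rewrite /pw /pwn !powRN ler_pdivlMr ?powR_gt0// mulrC ler_pdivrMr ?powR_gt0//.
by rewrite -powRM ?ler0n// ge0_ler_powR ?nnegrE ?ler0n// -natrM ler_nat.
Qed.

Lemma ae_forall_countable d (T : measurableType d) (R : realType)
    (P : probability T R) (I : countType) (Q : I -> T -> Prop) :
  (forall i, {ae P, forall w, Q i w}) -> {ae P, forall w, forall i, Q i w}.
Proof.
move=> HQ; have H : {ae P, forall w, forall n i, @choice.unpickle I n = Some i -> Q i w}.
  apply: ae_foralln => n; case: (@choice.unpickle I n) => [i|]; last by apply: aeW.
  by apply: filterS (HQ i) => w h i' [<-].
by apply: filterS H => w h i; apply: (h (choice.pickle i)); rewrite choice.pickleK.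
Qed.

Section linear_series.
Context d (T : measurableType d) (R : realType) (P : probability T R).
Context d' (E : measurableType d') (Z : int -> T -> E).
Hypothesis iidZ : iid_family P Z.
Context (s : nat) (y : int -> 'I_s -> E -> R) (N : 'I_s -> E -> R) (sg K : R).
Local Notation e := (pw sg).
Hypothesis pm : product_model P Z y N e K.
Hypothesis sg2 : 1 / 2 < sg.

Let N2 r : L1 P (fun w => N r (Z 0 w) ^+ 2) /\ Ex P (fun w => N r (Z 0 w) ^+ 2) <= K.
Proof.
have := pm_light pm (D := [set r]%SET); rewrite /light cards1 mul1n leq_maxr => /(_ isT).
by under eq_fun do rewrite /prodD big_set1.
Qed.

Let my h r : measurable_fun setT (y h r). Proof. exact: pm_my pm h r. Qed.
Let myZ h r l : measurable_fun setT (fun w => y h r (Z l w)).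
Proof. by apply: measurableT_comp => //; exact: iid_measurable iidZ l. Qed.

Let Lz_y2 h r : Lz P Z (fun x => y h r x ^+ 2) /\ Mu P Z (fun x => y h r x ^+ 2) <= K * e h ^+ 2.
Proof.
have [LN EN] := N2 r.
have yN x : y h r x ^+ 2 <= e h ^+ 2 * N r x ^+ 2.
  rewrite -exprMn -(real_normK (num_real (y h r x))) ler_sqr ?nnegrE//.
    exact: pm_yN pm h r x.
  by rewrite mulr_ge0// ?pw_ge0// (pm_N0 pm).
have L : Lz P Z (fun x => y h r x ^+ 2).
  split; first exact: measurable_funX.
  apply: (L1_le _ (L1Z (e h ^+ 2) LN)); first exact: measurable_funX.
  by move=> w; rewrite ger0_norm ?sqr_ge0.
split => //; rewrite mulrC; apply: le_trans (ler_wpM2l (sqr_ge0 (e h)) EN).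
rewrite -ExZ//; apply: Ex_le => //; [by case: L|exact: L1Z].
Qed.

Let Lz_y h r : Lz P Z (y h r).
Proof. by split => //; apply: L1_sqr => //; have [[]] := Lz_y2 h r. Qed.

(** Innovations at different indices are independent with mean zero, so only the diagonal of the
    squared sum survives. *)
Lemma series_var (k : int) r ls : uniq ls ->
  Ex P (fun w => (\sum_(l <- ls) y (k - l) r (Z l w)) ^+ 2) <=
  K * \sum_(l <- ls) e (k - l) ^+ 2.
Proof.
move=> u.
have L2 l : L1 P (fun w => y (k - l) r (Z l w) ^+ 2).
  have [L _] := Lz_y2 (k - l) r; exact: (Lz_L1 iidZ l L).
have LL l l' : L1 P (fun w => y (k - l) r (Z l w) * y (k - l') r (Z l' w)).
  exact: L1_sqr_mul.
rewrite (_ : (fun w => _) = fun w => \sum_(l <- ls) \sum_(l' <- ls)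
   y (k - l) r (Z l w) * y (k - l') r (Z l' w)); last first.
  by apply/funext => w; rewrite expr2 mulr_suml; apply: eq_bigr => l _; rewrite mulr_sumr.
rewrite Ex_sum; last by move=> l; exact: L1_sum.
rewrite mulr_sumr big_seq [leRHS]big_seq; apply: ler_sum => l lls.
rewrite Ex_sum// (bigD1_seq l)//= big1_seq ?addr0.
  have [L EL] := Lz_y2 (k - l) r; apply: le_trans EL; rewrite -(Ex_Mu iidZ l L).
  by rewrite le_eqVlt; apply/orP; left; apply/eqP; apply: eq_Ex => w; rewrite expr2.
move=> l' /andP[l'l l'ls].
have [|_] := prodZP iidZ (_ : uniq [:: l; l']) (fun h => Lz_y (k - h) r).
  by rewrite /= inE eq_sym l'l.
rewrite !big_cons big_nil !(pm_mean pm) mul0r => <-.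
by apply: eq_Ex => w; rewrite /prodZ !big_cons big_nil mulr1.
Qed.

Lemma half_series_cvg (k : int) r (idx : nat -> int) m : injective idx ->
  (forall i, i.+1 <= m * (absz (k - idx i)).+1)%N ->
  {ae P, forall w, cvgn (series (fun i => y (k - idx i) r (Z (idx i) w)))}.
Proof.
move=> inj Hm.
have t0 : 0 <= 2 * sg by move: sg2; lra.
apply: (@series_ae_cvg _ _ _ P (fun i w => y (k - idx i) r (Z (idx i) w))
   (K * m%:R `^ (2 * sg)) (2 * sg)) => //.
- by move: sg2; lra.
- by rewrite mulr_ge0 ?powR_ge0// (le_trans ler01)// (pm_K pm).
- move=> i; have [L _] := Lz_y2 (k - idx i) r; exact: (Lz_L1 iidZ (idx i) L).
- move=> a n; have := @series_var k r [seq idx i | i <- index_iota a (a + n)].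
  under eq_Ex do rewrite big_map.
  rewrite big_map map_inj_uniq// iota_uniq => /(_ isT) /le_trans; apply.
  rewrite -mulrA ler_wpM2l ?(le_trans ler01 (pm_K pm))// mulr_sumr.
  by apply: ler_sum => i _; rewrite sqr_pw; exact: pw_shift.
Qed.

Lemma linear_series_cvg : {ae P, forall w, forall k r,
  cvgn (series (fun i : nat => y (k - i%:Z) r (Z i%:Z w))) /\
  cvgn (series (fun i : nat => y (k - - (i.+1)%:Z) r (Z (- (i.+1)%:Z) w)))}.
Proof.
have H k r : {ae P, forall w,
  cvgn (series (fun i : nat => y (k - i%:Z) r (Z i%:Z w))) /\
  cvgn (series (fun i : nat => y (k - - (i.+1)%:Z) r (Z (- (i.+1)%:Z) w)))}.
  have h1 : {ae P, forall w, cvgn (series (fun i : nat => y (k - i%:Z) r (Z i%:Z w)))}.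
    (* The factor works because [i + 1 <= |k| + |k - i| + 1 <= (|k| + 2) (|k - i| + 1)]. *)
    apply: (@half_series_cvg k r Posz (absz k).+2); first by move=> i j [].
    by move=> i; lia.
  have h2 : {ae P, forall w, cvgn (series (fun i : nat => y (k - - (i.+1)%:Z) r (Z (- (i.+1)%:Z) w)))}.
    apply: (@half_series_cvg k r (fun i => - (i.+1)%:Z) (absz k).+2); first by move=> i j; lia.
    by move=> i; lia.
  by apply: filterS2 h1 h2.
by apply: ae_forall_countable => k; apply: filter_forall => r; exact: H.
Qed.

End linear_series.

Lemma le_sum_bigop (R : realDomainType) (I : finType) (f : I -> R) i :
  (forall i, 0 <= f i) -> f i <= \sum_i f i.
Proof. by move=> f0; rewrite (bigD1 i)//= lerDl sumr_ge0. Qed.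

Lemma sum_bounded (R : realDomainType) (X I : Type) (r : seq I) (Q : X -> Prop)
    (F : I -> X -> R) (g : X -> R) :
  (forall i, exists2 C : R, 0 <= C & forall x, Q x -> F i x <= C * g x) ->
  exists2 C : R, 0 <= C & forall x, Q x -> \sum_(i <- r) F i x <= C * g x.
Proof.
move=> FC; elim: r => [|i r [C C0 HC]].
  by exists 0 => // x _; rewrite big_nil mul0r.
have [C' C'0 HC'] := FC i.
exists (C' + C) => [|x Qx]; first exact: addr_ge0.
by rewrite big_cons mulrDl lerD ?HC ?HC'.
Qed.

(** [g] is a third of the gap between [2 - b] and [2 / p]: [b] is lowered by at most [g], and [th]
    is put at [2 - b + 2 g] or at 1 if that is larger, which keeps both inequalities strict. *)
Lemma exponent_choice (R : realFieldType) (p b c : R) : 1 < p -> p < 2 -> 0 < b -> 0 < c ->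
  2 - b < 2 / p -> exists eps th : R, [/\ 0 < eps, eps <= b & eps <= c] /\
    [/\ 1 <= th, 2 - (b - eps) < th & th < 2 / p].
Proof.
move=> p1 p2 b0 c0 bp; have p0 : 0 < p := lt_trans ltr01 p1.
have q1 : 1 < 2 / p by rewrite ltr_pdivlMr// mul1r.
set q := 2 / p in bp q1 *.
pose g := (q - (2 - b)) / 3; have g0 : 0 < g by rewrite divr_gt0 ?subr_gt0.
exists (Num.min (Num.min b c) g), (Num.max 1 (2 - b + 2 * g)).
have h : Num.min (Num.min b c) g <= g by rewrite ge_min lexx orbT.
split; split.
- by rewrite !lt_min b0 c0 g0.
- by rewrite !ge_min lexx.
- by rewrite !ge_min lexx !orbT.
- by rewrite le_max lexx.
- by rewrite lt_max; apply/orP; right; lra.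
- by rewrite gt_max q1/=; move: g0; rewrite /g; lra.
Qed.

(** * Moments of truncated heavy products *)

Section truncated_moments.
Context d (T : measurableType d) (R : realType) (P : probability T R).
Context d' (E : measurableType d') (Z : int -> T -> E).
Hypothesis iidZ : iid_family P Z.
Context (s : nat) (N : 'I_s -> E -> R) (al : R).
Local Notation Lz := (@Lz _ T R P _ E Z).
Local Notation Mu := (@Mu _ T R P _ E Z).
Hypothesis al12 : 1 < al < 2.
Hypothesis mN : forall r, measurable_fun setT (N r).
Hypothesis N0 : forall r x, 0 <= N r x.
Hypothesis light_L2 : forall D : {set 'I_s}, light D ->
  L1 P (fun w => prodD N D (Z 0 w) ^+ 2).
Hypothesis heavy_L : forall D : {set 'I_s}, ~~ light D ->
  L1 P (fun w => prodD N D (Z 0 w) `^ al).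

Let mZ l : measurable_fun setT (Z l). Proof. exact: iid_measurable iidZ l. Qed.
Let mND D : measurable_fun setT (prodD N D). Proof. exact: measurable_prodD. Qed.
Let ND0 D x : 0 <= prodD N D x. Proof. exact: prodr_ge0. Qed.

Let Lz_ND D : Lz (prodD N D).
Proof.
split => //; have mNZ := measurableT_comp (mND D) (mZ 0).
have [lD|hD] := boolP (light D); first by apply: L1_sqr => //; exact: light_L2.
apply: (L1_le _ (L1D (L1_cst P 1) (heavy_L hD))) => // w; rewrite ger0_norm//.
have [h|/ltW h] := leP (prodD N D (Z 0 w)) 1; first by rewrite ler_wpDr ?powR_ge0.
rewrite ler_wpDl// -[leLHS]powRr1// ler_powR//.
by move: al12; lra.
Qed.

Let f D : R := Ex P (fun w => prodD N D (Z 0 w) ^+ 2) + Mu (prodD N D) +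
  Ex P (fun w => prodD N D (Z 0 w) `^ al).

(** For [x <= M] one has [x ^+ 2 <= M ^ (2 - al) * x ^ al], and for [x > M] one has
    [x <= M ^ (1 - al) * x ^ al], so both truncated bounds come from the moment of order [al]. The
    sum over the finitely many [D] gives a common constant. *)
Lemma moment_constant : exists K : R, [/\ 1 <= K,
  forall D, light D -> Ex P (fun w => prodD N D (Z 0 w) ^+ 2) <= K,
  forall D, Lz (prodD N D) /\ Mu (prodD N D) <= K,
  forall M D, 1 <= M -> ~~ light D ->
    Mu (fun x => prodD N D x ^+ 2 * (prodD N D x <= M)%R%:R) <= K * M `^ (2 - al) &
  forall M D, 1 <= M -> ~~ light D ->
    Mu (fun x => prodD N D x * (M < prodD N D x)%R%:R) <= K * M `^ (1 - al)].
Proof.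
have E2 D : 0 <= Ex P (fun w => prodD N D (Z 0 w) ^+ 2) by apply: Ex_ge0 => w; exact: sqr_ge0.
have E1 D : 0 <= Mu (prodD N D) by apply: Ex_ge0.
have Ea D : 0 <= Ex P (fun w => prodD N D (Z 0 w) `^ al) by apply: Ex_ge0 => w; exact: powR_ge0.
have f0 D : 0 <= f D by rewrite /f !addr_ge0.
pose K := 1 + \sum_D f D.
have fK D : f D <= K by rewrite /K ler_wpDl// le_sum_bigop.
have K2 D : Ex P (fun w => prodD N D (Z 0 w) ^+ 2) <= K.
  by apply: le_trans (fK D); rewrite /f -addrA lerDl addr_ge0.
have K1 D : Mu (prodD N D) <= K.
  by apply: le_trans (fK D); rewrite /f addrAC lerDr addr_ge0.
have Ka D : Ex P (fun w => prodD N D (Z 0 w) `^ al) <= K.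
  by apply: le_trans (fK D); rewrite /f lerDr addr_ge0.
have heavy (u : R -> R) (c : R) D : ~~ light D -> measurable_fun setT (fun w => u (prodD N D (Z 0 w))) ->
    (forall x, 0 <= x -> 0 <= u x) -> 0 <= c -> (forall x, 0 <= x -> u x <= c * x `^ al) ->
    Mu (fun x => u (prodD N D x)) <= K * c.
  move=> hD mu u0 c0 uc; rewrite mulrC; apply: le_trans (ler_wpM2l c0 (Ka D)).
  have L := L1Z c (heavy_L hD).
  rewrite -ExZ; last exact: heavy_L.
  apply: Ex_le => //; last by move=> w; exact: uc.
  by apply: (L1_le mu L) => w; rewrite ger0_norm ?u0// uc.
have mle M D : measurable_fun setT (fun w => (prodD N D (Z 0 w) <= M)%R%:R : R).
  rewrite (_ : (fun w => _) = \1_[set w | prodD N D (Z 0 w) <= M]).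
    apply: measurable_indic; rewrite -[X in measurable X]setTI.
    by apply: measurable_fun_le => //; exact: measurableT_comp.
  by apply/funext => w; rewrite indicE mem_setE.
exists K; split => //.
- by rewrite /K lerDl sumr_ge0.
- move=> M D M1 hD; apply: (heavy (fun x => x ^+ 2 * (x <= M)%R%:R)) => //.
  + apply: measurable_funM; [by apply: measurable_funX; exact: measurableT_comp|exact: mle].
  + by move=> x x0; rewrite mulr_ge0 ?sqr_ge0.
  + exact: powR_ge0.
  + move=> x x0; have [xM|_] := leP x M; last by rewrite mulr0 mulr_ge0 ?powR_ge0.
    rewrite mulr1; have [->|xn0] := eqVneq x 0; first by rewrite expr0n/= mulr_ge0 ?powR_ge0.
    rewrite -powR_mulrn// [leLHS](_ : _ = x `^ ((2 - al) + al)); last by rewrite subrK.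
    rewrite powRD; last by rewrite xn0 implybT.
    rewrite ler_wpM2r ?powR_ge0// ge0_ler_powR ?nnegrE//; first by move: al12; lra.
    exact: le_trans ler01 M1.
- move=> M D M1 hD; apply: (heavy (fun x => x * (M < x)%R%:R)) => //.
  + apply: measurable_funM; first exact: measurableT_comp.
    rewrite (_ : (fun w => _) = fun w => 1 - (prodD N D (Z 0 w) <= M)%R%:R).
      exact: measurable_funB.
    by apply/funext => w; rewrite ltNge; case: (_ <= M); rewrite /= ?subrr ?subr0.
  + by move=> x x0; rewrite mulr_ge0.
  + exact: powR_ge0.
  + move=> x x0; have [_|Mx] := leP x M; first by rewrite mulr0 mulr_ge0 ?powR_ge0.
    rewrite mulr1; have M0 : 0 < M := lt_le_trans ltr01 M1.
    have xp : 0 < x := lt_trans M0 Mx.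
    have xE : x = x `^ (1 - al) * x `^ al.
      rewrite -powRD; last by rewrite (gt_eqF xp) implybT.
      by rewrite subrK powRr1.
    rewrite {1}xE ler_wpM2r ?powR_ge0// -opprB !powRN lef_pV2 ?posrE ?powR_gt0//.
    by rewrite ge0_ler_powR ?nnegrE ?ltW//; move: al12; lra.
Qed.

End truncated_moments.

(** * Choice of exponents and the strong law for products *)

Section product_strong_law.
Context d (T : measurableType d) (R : realType) (P : probability T R).
Context d' (E : measurableType d') (Z : int -> T -> E).
Hypothesis iidZ : iid_family P Z.
Context (s : nat) (y : int -> 'I_s -> E -> R) (N : 'I_s -> E -> R).
Context (sgr : 'I_s -> R) (sg al p : R).
Hypothesis s0 : (0 < s)%N.
Hypothesis al12 : 1 < al < 2.
Hypothesis p1 : 1 < p.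
Hypothesis pal : p < al.
Hypothesis my : forall h r, measurable_fun setT (y h r).
Hypothesis mN : forall r, measurable_fun setT (N r).
Hypothesis N0 : forall r x, 0 <= N r x.
Hypothesis yN : forall h r x, `|y h r x| <= pw (sgr r) h * N r x.
Hypothesis y_mean : forall h r, Mu P Z (y h r) = 0.
Hypothesis light_L2 : forall D : {set 'I_s}, light D ->
  L1 P (fun w => prodD N D (Z 0 w) ^+ 2).
Hypothesis heavy_L : forall D : {set 'I_s}, ~~ light D ->
  L1 P (fun w => prodD N D (Z 0 w) `^ al).
Hypothesis sg2 : 1 / 2 < sg.
Hypothesis sg_le : forall r, sg <= sgr r.
Hypothesis sgr1 : forall r, sgr r <= 1.
Hypothesis rate : if s == 2%N then 2 - (2 * \sum_r sgr r - 2) < 2 / p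
  else 3 - 2 * sg < 2 / p.
Local Notation TT := [set: 'I_s]%SET.

Let sg_le1 : sg <= 1.
Proof. exact: le_trans (sg_le (Ordinal s0)) (sgr1 _). Qed.

Let mom2 : exists K, product_model P Z y N (pw sg) K /\
  (forall M D, 1 <= M -> ~~ light D ->
    Mu P Z (fun x => prodD N D x ^+ 2 * (prodD N D x <= M)%R%:R) <= K * M `^ (2 - al)) /\
  (forall M D, 1 <= M -> ~~ light D ->
    Mu P Z (fun x => prodD N D x * (M < prodD N D x)%R%:R) <= K * M `^ (1 - al)).
Proof.
have [K [K1 K2 KL Kh Kt]] := moment_constant iidZ al12 mN N0 light_L2 heavy_L.
exists K; split => //; split => //.
- move=> h r x; apply: le_trans (yN h r x) _; rewrite ler_wpM2r//; exact: ler_pw.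
- by move=> h; exact: pw_gt0.
- by move=> h; apply: pw_le1; move: sg2; lra.
- by move=> D lD; split; [exact: light_L2|exact: K2].
Qed.

(** The two forms of the rate enter here. For [s = 2] the overlap exponents of [A], [B] and of their
    complements add up to [2 * \sum_r sgr r - 2 - eps]; otherwise a single overlap gives
    [2 * sg - 1 - eps]. The loss [eps] pays for the strict inequality in [pw_conv]. *)
Let cov_bound K A0 : product_model P Z y N (pw sg) K ->
  (forall k ls, uniq ls -> \sum_(l <- ls) pw sg (k - l) ^+ 2 <= A0) ->
  (forall M D, 1 <= M -> ~~ light D ->
    Mu P Z (fun x => prodD N D x ^+ 2 * (prodD N D x <= M)%R%:R) <= K * M `^ (2 - al)) ->
  exists Cb b th : R, [/\ 0 <= b, 0 <= Cb, 1 <= th, 2 - b < th & th < 2 / p /\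
    forall M k k' ls, 1 <= M -> uniq ls ->
    `|cov P Z y N M k k' ls (TT, TT)| <= Cb * pw b (k - k')].
Proof.
move=> pm eA heavy_sqr.
have p2 : p < 2 by move: pal al12; lra.
have K0 : 0 <= K := le_trans ler01 (pm_K pm).
have heavy2 M D : 1 <= M -> ~~ light D ->
    Mu P Z (fun x => prodD N D x ^+ 2 * (prodD N D x <= M)%R%:R) <= K * (M `^ (1 - al / 2)) ^+ 2.
  move=> M1 hD; have M0 := lt_le_trans ltr01 M1.
  rewrite expr2 -powRD; last by rewrite (gt_eqF M0) implybT.
  by rewrite (_ : 1 - al / 2 + (1 - al / 2) = 2 - al)//; [exact: heavy_sqr|lra].
move: rate; case: ifPn => [/eqP s2|_] hr.
  (* The limit [2 * (2 * sg - 1)] on [eps] keeps each overlap exponent, which loses [eps / 2],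
     nonnegative. *)
  have [||eps [th [[e0 eb ec] [t1 bt tp]]]] :=
    @exponent_choice R p (2 * \sum_r sgr r - 2) (2 * (2 * sg - 1)) p1 p2 _ _ hr.
  - have : \sum_(r < s) sg <= \sum_r sgr r by exact: ler_sum.
    rewrite sumr_const card_ord (_ : sg *+ s = 2 * sg); last by rewrite s2 mulr_natl.
    by move: sg2; lra.
  - by move: sg2; lra.
  have eps2 : 0 <= eps / 2 by lra.
  pose S (A : {set 'I_s}) := \sum_(r in A) sgr r.
  have STE A : S A + S (TT :\: A) = \sum_r sgr r.
    rewrite /S [RHS](bigID (mem A))/=; congr (_ + _).
    by apply: eq_bigl => r; rewrite !inE andbT.
  pose er h r := pw (sgr r) h.
  pose X := (int * int * seq int)%type.
  pose Q (x : X) := uniq x.2.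
  have gB (A B : {set 'I_s}) : #|A| = 1%N -> #|B| = 1%N -> exists2 C : R, 0 <= C & forall x, Q x ->
      gD er x.1.1 x.1.2 x.2 A B <= C * pw (S A + S B - 1 - eps / 2) (x.1.1 - x.1.2).
    move=> /eqP/cards1P[a ->] /eqP/cards1P[b' ->]; rewrite /S !big_set1.
    have ha := sg_le a; have hb := sg_le b'; have ha1 := sgr1 a; have hb1 := sgr1 b'.
    have [||||C C0 HC] := @pw_conv R (sgr a) (sgr b') (sgr a + sgr b' - 1 - eps / 2).
    - by lra.
    - by lra.
    - by lra.
    - by lra.
    exists C => // -[[k k'] ls] u /=; apply: le_trans (HC k k' ls u).
    by rewrite /gD le_eqVlt; apply/orP; left; apply/eqP; apply: eq_bigr => l _; rewrite /erD !big_set1.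
  have gD0 k k' ls A B : 0 <= gD er k k' ls A B.
    by apply: sumr_ge0 => l _; rewrite mulr_ge0//; apply: prodr_ge0 => r _; exact: pw_ge0.
  have [C C0 HC] : exists2 C : R, 0 <= C & forall x, Q x -> \sum_(A : {set 'I_s}) \sum_(B : {set 'I_s})
      (if (#|A| == 1%N) && (#|B| == 1%N) then gD er x.1.1 x.1.2 x.2 A B *
      gD er x.1.1 x.1.2 x.2 (TT :\: A) (TT :\: B) else 0) <= C * pw (2 * \sum_r sgr r - 2 - eps) (x.1.1 - x.1.2).
    apply: (sum_bounded _ (g := fun x : X => pw (2 * \sum_r sgr r - 2 - eps) (x.1.1 - x.1.2))) => A.
    apply: (sum_bounded _ (g := fun x : X => pw (2 * \sum_r sgr r - 2 - eps) (x.1.1 - x.1.2))) => B.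
    have [/andP[/eqP A1 /eqP B1]|_] := boolP ((#|A| == 1%N) && (#|B| == 1%N));
      last by exists 0 => // x _; rewrite mul0r.
    have cTD (D : {set 'I_s}) : #|D| = 1%N -> #|TT :\: D| = 1%N.
      move=> D1; have := cardsC D; rewrite finset.setTD D1 card_ord.
      by move: #|_| => n; rewrite s2 => -[].
    have [C C0 HC] := gB A B A1 B1; have [C' C'0 HC'] := gB _ _ (cTD A A1) (cTD B B1).
    exists (C * C') => [|x Qx]; first exact: mulr_ge0.
    have -> : 2 * \sum_r sgr r - 2 - eps = (S A + S B - 1 - eps / 2) +
        (S (TT :\: A) + S (TT :\: B) - 1 - eps / 2).
      by have hA := STE A; have hB := STE B; lra.
    by rewrite pwD mulrACA; apply: ler_pM => //; [exact: HC|exact: HC'].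
  exists (K ^+ 4 * C), (2 * \sum_r sgr r - 2 - eps), th; split => //.
  - by rewrite subr_ge0.
  - by rewrite mulr_ge0// exprn_ge0.
  split => // M k k' ls M1 u.
  have er0 h r : 0 < er h r by exact: pw_gt0.
  apply: (le_trans (cov2_le iidZ pm (fun D => @heavy2 M D M1) er0 yN s2 k k' u)).
  rewrite -mulrA ler_wpM2l ?exprn_ge0//; apply: le_trans (HC (k, k', ls) u) => /=.
  rewrite big_mkcond; apply: ler_sum => A _; case: ifP => _ /=; last by apply: sumr_ge0.
  by rewrite big_mkcond.
have b0 : 0 < 2 * sg - 1 by move: sg2; lra.
have hr' : 2 - (2 * sg - 1) < 2 / p by apply: le_lt_trans hr; lra.
have [eps [th [[e0 eb _] [t1 bt tp]]]] := exponent_choice p1 p2 b0 b0 hr'.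
have [||||C C0 HC] := @pw_conv R sg sg (2 * sg - 1 - eps); try by move: sg2 sg_le1; lra.
exists (CE s K A0 * (n2 R s * (n2 R s * (2 * K ^+ 4 * CE s K A0 ^+ 2) * C))), (2 * sg - 1 - eps), th.
have CE0 : 0 <= CE s K A0 by apply: (le_trans ler01); exact: CE_ge1 eA.
have n20 : 0 <= n2 R s by rewrite /n2; nonneg.
split => //; first by rewrite subr_ge0.
  by nonneg.
split => // M k k' ls M1 u.
apply: (le_trans (cov_le iidZ pm eA (fun D => @heavy2 M D M1) k k' (TT, TT) u)).
rewrite -!mulrA ler_wpM2l//; do 2 rewrite ler_wpM2l//.
rewrite ler_wpM2l//; do 4 rewrite ler_wpM2l//; do 2 rewrite ler_wpM2l//.
exact: HC.
Qed.

Lemma product_series_cvg : {ae P, forall w, forall k r,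
  cvgn (series (fun i : nat => y (k - i%:Z) r (Z i%:Z w))) /\
  cvgn (series (fun i : nat => y (k - - (i.+1)%:Z) r (Z (- (i.+1)%:Z) w)))}.
Proof.
have [K [pm _]] := mom2.
exact: (linear_series_cvg iidZ pm sg2).
Qed.

Context (Xl : int -> 'I_s -> T -> R).
Hypothesis mXl : forall k r, measurable_fun setT (Xl k r).
Hypothesis cXl : {ae P, forall w, forall k r,
  \sum_(l <- window n) y (k - l) r (Z l w) @[n --> \oo] --> Xl k r w}.

Theorem product_strong_law :
  {ae P, forall w, n%:R `^ (- p^-1) *
    (\sum_(0 <= i < n) (\prod_r Xl i.+1%:Z r w -
       Ex P (fun w' => \prod_r Xl i.+1%:Z r w'))) @[n --> \oo] --> 0}.
Proof.
have [K [pm [hs ht]]] := mom2.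
have [|A0 A0_ge0 eA'] := @pw_shift_bound R (2 * sg); first by move: sg2; lra.
have eA k ls : uniq ls -> \sum_(l <- ls) pw sg (k - l) ^+ 2 <= A0.
  by move=> u; under eq_bigr do rewrite sqr_pw; exact: eA'.
have [Cb [b [th [b0 Cb0 th1 bth [thp covb]]]]] := cov_bound pm eA hs.
have [Cth Cth0 blockb] := pw_block b0 th1 bth.
exact: (truncated_strong_law iidZ pm eA al12 hs ht covb Cb0 blockb p1 pal th1 thp Cth0 mXl cXl).
Qed.

End product_strong_law.

(** * Moments and matrices *)

Section tail_moments.
Context d (T : measurableType d) (R : realType) (P : probability T R).

(** Raising the truncation level from [2 ^+ n] to [2 ^+ n.+1] costs at most [(2 ^+ n.+1) ^ al] times
    the probability of exceeding [2 ^+ n], which is a constant times [q ^+ n]. Fatou removes the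
    truncation. *)
Lemma L1_powR_tail (f : T -> R) (a al K : R) : measurable_fun setT f ->
  (forall w, 0 <= f w) -> 0 < al -> al < a -> 0 <= K ->
  (forall t, 1 <= t -> ((t `^ a)%:E * P [set w | (t < f w)%R] <= K%:E)%E) ->
  L1 P (fun w => f w `^ al).
Proof.
move=> mf f0 al0 ala K0 tail.
pose g n w : R := Num.min (f w) (2 ^+ n) `^ al.
have mlt (t : R) : measurable [set w | t < f w].
  rewrite (_ : [set w | t < f w] = ~` [set w | f w <= t]); last first.
    by apply/seteqP; split => w /=; rewrite ltNge => /negP.
  apply: measurableC; rewrite -[X in measurable X]setTI.
  by apply: measurable_fun_le => //; exact: measurable_cst.
have two0 n : 0 <= 2 ^+ n :> R by exact: exprn_ge0.
have m0 n w : 0 <= Num.min (f w) (2 ^+ n) by rewrite le_min f0 two0.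
have mg n : measurable_fun setT (g n).
  apply: (measurableT_comp (measurable_powR al)).
  by apply: measurable_minr.
have Lg n : L1 P (g n).
  apply: (L1_le (mg n) (L1_cst P ((2 ^+ n) `^ al))) => w.
  rewrite ger0_norm ?powR_ge0// ge0_ler_powR ?nnegrE ?(ltW al0)//.
  by rewrite ge_min lexx orbT.
have LI (t : R) : L1 P (\1_[set w | t < f w]).
  apply: (L1_le _ (L1_cst P 1)) => [|w]; first exact: measurable_indic.
  by rewrite indicE; case: (_ \in _); rewrite ?normr1 ?normr0.
pose q : R := 2 `^ (al - a).
have q0 : 0 <= q by exact: powR_ge0.
have q1 : q < 1 by apply: powR_lt1; [rewrite ltr1n|rewrite subr_lt0].
have EI n : Ex P (\1_[set w | 2 ^+ n < f w]) <= K * (2 ^+ n) `^ (- a).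
  have t1 : 1 <= 2 ^+ n :> R by rewrite exprn_ege1// ler1n.
  have := tail _ t1; rewrite -[P _]fineK ?fin_num_measure// -EFinM lee_fin mulrC.
  rewrite -ler_pdivlMr ?powR_gt0 ?exprn_gt0// powRN.
  congr (_ <= _); rewrite /Ex /Rintegral; congr fine.
  by rewrite integral_indic ?setIT.
have step n : Ex P (g n.+1) <= Ex P (g n) + 2 `^ al * K * q ^+ n.
  apply: (@le_trans _ _ (Ex P (fun w => g n w + (2 ^+ n.+1) `^ al * \1_[set w | 2 ^+ n < f w] w))).
    apply: Ex_le => //; first by apply: L1D => //; exact: L1Z.
    move=> w; rewrite /g indicE; case: (ltP (2 ^+ n) (f w)) => h.
      rewrite mem_set//= mulr1 ler_wpDl ?powR_ge0//.
      by rewrite ge0_ler_powR ?nnegrE ?(ltW al0)// ge_min lexx orbT.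
    rewrite memNset/=; last by rewrite ltNge h.
    rewrite mulr0 addr0 min_l ?min_l//.
    by rewrite (le_trans h)// exprS ler_peMl// ler1n.
  rewrite ExD//; last exact: L1Z.
  rewrite lerD2l ExZ//.
  apply: (le_trans (ler_wpM2l (powR_ge0 _ _) (EI n))).
  rewrite le_eqVlt; apply/orP; left; apply/eqP.
  rewrite /q -!powR_mulrn ?powR_ge0// -!powRrM mulrCA [RHS]mulrAC -!powRD ?pnatr_eq0 ?implybT//.
  by rewrite mulrC; congr (_ `^ _ * _); rewrite -natr1; ring.
have gE n : Ex P (g n) <= 1 + 2 `^ al * K * (1 - q)^-1.
  apply: (@le_trans _ _ (1 + 2 `^ al * K * \sum_(0 <= j < n) q ^+ j)); last first.
    by rewrite lerD2l ler_wpM2l ?mulr_ge0 ?powR_ge0// geo_sum_le.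
  elim: n => [|n IH].
    rewrite big_nil mulr0 addr0 -[leRHS](Ex_cst P 1); apply: Ex_le => //; first exact: L1_cst.
    move=> w; rewrite /g expr0; apply: (@le_trans _ _ (1 `^ al)); last by rewrite powR1.
    rewrite ge0_ler_powR ?nnegrE ?(ltW al0)//.
      by have := m0 0%N w.
    by rewrite ge_min lexx orbT.
  by rewrite (le_trans (step n))// big_nat_recr//= mulrDr addrA lerD2r.
have [|||//] := @Ex_fatou _ _ _ P g (fun w => f w `^ al) _ (fun n w => powR_ge0 _ _) _ _ Lg gE.
- exact: (measurableT_comp (measurable_powR al)).
- by move=> w; exact: powR_ge0.
- apply: aeW => w; apply: cvg_near_cst.
  near=> n; rewrite /g min_l//.
  have : f w <= n%:R by near: n; exact: nbhs_infty_ger.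
  move=> /le_trans; apply; rewrite -natrX ler_nat; exact/ltnW/ltn_expl.
Unshelve. all: by end_near. Qed.

(** A pointwise form of Hölder's inequality: every factor is at most [S ^ (1 / m)], so the squared
    product is at most [S ^ (2 #|D| / m) <= S], because [S >= 1]. *)
Lemma light_moment (s : nat) (F : 'I_s -> T -> R) (D : {set 'I_s}) m :
  (forall r, measurable_fun setT (F r)) -> (forall r w, 0 <= F r w) ->
  (forall r, L1 P (fun w => F r w ^+ m)) -> (0 < m)%N -> (#|D| * 2 <= m)%N ->
  L1 P (fun w => (\prod_(r in D) F r w) ^+ 2).
Proof.
move=> mF F0 LF m0 Dm.
have mP : measurable_fun setT (fun w => (\prod_(r in D) F r w) ^+ 2).
  apply: measurable_funX; under eq_fun do rewrite big_mkcond.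
  by apply: measurable_prod => r _; case: (_ \in _).
have LS : L1 P (fun w => 1 + \sum_r F r w ^+ m) by apply: L1D; [exact: L1_cst|exact: L1_sum].
apply: (L1_le mP LS) => w; rewrite ger0_norm ?sqr_ge0//.
set S := 1 + _.
have S1 : 1 <= S by rewrite lerDl sumr_ge0// => r _; exact: exprn_ge0.
have S0 : 0 <= S by exact: le_trans ler01 S1.
have mn0 : m%:R != 0 :> R by rewrite pnatr_eq0 -lt0n.
have FS r : F r w <= S `^ (m%:R^-1).
  have -> : F r w = (F r w ^+ m) `^ (m%:R^-1).
    by rewrite -powR_mulrn// -powRrM divff// powRr1.
  rewrite ge0_ler_powR ?nnegrE ?invr_ge0 ?ler0n ?exprn_ge0//.
  rewrite /S (bigD1 r)//= addrCA lerDl addr_ge0// sumr_ge0// => r' _; exact: exprn_ge0.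
have -> : S = S `^ 1 by rewrite powRr1.
apply: (@le_trans _ _ ((S `^ (m%:R^-1)) ^+ (#|D| * 2))).
  rewrite exprM ler_sqr ?nnegrE ?prodr_ge0 ?exprn_ge0 ?powR_ge0//.
  rewrite -prodr_const; apply: ler_prod => r _; by rewrite F0 FS.
rewrite -powR_mulrn ?powR_ge0// -powRrM ler_powR//.
by rewrite mulrC ler_pdivrMr ?ltr0n// mul1r ler_nat.
Qed.

End tail_moments.

(** * Limits of matrices and their measurability *)

Section limits_of_matrices.
Context (R : realType) (m n : nat).

Lemma cvg_mxP (u : nat -> 'M[R]_(m, n)) (M : 'M[R]_(m, n)) :
  (forall i j, u k i j @[k --> \oo] --> M i j) -> u k @[k --> \oo] --> M.
Proof.
move=> uM A [Q HQ sQA].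
have H : \forall k \near \oo, forall i j, Q i j (u k i j).
  apply: filter_forall => i; apply: filter_forall => j.
  exact: (uM i j _ (HQ i j)).
by apply: filterS H => k Hk; exact: sQA.
Qed.

Lemma cvg_mx_entry (u : nat -> 'M[R]_(m, n)) (M : 'M[R]_(m, n)) i j :
  u k @[k --> \oo] --> M -> u k i j @[k --> \oo] --> M i j.
Proof. by move=> uM; exact: (cvg_comp _ _ uM (@coord_continuous R m n i j M)). Qed.

Lemma lim_mx_entry (u : nat -> 'M[R]_(m, n)) i j :
  (forall i j, cvgn (fun k => u k i j)) -> limn u i j = limn (fun k => u k i j).
Proof.
move=> cu; pose M := \matrix_(i, j) limn (fun k => u k i j).
have uM : u k @[k --> \oo] --> M by apply: cvg_mxP => i' j'; rewrite mxE; exact: cu.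
by rewrite (cvg_lim _ uM)// mxE.
Qed.

Lemma cvg_mx_entries (u : nat -> 'M[R]_(m, n)) :
  cvgn u <-> forall i j, cvgn (fun k => u k i j).
Proof.
split=> [/cvg_ex[M uM] i j|cu]; first by apply/cvg_ex; exists (M i j); exact: cvg_mx_entry.
apply/cvg_ex; exists (\matrix_(i, j) limn (fun k => u k i j)).
by apply: cvg_mxP => i' j'; rewrite mxE; exact: cu.
Qed.

(** Expresses convergence by quantities that are measurable in a parameter. *)
Lemma cvgn_esup_einf (u : nat -> R) : cvgn u <->
  limn_esup (EFin \o u) = limn_einf (EFin \o u) /\ limn_esup (EFin \o u) \is a fin_num.
Proof.
split=> [/cvg_ex[l ul]|[E fin]].
  have ul' : (u k)%:E @[k --> \oo] --> l%:E by apply: cvg_EFin => //; exact: nearW.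
  by have [-> ->] := cvg_limn_einf_sup ul'.
have h1 : esups (EFin \o u) @ \oo --> limn_esup (EFin \o u).
  by rewrite limn_esup_lim; exact: is_cvg_esups.
have h2 : einfs (EFin \o u) @ \oo --> limn_esup (EFin \o u).
  by rewrite E limn_einf_lim; exact: is_cvg_einfs.
have h : (u k)%:E @[k --> \oo] --> limn_esup (EFin \o u).
  apply: (squeeze_cvge _ h2 h1); apply: nearW => k; apply/andP; split.
    by apply: ereal_inf_lbound; exists k => //=.
  by apply: ereal_sup_ubound; exists k => //=.
apply/cvg_ex; exists (fine (limn_esup (EFin \o u))).
by apply: (fine_cvg (f := fun k => (u k)%:E)); rewrite fineK.
Qed.

End limits_of_matrices.

Section measurable_limits.
Context d (T : measurableType d) (R : realType).

Lemma measurable_cvgn (u : nat -> T -> R) : (forall k, measurable_fun setT (u k)) ->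
  measurable_fun setT (fun w => `[< cvgn (u^~ w) >]).
Proof.
move=> mu; have mE k : measurable_fun setT (EFin \o u k) by exact/measurable_EFinP.
rewrite (_ : (fun w => _) = fun w => (limn_esup (fun k => (u k w)%:E) == limn_einf (fun k => (u k w)%:E)) &&
   (limn_esup (fun k => (u k w)%:E) \is a fin_num)); last first.
  apply/funext => w; apply/asboolP/andP => [/cvgn_esup_einf[/eqP ? ?]//|[/eqP E f]].
  exact/cvgn_esup_einf.
have m1 := measurable_fun_limn_esup mE.
have m2 : measurable_fun setT (fun w => limn_einf (fun k => (u k w)%:E)).
  apply: measurableT_comp => //; apply: measurable_fun_limn_esup => k.
  by apply: measurableT_comp => //; exact: mE.
apply: measurable_and; first exact: measurable_fun_eqe.
apply: (measurable_fun_bool true).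
exact: emeasurable_fin_num.
Qed.

(** Where the matrices diverge, [limn] is the default [point]. One diverging entry is enough for
    that, so the case distinction concerns all entries and not only [i], [j]. *)
Lemma measurable_lim_mx m n (u : nat -> T -> 'M[R]_(m, n)) i j :
  (forall k i j, measurable_fun setT (fun w => u k w i j)) ->
  measurable_fun setT (fun w => limn (u^~ w) i j).
Proof.
move=> mu.
rewrite (_ : (fun w => _) = fun w => if [forall i', forall j', `[< cvgn (fun k => u k w i' j') >]]
   then fine (limn_esup (fun k => (u k w i j)%:E)) else (point : 'M[R]_(m, n)) i j); last first.
  apply/funext => w; case: ifPn => [/forallP cu|/forallP cu].
    have cu' i' j' : cvgn (fun k => u k w i' j') by have /forallP/(_ j')/asboolP := cu i'.
    rewrite lim_mx_entry//; have /cvg_ex[l ul] := cu' i j.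
    have ul' : (u k w i j)%:E @[k --> \oo] --> l%:E by apply: cvg_EFin => //; exact: nearW.
    by have [_ ->] := cvg_limn_einf_sup ul'; rewrite (cvg_lim _ ul).
  rewrite dvgP// => /cvg_mx_entries cu'; apply: cu => i'; apply/forallP => j'; apply/asboolP; exact: cu'.
apply: measurable_fun_ifT => //.
  apply: (measurable_fun_bool true).
  rewrite setTI (_ : _ @^-1` _ = \bigcap_(ij in [set: 'I_m * 'I_n])
      ((fun w => `[< cvgn (fun k => u k w ij.1 ij.2) >]) @^-1` [set true])).
    apply: fin_bigcap_measurable => // ij _; rewrite -[X in measurable X]setTI.
    exact: (measurable_cvgn (fun k => mu k ij.1 ij.2)).
  apply/seteqP; split => w /=.
    by move=> /forallP cu [i' j'] _ /=; have /forallP/(_ j') := cu i'.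
  move=> cu; apply/forallP => i'; apply/forallP => j'; exact: (cu (i', j')).
apply: measurableT_comp => //; apply: measurable_fun_limn_esup => k.
exact/measurable_EFinP.
Qed.

End measurable_limits.

(** The generating family inside [mx_measurable], named so that matrices become a measurable
    type. *)
Definition coord_gen (R : realType) (m n : nat) : set (set 'M[R]_(m, n)) :=
  [set A | exists i j (B : set R), measurable B /\ A = [set M : 'M[R]_(m, n) | B (M i j)]].

Notation mxT R m n := (g_sigma_algebraType (@coord_gen R m n)).

Section matrix_iid.
Context d (T : measurableType d) (R : realType) (P : probability T R) (m n : nat).

Lemma measurable_coord i j : measurable_fun setT (fun A : mxT R m n => (A : 'M[R]_(m, n)) i j).
Proof.
move=> _ B mB; rewrite setTI; apply: sub_sigma_algebra.
by exists i, j, B.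
Qed.

Lemma iid_mx_family (Xi : int -> T -> 'M[R]_(m, n)) : iid_mx P Xi ->
  iid_family P (Xi : int -> T -> mxT R m n).
Proof.
case=> mXi indXi idXi; split.
- move=> l; apply: (@measurability _ _ T (mxT R m n) setT (Xi l) (@coord_gen R m n)) => // _ [_ [i [j [B [mB ->]]]] <-].
  exact: mXi.
- move=> ls A uls mA.
  have H := @indXi [fset l in ls]%fset A (fun l _ => mA l).
  rewrite (_ : [set` ls] = [set` [fset l in ls]%fset]); last first.
    by apply/seteqP; split => l /=; rewrite in_fset.
  rewrite H; apply: perm_big; rewrite uniq_perm// ?fset_uniq// => l.
  by rewrite in_fset.
- by move=> l l' A mA; exact: idXi.
Qed.

End matrix_iid.

(** * Norms, coefficients and rates *)

Section frobenius_norm.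
Context (R : realType).

Lemma frobenius_ge0 m n (A : 'M[R]_(m, n)) : 0 <= frobenius A.
Proof. exact: sqrtr_ge0. Qed.

Lemma frobeniusE m n (A : 'M[R]_(m, n)) :
  frobenius A = Num.sqrt (\sum_j \sum_i A i j ^+ 2).
Proof.
rewrite /frobenius /mxtrace; congr Num.sqrt; apply: eq_bigr => j _.
by rewrite !mxE; apply: eq_bigr => i _; rewrite !mxE expr2.
Qed.

Lemma entry_le_frobenius m n (A : 'M[R]_(m, n)) i j : `|A i j| <= frobenius A.
Proof.
rewrite frobeniusE -sqrtr_sqr ler_wsqrtr// (bigD1 j)//= (bigD1 i)//= -addrA lerDl.
rewrite addr_ge0//; first by rewrite sumr_ge0// => *; exact: sqr_ge0.
by rewrite sumr_ge0// => *; rewrite sumr_ge0// => *; exact: sqr_ge0.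
Qed.

Lemma mulmx_entry_le d m (C : 'M[R]_(d, m)) (v : 'cV[R]_m) i :
  `|(C *m v) i 0| <= m%:R * (frobenius C * frobenius v).
Proof.
rewrite mxE; apply: (le_trans (ler_norm_sum _ _ _)).
apply: (@le_trans _ _ (\sum_(j < m) frobenius C * frobenius v)).
  by apply: ler_sum => j _; rewrite normrM ler_pM// entry_le_frobenius.
by rewrite sumr_const card_ord -[leLHS]mulr_natl.
Qed.

Lemma measurable_frobenius d (T : measurableType d) m n (Y : T -> 'M[R]_(m, n)) :
  (forall i j, measurable_fun setT (fun w => Y w i j)) ->
  measurable_fun setT (fun w => frobenius (Y w)).
Proof.
move=> mY; under eq_fun do rewrite frobeniusE.
apply: measurableT_comp; first by apply: continuous_measurable_fun; exact: sqrt_continuous.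
apply: measurable_sum => j; apply: measurable_sum => i; exact: measurable_funX.
Qed.

End frobenius_norm.

(** The tail hypothesis speaks of the first values of a permutation. Listing [D] first and its
    complement afterwards turns this into a product over [D]. *)
Lemma perm_onto_set (s : nat) (D : {set 'I_s}) (R : comPzSemiRingType) :
  exists pi : 'S_s, forall G : 'I_s -> R,
    \prod_(k < s | (k < #|D|)%N) G (pi k) = \prod_(r in D) G r.
Proof.
pose q := enum D ++ enum (~: D)%SET.
have uq : uniq q.
  rewrite cat_uniq !enum_uniq andbT /=; apply/hasPn => r.
  by rewrite !mem_enum inE.
have sq : size q = s by rewrite size_cat -!cardE cardsC card_ord.
pose f (k : 'I_s) := nth k q k.
have fE (k : 'I_s) k0 : f k = nth k0 q k by apply: set_nth_default; rewrite sq.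
have inj : injective f.
  move=> k k'; rewrite (fE k k) (fE k' k) => /eqP; rewrite nth_uniq ?sq// => /eqP; exact: val_inj.
exists (perm inj) => G; rewrite [RHS](reindex_inj (@perm_inj _ (perm inj))).
apply: eq_bigl => k; rewrite permE /f nth_cat -cardE.
case: ltnP => h; first by rewrite -mem_enum mem_nth// -cardE.
apply/esym/negbTE; have /mem_nth : (k - #|D| < size (enum (~: D)%SET))%N.
  by rewrite -cardE ltn_subLR// cardsC card_ord.
by move=> /(_ k); rewrite mem_enum inE.
Qed.

(** For [l <> 0] it rests on [|l| + 1 <= 2 |l|] and [2 ^ sg <= 2]. For [sg > 0] the supremum says
    nothing about [l = 0], hence the summand [c 0] in the constant. *)
Lemma decay_bound (R : realType) (c : int -> R) (sg : R) : (forall l, 0 <= c l) -> 0 <= sg <= 1 ->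
  (ereal_sup [set ((`|l|%:~R `^ sg) * c l)%:E | l in [set: int]] < +oo)%E ->
  exists2 K : R, 0 <= K & forall l, c l <= K * pw sg l.
Proof.
move=> c0 /andP[sg0 sg1]; set S := ereal_sup _ => Soo.
have S0 : (0 <= S)%E.
  apply: (@le_trans _ _ ((`|0 : int|%:~R `^ sg) * c 0)%:E).
    by rewrite lee_fin mulr_ge0 ?powR_ge0.
  by apply: ereal_sup_ubound; exists 0.
have Sfin : S \is a fin_num by rewrite ge0_fin_numE.
have cS l : (`|l|%:~R `^ sg) * c l <= fine S.
  by rewrite -lee_fin fineK//; apply: ereal_sup_ubound; exists l.
exists (2 * fine S + c 0); first by rewrite addr_ge0// mulr_ge0// fine_ge0.
move=> l; have [->|l0] := eqVneq l 0.
  by rewrite /pw /pwn absz0 powR1 mulr1 lerDr mulr_ge0// fine_ge0.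
apply: (@le_trans _ _ (2 * fine S * pw sg l)); last first.
  by rewrite ler_wpM2r ?pw_ge0// lerDl.
rewrite /pw /pwn powRN ler_pdivlMr ?powR_gt0//.
apply: (@le_trans _ _ (c l * (2 * `|l|%:~R `^ sg))).
  rewrite ler_wpM2l//.
  have -> : (`|l|%:~R : R) = (absz l)%:R by rewrite -abszE -pmulrn.
  have L1 : (1 <= absz l)%N by rewrite absz_gt0.
  apply: (@le_trans _ _ ((2 * (absz l)%:R) `^ sg)).
    rewrite ge0_ler_powR ?nnegrE ?mulr_ge0 ?ler0n//.
    by rewrite -natrM ler_nat; lia.
  rewrite powRM ?ler0n// ler_wpM2r ?powR_ge0//.
  by rewrite -[leRHS]powRr1// ler_powR// ler1n.
by rewrite mulrCA ler_wpM2l// mulrC.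
Qed.

Lemma exponent_between (R : realFieldType) (p b : R) : 1 < b -> p < b ->
  exists p' al : R, [/\ 1 < p', p <= p', p' < al & al < b].
Proof.
move=> b1 pb; pose p' := Num.max p ((1 + b) / 2).
have p'b : p' < b by rewrite gt_max pb/=; lra.
have p'1 : 1 < p' by rewrite lt_max; apply/orP; right; lra.
exists p', ((p' + b) / 2); split => //; first by rewrite le_max lexx.
- by lra.
- by lra.
Qed.

Lemma rate_inv (R : realFieldType) (x p : R) : 1 < p -> 0 < x -> p < 2 / x -> x < 2 / p.
Proof.
move=> p1 x0; have p0 : 0 < p := lt_trans ltr01 p1.
by rewrite !ltr_pdivlMr// mulrC.
Qed.

(** [p] may be at most 1, while truncation needs exponents above 1; it is raised to [p'], with [al]
    strictly between [p'] and the bound. The bounds on [p] are inverted into bounds on [2 / p'], the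
    form in which they meet the covariances. *)
Lemma rate_choice (R : realType) (s : nat) (alpha0 : R) (sigma : 'I_s -> R) (p : R) :
  (0 < s)%N -> 1 < alpha0 -> (forall r, 1 / 2 < sigma r <= 1) ->
  (p%:E < rate_bound alpha0 sigma)%E ->
  exists p' al : R, [/\ 1 < p', p <= p', p' < al & 1 < al < 2] /\
    ((1 < s)%N -> al < alpha0) /\
    (if s == 2%N then 2 - (2 * \sum_r sigma r - 2) < 2 / p'
     else 3 - 2 * (\big[Num.min/1]_r sigma r) < 2 / p').
Proof.
move=> s0 a1 sg12.
have sgm : 1 / 2 < \big[Num.min/1]_r sigma r <= 1.
  apply/andP; split; last exact: bigmin_le_id.
  by apply: lt_bigmin => [|r _]; [lra|have /andP[] := sg12 r].
have b1 : 1 < 2 / (3 - 2 * \big[Num.min/1]_r sigma r).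
  by rewrite ltr_pdivlMr; lra.
have b2 : 2 / (3 - 2 * \big[Num.min/1]_r sigma r) <= 2.
  by rewrite ler_pdivrMr; lra.
have b3 : 0 < 3 - 2 * \big[Num.min/1]_r sigma r by lra.
case: s s0 sigma sg12 sgm b1 b2 b3 => [//|[|[|s']]] _ sigma sg12.
- rewrite /= big_ord_recl big_ord0 min_l; last by have /andP[] := sg12 ord0.
  rewrite lte_fin => sgm b1 b2 b3 pb.
  have [p' [al [p'1 pp' p'al alb]]] := exponent_between b1 pb.
  exists p', al; split; first by split => //; rewrite (lt_trans p'1 p'al) (lt_le_trans alb b2).
  by split => //; apply: rate_inv => //; exact: lt_trans p'al alb.
- move=> _ _ _ _; rewrite /= !lt_min !lte_fin => /andP[/andP[p2 pa] pS].
  have hS : \sum_r sigma r = sigma ord0 + sigma ord_max.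
    by rewrite big_ord_recr/= big_ord1; congr (sigma _ + _); apply: val_inj.
  have h0 := sg12 ord0; have h1 := sg12 ord_max.
  set x := 2 - sigma ord0 - sigma ord_max in pS.
  (* If both exponents are 1, the inverse is infinite and only [2] and [alpha0] limit [p]. *)
  have [x0|x0] := eqVneq x 0.
    pose b := Num.min 2 alpha0.
    have [||p' [al [p'1 pp' p'al]]] := @exponent_between _ p b; rewrite /b ?lt_min ?p2 ?pa ?a1 ?ltr1n//.
    move=> /andP[al2 ala]; exists p', al; split; first by split => //; rewrite (lt_trans p'1 p'al).
    split => //; rewrite hS; apply: (@le_lt_trans _ _ 0); first by move: x0; rewrite /x; lra.
    by rewrite divr_gt0// (lt_trans ltr01).
  have xp : 0 < x by rewrite lt_neqAle eq_sym x0/= /x; lra.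
  have x1 : x < 1 by rewrite /x; lra.
  pose b := Num.min (Num.min 2 alpha0) x^-1.
  move: pS; rewrite inver (negbTE x0) lte_fin => pS.
  have [||p' [al [p'1 pp' p'al]]] := @exponent_between _ p b; rewrite /b ?lt_min ?p2 ?pa ?a1 ?pS ?ltr1n ?invf_gt1//.
  move=> /andP[/andP[al2 ala] alx]; exists p', al; split; first by split => //; rewrite (lt_trans p'1 p'al).
  split => //; rewrite hS (_ : 2 - _ = 2 * x); last by rewrite /x; ring.
  apply: rate_inv => //; first by rewrite mulr_gt0.
  rewrite invfM mulrA divff ?mul1r ?pnatr_eq0//; exact: lt_trans p'al alx.
- move=> sgm b1 b2 b3; rewrite /= lt_min !lte_fin => /andP[pa pb].
  have [||p' [al [p'1 pp' p'al]]] := @exponent_between _ p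
    (Num.min alpha0 (2 / (3 - 2 * \big[Num.min/1]_r sigma r))); rewrite ?lt_min ?a1 ?b1 ?pa ?pb//.
  move=> /andP[ala alb]; exists p', al; split; first by split => //; rewrite (lt_trans p'1 p'al) (lt_le_trans alb b2).
  by split => //; apply: rate_inv => //; exact: lt_trans p'al alb.
Qed.

(** The hypotheses on moments and tails concern index 1, whereas the family takes its moments at
    index 0. *)
Lemma iid_L1_transfer d (T : measurableType d) (R : realType) (P : probability T R)
    d' (E : measurableType d') (Z : int -> T -> E) (phi : E -> R) l :
  iid_family P Z -> measurable_fun setT phi ->
  L1 P (fun w => phi (Z l w)) -> L1 P (fun w => phi (Z 0 w)).
Proof.
move=> iidZ mphi /L1P[_ fi]; apply/L1P; split.
  by apply: measurableT_comp => //; exact: iid_measurable iidZ 0.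
rewrite -(iid_integral_ge0 iidZ l (phi := fun x => `|phi x|%:E))//.
by apply/measurable_EFinP; exact: measurableT_comp.
Qed.

Lemma powR_slower (R : realType) (p p' : R) (S : nat -> R) : 0 < p -> p <= p' ->
  n%:R `^ (- p'^-1) * S n @[n --> \oo] --> 0 ->
  n%:R `^ (- p^-1) * S n @[n --> \oo] --> 0.
Proof.
move=> p0 pp' /cvg_norm; rewrite normr0 => c; apply/norm_cvg0P.
apply: (squeeze_cvgr _ (cvg_cst 0) c); near=> n.
have n0 : (0 < n)%N by near: n; exists 1%N.
rewrite normr_ge0/= !normrM ler_wpM2r// !ger0_norm ?powR_ge0//.
rewrite ler_powR ?ler1n// lerN2 lef_pV2 ?posrE//; exact: lt_le_trans pp'.
Unshelve. all: by end_near. Qed.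

(** * Verification of the model for linear processes *)

Section linear_processes.
Context disp (T : measurableType disp) (R : realType) (P : probability T R).
Context (s m d : nat) (s_gt0 : (0 < s)%N).
Context (alpha : nat -> R) (alpha0_gt1 : 1 < alpha 0%N)
  (alphaE : forall i : nat, (1 <= i <= (s.-1)./2)%N ->
     alpha i = s%:R / (s - i)%:R * alpha 0%N).
Context (Xi : int -> T -> 'M[R]_(m, s)) (Xi_iid : iid_mx P Xi).
Hypothesis Xi_mean0 : forall l i j, ('E_P[fun w => Xi l w i j] = 0)%E.
Hypothesis Xi_moment : forall r : 'I_s,
  ('E_P[fun w => (frobenius (col r (Xi 1 w)) ^+ maxn s 2)%R] < +oo)%E.
Hypothesis Xi_tail :
  (\big[maxe/-oo]_(pi : 'S_s) \big[maxe/-oo]_(0 <= i < (s.-1)./2.+1)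
     ereal_sup
       [set (t `^ alpha i)%:E *
            P [set w | (t < \prod_(k < s | (k < s - i)%N)
                              frobenius (col (pi k) (Xi 1 w)))%R]
          | t in [set t : R | (0 <= t)%R]] < +oo)%E.
Local Notation E := (mxT R m s).
Let Z : int -> T -> E := Xi.
Let iidZ : iid_family P Z := iid_mx_family Xi_iid.
Let F (r : 'I_s) (A : E) : R := frobenius (col r (A : 'M[R]_(m, s))).

Let mF r : measurable_fun setT (F r).
Proof.
apply: measurable_frobenius => i j; under eq_fun do rewrite mxE.
exact: measurable_coord.
Qed.

Let F0 r A : 0 <= F r A. Proof. exact: frobenius_ge0. Qed.

Let mFD (D : {set 'I_s}) : measurable_fun setT (fun A => \prod_(r in D) F r A).
Proof.
under eq_fun do rewrite big_mkcond.
by apply: measurable_prod => r _; case: (_ \in _).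
Qed.

Let mFZ l r : measurable_fun setT (fun w => F r (Z l w)).
Proof. by apply: measurableT_comp => //; exact: iid_measurable iidZ l. Qed.

Let light_F (D : {set 'I_s}) : light D -> L1 P (fun w => (\prod_(r in D) F r (Z 0 w)) ^+ 2).
Proof.
move=> lD; apply: (@iid_L1_transfer _ _ _ _ _ _ Z (fun A => (\prod_(r in D) F r A) ^+ 2) 1) => //.
  exact: measurable_funX.
apply: (@light_moment _ _ _ P s (fun r w => F r (Z 1 w)) D (maxn s 2)) => //.
- move=> r; apply: L1_ge0; first exact: measurable_funX.
    by move=> w; rewrite exprn_ge0.
  by have := Xi_moment r; rewrite unlock.
- by rewrite leq_max orbT.
Qed.

(** With [i = s - #|D|], heaviness means that [i] is in the range of the tail hypothesis. Since
    [alpha i >= alpha 0], its exponent can be lowered to [alpha 0] for [t >= 1]. *)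
Let tail_F (D : {set 'I_s}) : ~~ light D -> exists2 K : R, 0 <= K &
  forall t, 1 <= t -> ((t `^ alpha 0%N)%:E *
    P [set w | (t < \prod_(r in D) F r (Z 1%R w))%R] <= K%:E)%E.
Proof.
rewrite /light -ltnNge => hD.
have Ds : (#|D| <= s)%N by rewrite -[leqRHS]card_ord max_card.
have [i iE] : exists i, i = (s - #|D|)%N by eexists.
have i2 : (i < (s.-1)./2.+1)%N by move: hD Ds s_gt0; rewrite iE; lia.
have siD : (s - i = #|D|)%N by rewrite iE subKn.
have a0 : 0 <= alpha 0%N by move: alpha0_gt1; lra.
have ai : alpha 0%N <= alpha i.
  have [->//|i0] := eqVneq i 0%N.
  rewrite [leRHS]alphaE; last by rewrite lt0n i0 -ltnS.
  rewrite siD ler_peMl// ler_pdivlMr ?mul1r ?ler_nat// ltr0n; lia.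
have [pi piE] := perm_onto_set D R.
pose Sf i := ereal_sup [set ((t `^ alpha i)%:E *
  P [set w | (t < \prod_(k < s | (k < s - i)%N) frobenius (col (pi k) (Xi 1%R w)))%R])%E
  | t in [set t : R | (0 <= t)%R]].
pose S := Sf i.
have Soo : (S < +oo)%E.
  apply: le_lt_trans Xi_tail; apply: le_trans (le_bigmax _ _ pi).
  by apply: (@le_bigmax_seq _ _ _ _ _ i xpredT Sf) => //; rewrite mem_index_iota.
have tS t : 0 <= t -> ((t `^ alpha i)%:E * P [set w | (t < \prod_(r in D) F r (Z 1%R w))%R] <= S)%E.
  move=> t0; apply: ereal_sup_ubound; exists t => //; congr (_ * P _)%E.
  by apply/funext => w /=; rewrite siD (piE (fun r => frobenius (col r (Xi 1 w)))).
have S0 : (0 <= S)%E by apply: le_trans (tS 0 (lexx 0)); rewrite mule_ge0// lee_fin powR_ge0.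
exists (fine S) => [|t t1]; first exact: fine_ge0.
rewrite fineK ?ge0_fin_numE//; apply: le_trans (tS t (le_trans ler01 t1)).
by rewrite lee_wpmul2r// lee_fin ler_powR.
Qed.

Let heavy_F (D : {set 'I_s}) al : ~~ light D -> 0 < al -> al < alpha 0%N ->
  L1 P (fun w => (\prod_(r in D) F r (Z 0 w)) `^ al).
Proof.
move=> hD al0 ala; apply: (@iid_L1_transfer _ _ _ _ _ _ Z (fun A => (\prod_(r in D) F r A) `^ al) 1) => //.
  exact: (measurableT_comp (measurable_powR al)).
have [K K0 HK] := tail_F hD.
apply: (@L1_powR_tail _ _ _ P _ (alpha 0%N) al K) => //.
  by apply: (measurableT_comp (mFD D)); exact: iid_measurable iidZ 1.
by move=> w; apply: prodr_ge0.
Qed.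

Let entry_L1 j r : L1 P (fun w => Xi 0 w j r).
Proof.
have L2 : L1 P (fun w => F r (Z 0 w) ^+ 2).
  have := light_F (D := [set r]%SET); rewrite /light cards1 mul1n leq_maxr => /(_ isT).
  by under eq_fun do rewrite big_set1.
apply: (L1_le _ (L1_sqr (mFZ 0 r) L2)); first by case: Xi_iid => mXi _ _; exact: mXi.
by move=> w; have := entry_le_frobenius (col r (Xi 0 w)) j 0; rewrite mxE.
Qed.

Context (C : int -> 'I_s -> 'M[R]_(d, m)) (sigma : 'I_s -> R)
  (sigma_bounds : forall r : 'I_s, 1 / 2 < sigma r <= 1)
  (C_decay : forall r : 'I_s,
     (ereal_sup [set ((`|l|%:~R `^ sigma r) * frobenius (C l r))%:E
                   | l in [set: int]] < +oo)%E).

Let y (i : 'I_s -> 'I_d) (h : int) (r : 'I_s) (A : E) : R :=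
  (C h r *m col r (A : 'M[R]_(m, s))) (i r) 0.

Let yE i h r A : y i h r A = \sum_j C h r (i r) j * (A : 'M[R]_(m, s)) j r.
Proof. by rewrite /y mxE; apply: eq_bigr => j _; rewrite mxE. Qed.

Let my i h r : measurable_fun setT (y i h r).
Proof.
rewrite (_ : y i h r = fun A => \sum_j C h r (i r) j * (A : 'M[R]_(m, s)) j r); last exact/funext.
by apply: measurable_sum => j; apply: measurable_funM => //; exact: measurable_coord.
Qed.

Let y_mean i h r : Mu P Z (y i h r) = 0.
Proof.
rewrite /Mu; under eq_Ex do rewrite yE.
rewrite Ex_sum; last by move=> j; apply: L1Z; exact: entry_L1.
rewrite big1// => j _; rewrite ExZ; last exact: entry_L1.
have := Xi_mean0 0 j r; rewrite unlock => H.
by rewrite (Ex_integral H) mulr0.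
Qed.

Let norm_bound : exists2 c : R, 0 <= c &
  forall i h r A, `|y i h r A| <= pw (sigma r) h * (c * F r A).
Proof.
have H r : exists2 K : R, 0 <= K & forall l, frobenius (C l r) <= K * pw (sigma r) l.
  apply: decay_bound => //; first by move=> l; exact: frobenius_ge0.
  by have /andP[s1 ->] := sigma_bounds r; rewrite andbT; lra.
have [Kf Kf0 KfE] := fin_all_exists2 H.
exists (m%:R * \sum_r Kf r) => [|i h r A]; first by rewrite mulr_ge0// sumr_ge0.
apply: (le_trans (mulmx_entry_le _ _ _)).
rewrite [leRHS](_ : _ = m%:R * ((\sum_r Kf r) * pw (sigma r) h * F r A)); last by ring.
apply: ler_wpM2l; first exact: ler0n.
apply: ler_wpM2r; first exact: F0.
apply: (le_trans (KfE r h)); apply: ler_wpM2r; first exact: pw_ge0.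
exact: le_sum_bigop.
Qed.

Local Notation X := (linear_process C Xi).

Let XE k r w i : X k r w i 0 =
  limn (fun n => \sum_(0 <= l < n) (C (k - l%:Z) r *m col r (Xi l%:Z w))) i 0 +
  limn (fun n => \sum_(0 <= l < n) (C (k - - (l.+1)%:Z) r *m col r (Xi (- (l.+1)%:Z) w))) i 0.
Proof. by rewrite /linear_process /seriesZ mxE. Qed.

Let mX k r i : measurable_fun setT (fun w => X k r w i 0).
Proof.
under eq_fun do rewrite XE.
have mC h l i' j : measurable_fun setT (fun w => (C h r *m col r (Xi l w)) i' j).
  by rewrite ord1; apply: measurableT_comp (my (fun=> i') h r) (iid_measurable iidZ l).
apply: measurable_funD.
  apply: (measurable_lim_mx
    (u := fun n w => \sum_(0 <= l < n) (C (k - l%:Z) r *m col r (Xi l%:Z w)))) => n i' j.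
  by under eq_fun do rewrite summxE; exact: measurable_sum.
apply: (measurable_lim_mx
    (u := fun n w => \sum_(0 <= l < n) (C (k - - (l.+1)%:Z) r *m col r (Xi (- (l.+1)%:Z) w)))) => n i' j.
by under eq_fun do rewrite summxE; exact: measurable_sum.
Qed.

Context (p al p' : R).
Hypothesis p_gt0 : 0 < p.
Hypothesis pp' : p <= p'.
Hypothesis p'1 : 1 < p'.
Hypothesis p'al : p' < al.
Hypothesis al12 : 1 < al < 2.
Hypothesis al_alpha : (1 < s)%N -> al < alpha 0%N.
Hypothesis rate : if s == 2%N then 2 - (2 * \sum_r sigma r - 2) < 2 / p'
  else 3 - 2 * (\big[Num.min/1]_r sigma r) < 2 / p'.

Let sg_half : 1 / 2 < \big[Num.min/1]_r sigma r.
Proof. by apply: lt_bigmin => [|r _]; [lra|have /andP[] := sigma_bounds r]. Qed.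

Theorem linear_process_strong_law (i : {ffun 'I_s -> 'I_d}) :
  {ae P, forall w, n%:R `^ (- p^-1) * (\sum_(1 <= k < n.+1)
     (tensor (fun r => X k%:Z r w) i -
      fine 'E_P[fun w' => tensor (fun r => X k%:Z r w') i]%E)) @[n --> \oo] --> 0}.
Proof.
have [c c0 yc] := norm_bound.
pose N r A := c * F r A.
have prodN D A : prodD N D A = c ^+ #|D| * \prod_(r in D) F r A.
  by rewrite /prodD big_split/= prodr_const.
have mN r : measurable_fun setT (N r) by apply: measurable_funM.
have N0 r A : 0 <= N r A by rewrite mulr_ge0.
have light_N D : light D -> L1 P (fun w => prodD N D (Z 0 w) ^+ 2).
  by move=> lD; under eq_fun do rewrite prodN exprMn; apply: L1Z; exact: light_F.
have heavy_N D : ~~ light D -> L1 P (fun w => prodD N D (Z 0 w) `^ al).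
  move=> hD; under eq_fun do rewrite prodN powRM ?exprn_ge0 ?prodr_ge0//.
  apply: L1Z; apply: heavy_F => //; first by move: al12; lra.
  apply: al_alpha; apply: leq_trans (heavy_card hD) _.
  by rewrite -[leqRHS]card_ord max_card.
have sgle r : \big[Num.min/1]_r sigma r <= sigma r by exact: bigmin_le.
have sg1 r : sigma r <= 1 by have /andP[] := sigma_bounds r.
(* Each row [j] is used for all factors at once: the limit of vectors may be read off entrywise only
   after every entry is known to converge. *)
have cvg_rows : {ae P, forall w, forall j k r,
  cvgn (series (fun l : nat => y (fun=> j) (k - l%:Z) r (Z l%:Z w))) /\
  cvgn (series (fun l : nat => y (fun=> j) (k - - (l.+1)%:Z) r (Z (- (l.+1)%:Z) w)))}.
  apply: filter_forall => j.
  have := product_series_cvg iidZ al12 (my (fun=> j)) mN N0 (yc (fun=> j))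
    (y_mean (fun=> j)) light_N heavy_N sg_half sgle.
  by apply: filterS => w.
have rowE (h z : nat -> int) r w i' j' :
    (fun n => (\sum_(0 <= l < n) (C (h l) r *m col r (Xi (z l) w))) i' j') =
    series (fun l => y (fun=> i') (h l) r (Z (z l) w)).
  by apply/funext => n; rewrite summxE ord1.
have cX : {ae P, forall w, forall k r,
    \sum_(l <- window n) y i (k - l) r (Z l w) @[n --> \oo] --> X k r w (i r) 0}.
  apply: filterS cvg_rows => w cw k r; rewrite XE.
  under eq_fun do rewrite sum_window.
  apply: cvgD; rewrite lim_mx_entry => [|i' j'].
  - by rewrite rowE; have [+ _] := cw (i r) k r.
  - by rewrite rowE; have [+ _] := cw i' k r.
  - by rewrite rowE; have [_ +] := cw (i r) k r.
  - by rewrite rowE; have [_ +] := cw i' k r.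
have := product_strong_law iidZ s_gt0 al12 p'1 p'al (my i) mN N0 (yc i) (y_mean i)
  light_N heavy_N sg_half sgle sg1 rate (fun k r => mX k r (i r)) cX.
apply: filterS => w cw; apply: (powR_slower p_gt0 pp').
rewrite [X in X @ _ --> _](_ : _ = fun n => n%:R `^ (- p'^-1) * \sum_(0 <= k < n)
    (\prod_r X k.+1%:Z r w (i r) 0 - Ex P (fun w' => \prod_r X k.+1%:Z r w' (i r) 0)))//.
by apply/funext => n; rewrite big_add1/=; congr (_ * _); apply: eq_bigr => k _; rewrite unlock.
Qed.

End linear_processes.

Theorem theorem2 (R : realType) (disp : measure_display)
  (T : measurableType disp) (P : probability T R)
  (s m d : nat) (s_gt0 : (0 < s)%N) (m_gt0 : (0 < m)%N) (d_gt0 : (0 < d)%N)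
  (alpha : nat -> R) (alpha0_gt1 : 1 < alpha 0%N)
  (alphaE : forall i : nat, (1 <= i <= (s.-1)./2)%N ->
     alpha i = s%:R / (s - i)%:R * alpha 0%N)
  (Xi : int -> T -> 'M[R]_(m, s))
  (Xi_iid : iid_mx P Xi)
  (Xi_mean0 : forall l i j, ('E_P[fun w => Xi l w i j] = 0)%E)
  (Xi_moment : forall r : 'I_s,
     ('E_P[fun w => (frobenius (col r (Xi 1 w)) ^+ maxn s 2)%R] < +oo)%E)
  (Xi_tail :
     (\big[maxe/-oo]_(pi : 'S_s) \big[maxe/-oo]_(0 <= i < (s.-1)./2.+1)
        ereal_sup
          [set (t `^ alpha i)%:E *
               P [set w | (t < \prod_(k < s | (k < s - i)%N)
                                 frobenius (col (pi k) (Xi 1 w)))%R]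
             | t in [set t : R | (0 <= t)%R]] < +oo)%E)
  (C : int -> 'I_s -> 'M[R]_(d, m)) (sigma : 'I_s -> R)
  (sigma_bounds : forall r : 'I_s, 1 / 2 < sigma r <= 1)
  (C_decay : forall r : 'I_s,
     (ereal_sup [set ((`|l|%:~R `^ sigma r) * frobenius (C l r))%:E
                   | l in [set: int]] < +oo)%E)
  (p : R) (p_gt0 : 0 < p) (p_lt : (p%:E < rate_bound (alpha 0%N) sigma)%E) :
  let X := linear_process C Xi in
  {ae P, forall w, forall i : {ffun 'I_s -> 'I_d},
    n%:R `^ (- p^-1) *
      (\sum_(1 <= k < n.+1)
         (tensor (fun r => X k%:Z r w) i -
          fine 'E_P[fun w' => tensor (fun r => X k%:Z r w') i]%E))
    @[n --> \oo] --> 0}.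
Proof.
move=> X; have [p' [al [[p'1 pp' p'al al12] [al_alpha rate]]]] :=
  rate_choice s_gt0 alpha0_gt1 sigma_bounds p_lt.
apply: filter_forall => i.
exact: (linear_process_strong_law s_gt0 alpha0_gt1 alphaE Xi_iid Xi_mean0 Xi_moment
  Xi_tail sigma_bounds C_decay p_gt0 pp' p'1 p'al al12 al_alpha rate).
Qed.
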